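(* Let $\{B(t):t\in[0,1]\}$ be a standard two-dimensional Brownian motion. Then, almost surely, there exists a compact set $D\subset[0,1]$ such that $B$ is non-decreasing on $D$ and $\dim_{\mathcal H}D\ge1/3$.
   Context: A function $f\colon[0,1]\to\mathbb R^d$ is non-decreasing on a set $A\subset[0,1]$ if all the coordinate functions of $f|_A$ are non-decreasing. $\dim_{\mathcal H}$ is Hausdorff dimension. *)

(* Defs.v *)
From mathcomp Require Import all_boot all_order all_algebra.
From mathcomp Require Import all_classical all_reals all_analysis.

Set Implicit Arguments.
Unset Strict Implicit.
Unset Printing Implicit Defensive.

Import Order.TTheory GRing.Theory Num.Theory.
Import numFieldNormedType.Exports.

Local Open Scope classical_set_scope.
Local Open Scope ring_scope.

Section hausdorff.
Context {R : realType} {X : normedModType R}.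
Local Open Scope ereal_scope.

(* 0 is added to the set so that the diameter of set0 is 0 and not -oo. *)
Definition diam (A : set X) : \bar R :=
  ereal_sup (0 |` [set `|x - y|%:E | x in A & y in A]).

(* The empty set contributes 0 even when s = 0, although 0 `^ 0 = 1; thus the
   0-dimensional Hausdorff measure is the counting measure. *)
Definition diam_pow (s : R) (A : set X) : \bar R :=
  if A == set0 then 0 else diam A `^ s.

Definition hausdorff_premeasure (s delta : R) (A : set X) : \bar R :=
  ereal_inf [set \sum_(0 <= n <oo) diam_pow s (U n) | U in
    [set U : (set X)^nat | A `<=` \bigcup_n U n /\
                           forall n, diam (U n) <= delta%:E]].

Definition hausdorff_measure (s : R) (A : set X) : \bar R :=
  ereal_sup [set hausdorff_premeasure s delta A | delta in
    [set delta : R | (0 < delta)%R]].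

Definition hausdorff_dim (A : set X) : \bar R :=
  ereal_inf [set s%:E | s in
    [set s : R | (0 <= s)%R /\ hausdorff_measure s A = 0]].

End hausdorff.

Definition nondecreasing_on {R : realType} {d : nat}
    (A : set R) (f : R -> 'rV[R]_d) : Prop :=
  forall i : 'I_d, {in A &, {homo (fun t => f t ord0 i) : s t / s <= t}}.

Section brownian_motion.
Context {R : realType} {d : measure_display} {T : measurableType d}.
Variable P : probability T R.

(* Intended for families of sigma-algebras: as each F i then contains setT, the
   product rule over the whole of I covers all subfamilies. *)
Definition independent_sigma_algebras {I : finType} (F : I -> set_system T) :=
  forall E : I -> set T, (forall i, F i (E i)) ->
    P (\bigcap_i E i) = (\prod_i P (E i))%E.

Definition independent_RVs {I : finType} (X : I -> T -> R) :=
  independent_sigma_algebras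
    (fun i => preimage_set_system setT (X i) measurable).

Definition process_sigma_algebra (D : set R) (X : R -> T -> R) : set_system T :=
  <<s \bigcup_(t in D) preimage_set_system setT (X t) measurable >>.

(* Paths are total functions on R, but only times in [0, 1] are constrained.
   The second parameter of normal_prob is the standard deviation; s < t is
   strict because normal_prob 0 0 is not a Dirac mass. *)
Record standard_linear_BM (X : R -> T -> R) : Prop := {
  BM_measurable : forall t, `[0, 1]%classic t -> measurable_fun setT (X t) ;
  BM_start : {ae P, forall w, X 0 w = 0} ;
  BM_independent_increments : forall (n : nat) (t : nat -> R),
    (forall k, (k <= n)%N -> `[0, 1]%classic (t k)) ->
    (forall k, (k < n)%N -> t k <= t k.+1) ->
    independent_RVs (fun (i : 'I_n) w => X (t i.+1) w - X (t i) w) ;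
  BM_gaussian_increments : forall s t, 0 <= s -> s < t -> t <= 1 ->
    forall A : set R, measurable A ->
      P ((fun w => X t w - X s w) @^-1` A) =
      normal_prob 0 (Num.sqrt (t - s)) A ;
  BM_continuous :
    {ae P, forall w, {within `[0, 1], continuous (fun t => X t w)}} }.

Record standard_BM (n : nat) (B : R -> T -> 'rV[R]_n) : Prop := {
  BM_coordinates : forall i : 'I_n,
    standard_linear_BM (fun t w => B t w ord0 i) ;
  BM_independent_coordinates :
    independent_sigma_algebras (fun i : 'I_n =>
      process_sigma_algebra `[0, 1] (fun t w => B t w ord0 i)) }.

End brownian_motion.

(* Main.v *)
From HB Require Import structures.
Require Import Defs.
From mathcomp Require Import all_boot all_order all_algebra.
From mathcomp Require Import all_classical all_reals all_analysis.
From mathcomp Require Import measurable_realfun normal_distribution.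
From mathcomp Require Import ring lra.

(** The set [D] is the closure of the range of an increasing map [h] from the unit
    interval to times, along which both coordinates of the path increase and
    which jumps by at least [r i] across each dyadic point of level [i]. Covers
    of [D] pull back to covers of the unit interval ([hausdorff_dim_ge]), so the
    dimension is at least [1 / 3] as soon as [r i] is, up to factors of lower
    order, at least [2 ^ (- 3 * i)].

    A discrete version of [h] is a chain of [2 ^ J] times. Each stage of the chain
    first waits for a compulsory delay, [r i] if it leads to a dyadic point of
    level [i], and then for the first moment at which the path lies in the closed
    first quadrant as seen from the previous time of the chain. The question is
    whether all stages are complete before time 1. Until the quadrant is reached
    the displacement stays in a cone of aperture [3 * pi / 2], on which
    [r ^ p * cos (q * theta)] is positive and superharmonic for [p < q < 2 / 3]
    ([barrier_superharmonic]). Therefore a stage with delay [t] has an expected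
    cost, the [p]-th power of the first coordinate of its displacement, of at most
    a multiple of [t ^ (p / 2)] ([waiting_potential]). Since there are
    [2 ^ (i - 1)] stages of level [i], delays slightly shorter than
    [2 ^ (- 3 * i)] make the total expected cost small, uniformly in [J], when
    [p] tends slowly to [2 / 3] with the level ([exists_delay_scales]). This is
    where [1 / 3], half of [2 / 3], comes from.

    If the total cost is at most [rho <= 1], then so is the displacement of the
    first coordinate, because [p <= 1]. Brownian motion is unlikely to be that
    close to its start at time 1, so that all stages are then complete by that time
    ([stage_times_exist], [skeleton_probability]). To avoid stopping times in
    continuous time, the chain runs on a fine grid of times. It becomes a Markov
    chain driven by independent increments, and the sum of the cost paid so far
    and the potential of what remains is a supermartingale
    ([supermartingale_expectation]). The estimates hold for discrete increments
    because they use only their first four moments ([quartic_moments]).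

    With probability at least [1 - 2 * rho] chains exist for infinitely many [J]
    ([measure_eventually_le]). By continuity of the path their limit along an
    ultrafilter is the required [h] ([monotone_set_of_skeletons]). Letting [rho]
    tend to 0 along a sequence gives the almost sure statement. *)

Set Implicit Arguments.
Unset Strict Implicit.
Unset Printing Implicit Defensive.

Import Order.TTheory GRing.Theory Num.Theory.
Import numFieldNormedType.Exports.

Local Open Scope classical_set_scope.
Local Open Scope ring_scope.

(** * Second order Taylor estimates *)

Section taylor.
Context {R : realType}.

(** Mean value theorem for a function that vanishes at 0: a bound on the
    derivative gains one order of vanishing. *)
Lemma le_norm_of_derive (g dg : R -> R) (c M : R) (k : nat) :
  (forall x : R, `|x| <= c -> is_derive x 1 g (dg x)) -> g 0 = 0 ->
  (forall x, `|x| <= c -> `|dg x| <= M * `|x| ^+ k) ->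
  forall x, `|x| <= c -> `|g x| <= M * `|x| ^+ k.+1.
Proof.
move=> dgP g0 dgle x xc.
have M0 : `|x| != 0 -> 0 <= M.
  move=> x0; have := le_trans (normr_ge0 _) (dgle x xc).
  by rewrite pmulr_lge0// exprn_gt0// lt0r x0 normr_ge0.
have key a b : a < b -> (forall t, a <= t <= b -> `|t| <= `|x|) ->
    `|g b - g a| <= M * `|x| ^+ k * (b - a).
  move=> ab tx.
  have [||t] := @MVT R g dg a b ab.
  - move=> t; rewrite in_itv/= => /andP[at_ tb]; apply: dgP.
    by apply: le_trans xc; apply: tx; rewrite !ltW.
  - apply: continuous_in_subspaceT => t; rewrite inE/= in_itv/= => tab.
    apply: differentiable_continuous; apply/derivable1_diffP.
    by have [] := dgP t (le_trans (tx t tab) xc).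
  rewrite in_itv/= => /andP[at_ tb] ->.
  have tx' : `|t| <= `|x| by apply: tx; rewrite !ltW.
  rewrite normrM (gtr0_norm (_ : 0 < b - a)) ?subr_gt0// ler_pM2r ?subr_gt0//.
  apply: le_trans (dgle t (le_trans tx' xc)) _.
  have [x0|x0] := eqVneq `|x| 0; last first.
    by apply: ler_wpM2l; [exact: M0|rewrite lerXn2r ?nnegrE].
  by have -> : `|t| = `|x| by apply/eqP; rewrite eq_le tx' x0 normr_ge0.
have [x0|x0|->] := ltgtP x 0.
- have := key x 0 x0; rewrite g0 sub0r normrN sub0r (ltr0_norm x0) exprSr mulrA.
  by apply => t /andP[xt t0]; rewrite ler0_norm// lerN2.
- have := key 0 x x0; rewrite g0 !subr0 (gtr0_norm x0) exprSr mulrA.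
  by apply => t /andP[t0 tx]; rewrite ger0_norm.
- by rewrite g0 normr0 exprS mul0r mulr0.
Qed.

(** Three uses of [le_norm_of_derive], for the second, first and zeroth order
    remainders; only the cubic order of the error matters later. *)
Lemma taylor3 (f f1 f2 f3 : R -> R) (c M : R) :
  (forall x : R, `|x| <= c -> is_derive x 1 f (f1 x)) ->
  (forall x : R, `|x| <= c -> is_derive x 1 f1 (f2 x)) ->
  (forall x : R, `|x| <= c -> is_derive x 1 f2 (f3 x)) ->
  (forall x, `|x| <= c -> `|f3 x| <= M) ->
  forall x, `|x| <= c ->
  `|f x - (f 0 + f1 0 * x + f2 0 / 2 * x ^+ 2)| <= M * `|x| ^+ 3.
Proof.
move=> d1 d2 d3 f3M.
have h2 x : `|x| <= c -> `|f2 x - f2 0| <= M * `|x| ^+ 1.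
  move: x; apply: (@le_norm_of_derive (fun x => f2 x - f2 0) f3 c M 0).
  - move=> x xc; have := d3 x xc => ?.
    by apply: is_derive_eq; rewrite subr0.
  - by rewrite subrr.
  - by move=> x xc; rewrite expr0 mulr1; exact: f3M.
have h1 x : `|x| <= c -> `|f1 x - f1 0 - f2 0 * x| <= M * `|x| ^+ 2.
  move: x; apply: (@le_norm_of_derive (fun x => f1 x - f1 0 - f2 0 * x)
    (fun x => f2 x - f2 0) c M 1) => //.
  - move=> x xc; have := d2 x xc => ?.
    by apply: is_derive_eq; rewrite subr0 /GRing.scale/= mulr1.
  - by rewrite mulr0 subrr subr0.
move=> x xc.
have -> : f x - (f 0 + f1 0 * x + f2 0 / 2 * x ^+ 2) =
  f x - f 0 - f1 0 * x - f2 0 / 2 * x ^+ 2 by ring.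
move: x xc; apply: (@le_norm_of_derive
    (fun x => f x - f 0 - f1 0 * x - f2 0 / 2 * x ^+ 2)
    (fun x => f1 x - f1 0 - f2 0 * x) c M 2) => //.
- move=> x xc; have := d1 x xc => ?.
  apply: is_derive_eq; rewrite /GRing.scale/=.
  by field.
- by rewrite expr0n /= !mulr0 !subr0 subrr.
Qed.

Lemma sin_approx (x : R) : `|sin x - x| <= `|x| ^+ 3.
Proof.
suff : `|sin x - (sin 0 + cos 0 * x + - sin 0 / 2 * x ^+ 2)| <= 1 * `|x| ^+ 3.
  by rewrite sin0 cos0 oppr0 !mul0r addr0 add0r !mul1r.
apply: (@taylor3 sin cos (fun x => - sin x) (fun x => - cos x) `|x| 1) => // t _.
- by rewrite normrN; rewrite ler_norml cos_geN1 cos_le1.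
Qed.

Lemma cos_approx (x : R) : `|cos x - (1 - x ^+ 2 / 2)| <= `|x| ^+ 3.
Proof.
suff : `|cos x - (cos 0 + - sin 0 * x + - cos 0 / 2 * x ^+ 2)| <= 1 * `|x| ^+ 3.
  have -> : cos 0 + - sin 0 * x + - cos 0 / 2 * x ^+ 2 = 1 - x ^+ 2 / 2 :> R.
    by rewrite sin0 cos0; field.
  by rewrite mul1r.
apply: (@taylor3 cos (fun x => - sin x) (fun x => - cos x) sin `|x| 1) => // t _.
- by apply: is_derive_eq; rewrite opprK.
- by rewrite ler_norml sin_geN1 sin_le1.
Qed.

Lemma atan_approx (t : R) : `|atan t - t| <= `|t| ^+ 3.
Proof.
rewrite -[leRHS]mul1r.
apply: (@le_norm_of_derive (fun t => atan t - t) (fun t => (1 + t ^+ 2)^-1 - 1)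
  `|t| 1 2 _ _ _ t (lexx _)).
- by rewrite atan0 subr0.
- move=> x _; have x1 : 0 < 1 + x ^+ 2 by rewrite ltr_pwDl// sqr_ge0.
  have -> : (1 + x ^+ 2)^-1 - 1 = - (x ^+ 2 / (1 + x ^+ 2)) by field; rewrite gt_eqF.
  have h : 0 <= x ^+ 2 / (1 + x ^+ 2) by rewrite divr_ge0 ?sqr_ge0// ltW.
  rewrite normrN mul1r real_normK ?num_real// ger0_norm//.
  by rewrite ler_pdivrMr// ler_peMr ?sqr_ge0// lerDl sqr_ge0.
Qed.

Lemma norm_atan_le (t : R) : `|atan t| <= `|t|.
Proof.
rewrite -[leRHS]mul1r -(expr1 `|t|).
apply: (@le_norm_of_derive atan (fun t => (1 + t ^+ 2)^-1) `|t| 1 0 _ _ _ t (lexx _)).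
- by rewrite atan0.
- move=> x _; have x1 : 1 <= 1 + x ^+ 2 by rewrite lerDl sqr_ge0.
  have x0 : 0 < 1 + x ^+ 2 by exact: lt_le_trans x1.
  have xi0 : 0 <= (1 + x ^+ 2)^-1 by rewrite invr_ge0 ltW.
  by rewrite expr0 mulr1 ger0_norm// invf_le1.
Qed.

Lemma powR_approx (k u : R) : 0 < k < 1 -> `|u| <= 1 / 2 ->
  `|(1 + u) `^ k - (1 + k * u + k * (k - 1) / 2 * u ^+ 2)| <= 16 * `|u| ^+ 3.
Proof.
move=> /andP[k0 k1].
pose f (e : R) := fun u : R => (1 + u) `^ e.
have df (e x : R) : `|x| <= 1 / 2 -> is_derive x 1 (f e) (e * f (e - 1) x).
  rewrite ler_norml => /andP[x1 x2]; have x0 : 0 < 1 + x by lra.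
  have := is_derive1_powR e x0 => ?.
  rewrite /f; apply: is_derive_eq; first exact: is_derive1_comp.
  by rewrite /GRing.scale/= add0r mulr1.
have dcf (c e x : R) : `|x| <= 1 / 2 ->
    is_derive x 1 (fun x => c * f e x) (c * (e * f (e - 1) x)).
  by move=> x1; have := df e x x1 => ?; apply: is_derive_eq.
move=> ule.
have f0 e : f e 0 = 1 by rewrite /f addr0 powR1.
suff : `|f k u - (f k 0 + k * f (k - 1) 0 * u +
    k * ((k - 1) * f (k - 1 - 1) 0) / 2 * u ^+ 2)| <= 16 * `|u| ^+ 3.
  by rewrite !f0 !mulr1.
(* for 1 + x >= 1/2 the third derivative is at most 1 * 1 * 2 * (1/2) ^ -3 *)
apply: (@taylor3 (f k) (fun x => k * f (k - 1) x)
  (fun x => k * ((k - 1) * f (k - 1 - 1) x))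
  (fun x => k * ((k - 1) * ((k - 1 - 1) * f (k - 1 - 1 - 1) x)))
  (1 / 2) 16 _ _ _ _ u ule).
- move=> x x1; have := dcf (k * (k - 1)) (k - 1 - 1) x x1.
  by rewrite -!mulrA; under eq_fun do rewrite -!mulrA.
- move=> x; rewrite /f ler_norml => /andP[x1 x2]; have x0 : 0 < 1 + x by lra.
  rewrite !normrM (ger0_norm (powR_ge0 _ _)).
  have P8 : (1 + x) `^ (k - 1 - 1 - 1) <= 8.
    have -> : k - 1 - 1 - 1 = - (3 - k) by ring.
    rewrite powRN invf_ple ?posrE ?powR_gt0//.
    apply: (@le_trans _ _ ((1 / 2) `^ 3)).
      have -> : (1 / 2) `^ 3 = 8^-1 :> R by rewrite (powR_mulrn 3)//; field.
      exact: lexx.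
    apply: (@le_trans _ _ ((1 / 2) `^ (3 - k))).
      apply: ger_powR; [by lra|by lra].
    by apply: ge0_ler_powR; rewrite ?nnegrE; lra.
  rewrite (gtr0_norm k0) (ltr0_norm (_ : k - 1 < 0)) ?(ltr0_norm (_ : k - 1 - 1 < 0)); try lra.
  set P := powR _ _ in P8 *; have P0 : 0 <= P by exact: powR_ge0.
  have E1 : 0 <= - (k - 1 - 1) * P <= 16.
    by rewrite mulr_ge0//=; [nra|lra].
  have E2 : 0 <= - (k - 1) * (- (k - 1 - 1) * P) <= 16.
    case/andP: E1 => E10 E11.
    by rewrite mulr_ge0//=; [nra|lra].
  by case/andP: E2 => E20 E21; nra.
Qed.
End taylor.

(** * Moments of the Gaussian law *)

Section gaussian_moments.
Context {R : realType}.
Local Notation mu := (@lebesgue_measure R).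

(** The law is given by its density on sets only; uniqueness of the
    Radon-Nikodym derivative extends the formula to functions. *)
Lemma integral_normal_prob (s : R) (f : measurableTypeR R -> \bar R) :
  measurable_fun setT f -> (forall x, 0 <= f x)%E ->
  (\int[normal_prob 0 s]_x f x = \int[mu]_x (f x * (normal_pdf 0 s x)%:E))%E.
Proof.
move=> mf f0; have dom := normal_prob_dominates (0 : R) s.
rewrite -(Radon_Nikodym_SigmaFinite.change_of_variables dom)//.
have mp : measurable_fun setT (fun x : R => (normal_pdf 0 s x)%:E).
  by apply/measurable_EFinP; exact: measurable_normal_pdf.
apply: ae_eq_integral => //.
- apply: emeasurable_funM => //.
  by have /integrableP[] := Radon_Nikodym_SigmaFinite.f_integrable dom.
- exact: emeasurable_funM.
- have : ae_eq mu setT (Radon_Nikodym_SigmaFinite.f (normal_prob 0 s) mu)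
      (fun x => (normal_pdf 0 s x)%:E).
    apply: integral_ae_eq => //.
      exact: Radon_Nikodym_SigmaFinite.f_integrable.
    by move=> E _ mE; rewrite -Radon_Nikodym_SigmaFinite.f_integral.
  by apply: filterS => x /= e xT; rewrite e.
Qed.

Lemma integral_normal_cst (s c : R) :
  (\int[normal_prob 0 s]_(x in setT) c%:E = c%:E)%E.
Proof.
rewrite integral_cst//= [X in (_ * X)%E](_ : _ = 1%E) ?mule1//.
exact: probability_setT.
Qed.

(** Half of the exponent of the density absorbs the factor [x ^+ 4] and the other
    half is the exponent of a Gaussian density of twice the variance. *)
Lemma normal_x4_le (s x : R) : 0 < s ->
  x ^+ 4 * normal_pdf 0 s x <=
  64 * s ^+ 4 * normal_pdf 0 (Num.sqrt 2 * s) x.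
Proof.
move=> s0; have s2 : 0 < Num.sqrt 2 :> R by rewrite sqrtr_gt0.
have q2 : Num.sqrt 2 ^+ 2 = 2 :> R by rewrite sqr_sqrtr.
rewrite !normal_pdfE ?gt_eqF ?mulr_gt0// /normal_peak /normal_fun.
rewrite !subr0 exprMn q2.
set t := x ^+ 2 / (4 * s ^+ 2).
have s20 : s ^+ 2 != 0 by rewrite gt_eqF// exprn_gt0.
have -> : x ^+ 4 = 16 * s ^+ 4 * t ^+ 2 by rewrite /t; field; rewrite gt_eqF.
have -> : - x ^+ 2 / (s ^+ 2 *+ 2) = - t - t.
  by rewrite /t -mulr_natr; field; rewrite gt_eqF.
have -> : - x ^+ 2 / (2 * s ^+ 2 *+ 2) = - t.
  by rewrite /t -mulr_natr; field; rewrite gt_eqF.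
have t0 : 0 <= t by rewrite /t divr_ge0 ?sqr_ge0// mulr_ge0 ?sqr_ge0.
have tE : t ^+ 2 * expR (- t) <= 2.
  rewrite expRN ler_pdivrMr ?expR_gt0//.
  have := @expR_ge1Dxn R t 1 t0; rewrite !factS fact0 !muln1; lra.
have peakE : (Num.sqrt (s ^+ 2 * pi *+ 2))^-1 <=
    2 * (Num.sqrt (2 * s ^+ 2 * pi *+ 2))^-1 :> R.
  have p0 : 0 < s ^+ 2 * pi *+ 2 :> R.
    by rewrite mulrn_wgt0// mulr_gt0 ?pi_gt0 ?exprn_gt0.
  have -> : 2 * s ^+ 2 * pi *+ 2 = 2 * (s ^+ 2 * pi *+ 2) :> R.
    by rewrite -!mulrA mulrnAr.
  rewrite sqrtrM// invfM mulrA ler_peMl ?invr_ge0 ?sqrtr_ge0//.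
  rewrite ler_pdivlMr// mul1r -(ler_pXn2r (n := 2)) ?nnegrE ?sqrtr_ge0//.
  by rewrite q2; lra.
rewrite expRD.
set P := (Num.sqrt _)^-1 in peakE *; set Q := (Num.sqrt _)^-1 in peakE *.
have -> : 16 * s ^+ 4 * t ^+ 2 * (P * (expR (- t) * expR (- t))) =
  (16 * s ^+ 4 * expR (- t)) * ((t ^+ 2 * expR (- t)) * P) by ring.
have -> : 64 * s ^+ 4 * (Q * expR (- t)) =
  (16 * s ^+ 4 * expR (- t)) * (2 * (2 * Q)) by ring.
apply: ler_wpM2l.
  by rewrite mulr_ge0 ?expR_ge0// mulr_ge0// exprn_ge0// ltW.
apply: ler_pM => //; first by rewrite mulr_ge0 ?sqr_ge0 ?expR_ge0.
by rewrite invr_ge0 sqrtr_ge0.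
Qed.

Lemma normal_m4_le (s : R) : 0 < s ->
  (\int[normal_prob 0 s]_x (x ^+ 4)%:E <= (64 * s ^+ 4)%:E)%E.
Proof.
move=> s0.
have mX4 : measurable_fun setT (fun x : measurableTypeR R => (x ^+ 4)%:E).
  by apply/measurable_EFinP; exact: measurable_funX.
rewrite integral_normal_prob//; last first.
  by move=> x; rewrite lee_fin exprn_even_ge0.
apply: (@le_trans _ _ (\int[mu]_x ((64 * s ^+ 4)%:E *
    (normal_pdf 0 (Num.sqrt 2 * s) x)%:E))%E).
  apply: ge0_le_integral => //.
  - move=> x _; rewrite -EFinM lee_fin mulr_ge0 ?exprn_even_ge0//.
    exact: normal_pdf_ge0.
  - by apply: emeasurable_funM => //; apply/measurable_EFinP; exact: measurable_normal_pdf.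
  - by apply: emeasurable_funM => //; apply/measurable_EFinP; exact: measurable_normal_pdf.
  - by move=> x _; rewrite -!EFinM lee_fin; exact: normal_x4_le.
rewrite ge0_integralZl//.
- by rewrite integral_normal_pdf mule1.
- by apply/measurable_EFinP; exact: measurable_normal_pdf.
- by move=> x _; rewrite lee_fin normal_pdf_ge0.
- by rewrite lee_fin mulr_ge0// exprn_ge0// ltW.
Qed.

(** The density is at most [1 / (2 * s)], because [2 <= pi]. *)
Lemma normal_prob_itv_le (s r : R) : 0 < s -> 0 <= r ->
  (normal_prob 0 s [set x : R | (`|x| <= r)%R] <= (r / s)%:E)%E.
Proof.
move=> s0 r0.
have -> : [set x : R | `|x| <= r] = `[- r, r]%classic.
  by apply/seteqP; split => x /=; rewrite in_itv/= ler_norml.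
rewrite /normal_prob.
apply: (@le_trans _ _ (\int[mu]_(x in `[(- r)%R, r]%classic) (normal_peak s)%:E))%E.
  apply: ge0_le_integral => //=.
  - by move=> x _; rewrite lee_fin normal_pdf_ge0.
  - apply/measurable_EFinP/measurable_funTS; exact: measurable_normal_pdf.
  - by move=> x _; rewrite lee_fin normal_pdf_ub// gt_eqF.
rewrite integral_cst//= lebesgue_measure_itv/= lte_fin.
case: ifPn => [rr|_]; last by rewrite mule0 lee_fin divr_ge0// ltW.
rewrite -EFinD -EFinM lee_fin /normal_peak opprK.
have sp : s * 2 <= Num.sqrt (s ^+ 2 * pi *+ 2).
  rewrite -[leLHS]ger0_norm; last by rewrite mulr_ge0// ltW.
  rewrite -sqrtr_sqr ler_wsqrtr// exprMn -mulrnAr ler_wpM2l ?sqr_ge0//.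
  by have := @pi_ge2 R; rewrite -mulr_natr; move: (pi : R) => P; lra.
have sp0 : 0 < Num.sqrt (s ^+ 2 * pi *+ 2) by apply: lt_le_trans sp; lra.
rewrite mulrC ler_pdivrMr// mulrAC ler_pdivlMr//.
by have := ler_wpM2l r0 sp; lra.
Qed.

Lemma normal_x4_integrable (s : R) : 0 < s ->
  (normal_prob 0 s).-integrable setT (fun x : measurableTypeR R => (x ^+ 4)%:E).
Proof.
move=> s0; apply/integrableP; split.
  by apply/measurable_EFinP; exact: measurable_funX.
under eq_integral do rewrite gee0_abs ?lee_fin ?exprn_even_ge0//.
by apply: le_lt_trans (normal_m4_le s0) _; rewrite ltry.
Qed.

Lemma sqr_le_1Dx4 (x : R) : x ^+ 2 <= 1 + x ^+ 4.
Proof.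
have : 0 <= (x ^+ 2 - 1 / 2) ^+ 2 by exact: sqr_ge0.
have -> : x ^+ 4 = (x ^+ 2) ^+ 2 by ring.
by rewrite sqrrB; set y := x ^+ 2; lra.
Qed.

Lemma norm_le_1Dx4 (x : R) : `|x| <= 1 + x ^+ 4.
Proof.
have <- : `|x| ^+ 4 = x ^+ 4 by rewrite -normrX ger0_norm// exprn_even_ge0.
have : 0 <= (`|x| ^+ 2 - 1 / 2) ^+ 2 by exact: sqr_ge0.
have : 0 <= (`|x| - 1 / 2) ^+ 2 by exact: sqr_ge0.
have -> : `|x| ^+ 4 = (`|x| ^+ 2) ^+ 2 by ring.
by rewrite !sqrrB; set y := `|x| ^+ 2; lra.
Qed.

Lemma normal_dom_integrable (s : R) (f : measurableTypeR R -> R) : 0 < s ->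
  measurable_fun setT f -> (forall x, `|f x| <= 1 + x ^+ 4) ->
  (normal_prob 0 s).-integrable setT (fun x : measurableTypeR R => (f x)%:E).
Proof.
move=> s0 mf fle.
apply: (@le_integrable _ _ _ (normal_prob 0 s) setT measurableT _
    (fun x : measurableTypeR R => (1 + x ^+ 4)%:E)).
- exact/measurable_EFinP.
- move=> x _; rewrite lee_fin (le_trans (fle x))//; exact: ler_norm.
- under eq_fun do rewrite EFinD.
  apply: integrableD => //; last exact: normal_x4_integrable.
  apply/integrableP; split => //.
  by rewrite integral_normal_cst ltry.
Qed.

(** By the symmetry of the density, the positive and the negative part of the
    identity have the same integral. *)
Lemma normal_mean0 (s : R) : 0 < s ->
  (\int[normal_prob 0 s]_x x%:E = 0)%E.
Proof.
move=> s0; rewrite integralE.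
have mx : measurable_fun setT (fun x : measurableTypeR R => x%:E).
  exact/measurable_EFinP.
have xi : (normal_prob 0 s).-integrable setT (fun x : measurableTypeR R => x%:E).
  by apply: normal_dom_integrable => //; exact: norm_le_1Dx4.
have mpdf (h : measurableTypeR R -> \bar R) : measurable_fun setT h ->
    measurable_fun setT (fun x => h x * (normal_pdf 0 s x)%:E)%E.
  move=> mh; apply: emeasurable_funM => //; apply/measurable_EFinP.
  exact: measurable_normal_pdf.
suff -> : (\int[normal_prob 0 s]_x (fun x : measurableTypeR R => x%:E)^\+ x =
    \int[normal_prob 0 s]_x (fun x : measurableTypeR R => x%:E)^\- x)%E.
  rewrite subee//; exact: integrable_neg_fin_num.
rewrite !integral_normal_prob//; last 2 first.
- exact: measurable_funeneg.
- exact: measurable_funepos.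
transitivity (\int[mu]_(x in `[0%R, +oo[%classic) (x * normal_pdf 0 s x)%:E)%E.
  rewrite [RHS]integral_mkcond; apply: eq_integral => x _.
  rewrite funeposE patchE; case: ifPn.
    by rewrite inE/= in_itv/= andbT => x0; rewrite max_l ?lee_fin.
  rewrite notin_setE/= in_itv/= andbT => /negP; rewrite -ltNge => x0.
  by rewrite max_r ?mul0e// lee_fin ltW.
have NE : forall x, normal_pdf 0 s (- x) = normal_pdf 0 s x.
  move=> x; rewrite !normal_pdfE ?gt_eqF// /normal_fun !subr0.
  by rewrite sqrrN.
transitivity (\int[mu]_(x in `]-oo, (- 0)%R]%classic) (- x * normal_pdf 0 s x)%:E)%E.
  rewrite ge0_integration_by_substitutionNy.
  - by apply: eq_integral => x _ /=; rewrite NE opprK.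
  - apply: continuous_subspaceT => x; apply: continuousM.
      exact: opp_continuous.
    by apply: continuous_normal_pdf; rewrite gt_eqF.
  - move=> x; rewrite in_itv/= oppr0 => x0.
    by rewrite mulr_ge0 ?normal_pdf_ge0// oppr_ge0 ltW.
rewrite integral_mkcond; apply: eq_integral => x _.
rewrite funenegE patchE; case: ifPn.
  by rewrite inE/= in_itv/= oppr0 => x0; rewrite max_l// lee_fin oppr_ge0.
rewrite notin_setE/= in_itv/= oppr0 => /negP; rewrite -ltNge => x0.
by rewrite max_r ?mul0e// lee_fin oppr_le0 ltW.
Qed.

Lemma measurable_quartic (c0 c1 c2 c4 : R) : measurable_fun setT
  (fun x : measurableTypeR R => (c0 + c1 * x + c2 * x ^+ 2 + c4 * x ^+ 4)%:E).
Proof.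
apply/measurable_EFinP; apply: measurable_funD; last first.
  by apply: measurable_funM => //; exact: measurable_funX.
apply: measurable_funD; last first.
  by apply: measurable_funM => //; exact: measurable_funX.
by apply: measurable_funD => //; exact: measurable_funM.
Qed.

(** The only property of the increments that the potential estimates use: an upper
    bound for integrals of functions that a quartic polynomial without cubic
    term dominates. It makes these estimates independent of the step size. *)
Definition quartic_moments (g : probability (measurableTypeR R) R) (v K : R) :=
  forall (f : measurableTypeR R -> \bar R) (c0 c1 c2 c4 : R),
    measurable_fun setT f -> (forall x, 0 <= f x)%E -> 0 <= c4 ->
    (forall x, f x <= (c0 + c1 * x + c2 * x ^+ 2 + c4 * x ^+ 4)%:E)%E ->
  (\int[g]_x f x <= (c0 + c2 * v + c4 * (K * v ^+ 2))%:E)%E.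

(** Only the order of the variance matters below. It follows from the bound on
    small balls and from the fourth moment, without computing the variance. *)
Lemma normal_quartic_moments (s : R) : 0 < s ->
  exists v, [/\ s ^+ 2 / 32 <= v, v <= 33 * s ^+ 2 &
    quartic_moments (normal_prob 0 s) v (64 * 32 ^+ 2)].
Proof.
move=> s0.
have x1i : (normal_prob 0 s).-integrable setT (fun x : measurableTypeR R => x%:E).
  by apply: normal_dom_integrable => //; exact: norm_le_1Dx4.
have x2i : (normal_prob 0 s).-integrable setT
    (fun x : measurableTypeR R => (x ^+ 2)%:E).
  apply: normal_dom_integrable => // x; rewrite ger0_norm ?sqr_ge0//.
  exact: sqr_le_1Dx4.
have x4i := normal_x4_integrable s0.
pose v := fine (\int[normal_prob 0 s]_x (x ^+ 2)%:E)%E.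
have vE : (\int[normal_prob 0 s]_x (x ^+ 2)%:E = v%:E)%E.
  by rewrite fineK//; exact: integrable_fin_num.
pose m := fine (\int[normal_prob 0 s]_x (x ^+ 4)%:E)%E.
have mE : (\int[normal_prob 0 s]_x (x ^+ 4)%:E = m%:E)%E.
  by rewrite fineK//; exact: integrable_fin_num.
have mle : m <= 64 * s ^+ 4 by rewrite -lee_fin -mE normal_m4_le.
have s20 : 0 < s ^+ 2 by rewrite exprn_gt0.
have csti (c : R) : (normal_prob 0 s).-integrable setT
    (fun _ : measurableTypeR R => c%:E).
  apply/integrableP; split => //.
  by rewrite integral_normal_cst ltry.
have polyE (c0 c1 c2 c4 : R) :
    (\int[normal_prob 0 s]_x (c0 + c1 * x + c2 * x ^+ 2 + c4 * x ^+ 4)%:E =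
     (c0 + c2 * v + c4 * m)%:E)%E.
  under eq_integral do rewrite !EFinD !EFinM.
  have i1 := integrableZl measurableT c1 x1i.
  have i2 := integrableZl measurableT c2 x2i.
  have i4 := integrableZl measurableT c4 x4i.
  have i01 := integrableD measurableT (csti c0) i1.
  have i012 := integrableD measurableT i01 i2.
  rewrite (integralD measurableT i012 i4) (integralD measurableT i01 i2).
  rewrite (integralD measurableT (csti c0) i1) !integralZl// normal_mean0//.
  rewrite vE mE integral_normal_cst mule0 adde0.
  by rewrite -!EFinM -!EFinD.
have vge : s ^+ 2 / 32 <= v.
  (* at most a quarter of the mass lies within s / 4 of the mean *)
  pose A := [set x : measurableTypeR R | `|x| <= s / 4].
  have mA : measurable A.
    have -> : A = `[- (s / 4), s / 4]%classic.
      by rewrite /A; apply/seteqP; split => x /=; rewrite in_itv/= ler_norml.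
    exact: measurable_itv.
  have PA : (normal_prob 0 s A <= (1 / 4)%:E)%E.
    apply: le_trans (normal_prob_itv_le s0 _) _; first by rewrite divr_ge0// ltW.
    by rewrite lee_fin mulrAC mulfV ?gt_eqF.
  have : (\int[normal_prob 0 s]_(x in ~` A) (s ^+ 2 / 16)%:E <= v%:E)%E.
    rewrite -vE; apply: (@le_trans _ _ (\int[normal_prob 0 s]_(x in ~` A) (x ^+ 2)%:E)%E).
      apply: ge0_le_integral => //.
      - exact: measurableC.
      - by move=> x _; rewrite lee_fin mulr_ge0// ltW.
      - by apply/measurable_EFinP/measurable_funTS; exact: measurable_funX.
      - move=> x /negP; rewrite -ltNge => x4; rewrite lee_fin.
        rewrite -(real_normK (num_real x)).
        have -> : s ^+ 2 / 16 = (s / 4) ^+ 2 by field.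
        have s4 : 0 <= s / 4 by rewrite divr_ge0// ltW.
        by rewrite lerXn2r ?nnegrE// ltW.
    apply: ge0_subset_integral => //; first exact: measurableC.
      by apply/measurable_EFinP; exact: measurable_funX.
    by move=> x _; rewrite lee_fin sqr_ge0.
  rewrite integral_cst//; last exact: measurableC.
  move=> h; rewrite -lee_fin; apply: le_trans h.
  have : ((1 / 2)%:E <= normal_prob 0 s (~` A))%E.
    rewrite probability_setC//.
    apply: (@le_trans _ _ (1%:E - (1 / 4)%:E))%E.
      by rewrite -EFinB lee_fin; lra.
    by apply: leeB.
  move=> h; apply: (@le_trans _ _ ((s ^+ 2 / 16)%:E * (1 / 2)%:E))%E.
    by rewrite -EFinM lee_fin; lra.
  by apply: lee_pmul => //; rewrite lee_fin ?divr_ge0// ltW.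
(* integrate x ^ 2 <= s ^ 2 / 2 + x ^ 4 / (2 * s ^ 2) *)
have vle : v <= 33 * s ^+ 2.
  have : (v%:E <= (s ^+ 2 / 2 + 0 * v + 1 / (2 * s ^+ 2) * m)%:E)%E.
    rewrite -(polyE _ 0) -vE; apply: ge0_le_integral => //.
    - by move=> x _; rewrite lee_fin sqr_ge0.
    - by apply/measurable_EFinP; exact: measurable_funX.
    - exact: measurable_quartic.
    - move=> x _; rewrite lee_fin !mul0r !addr0.
      rewrite -subr_ge0; have -> : s ^+ 2 / 2 + 1 / (2 * s ^+ 2) * x ^+ 4 - x ^+ 2 =
        (s ^+ 2 - x ^+ 2) ^+ 2 / (2 * s ^+ 2) by field; rewrite gt_eqF.
      by rewrite divr_ge0 ?sqr_ge0// mulr_ge0// ltW.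
  rewrite lee_fin mul0r addr0 => h; apply: le_trans h _.
  have : 1 / (2 * s ^+ 2) * m <= 1 / (2 * s ^+ 2) * (64 * s ^+ 4).
    by apply: ler_wpM2l => //; rewrite divr_ge0// mulr_ge0// ltW.
  have -> : 1 / (2 * s ^+ 2) * (64 * s ^+ 4) = 32 * s ^+ 2 by field; rewrite gt_eqF.
  lra.
exists v; split => // f c0 c1 c2 c4 mf f0 c40 fle.
apply: (@le_trans _ _ (c0 + c2 * v + c4 * m)%:E).
  rewrite -(polyE c0 c1); apply: ge0_le_integral => //.
  exact: measurable_quartic.
rewrite lee_fin lerD2l ler_wpM2l//; apply: le_trans mle _.
have : (s ^+ 2 / 32) ^+ 2 <= v ^+ 2.
  have s32 : 0 <= s ^+ 2 / 32 by rewrite divr_ge0// ltW.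
  by rewrite lerXn2r ?nnegrE// (le_trans s32).
have -> : s ^+ 4 = (s ^+ 2) ^+ 2 by ring.
by set w := s ^+ 2; lra.
Qed.
End gaussian_moments.

Section planar_moments.
Context {R : realType}.

(** The linear terms and the mixed term integrate to 0. *)
Lemma planar_quartic_bound (g : probability (measurableTypeR R) R) (v K : R)
    (f : measurableTypeR R * measurableTypeR R -> \bar R)
    (c0 c1 c2 c11 c12 c22 c4 : R) :
  quartic_moments g v K ->
  measurable_fun setT f -> (forall z, 0 <= f z)%E -> 0 <= c4 ->
  (forall x1 x2, f (x1, x2) <= (c0 + c1 * x1 + c2 * x2 + c11 * x1 ^+ 2
     + c12 * (x1 * x2) + c22 * x2 ^+ 2 + c4 * (x1 ^+ 4 + x2 ^+ 4))%:E)%E ->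
  (\int[g]_x1 \int[g]_x2 f (x1, x2) <=
     (c0 + (c11 + c22) * v + c4 * (2 * (K * v ^+ 2)))%:E)%E.
Proof.
move=> gm mf f0 c40 fle.
have -> : c0 + (c11 + c22) * v + c4 * (2 * (K * v ^+ 2)) =
  (c0 + c22 * v + c4 * (K * v ^+ 2)) + c11 * v + c4 * (K * v ^+ 2) by ring.
apply: (gm _ _ c1) => //.
- exact: (measurable_fun_fubini_tonelli_F (m2 := g) f).
- by move=> x; exact: integral_ge0.
move=> x1.
have -> : c0 + c22 * v + c4 * (K * v ^+ 2) + c1 * x1 + c11 * x1 ^+ 2 + c4 * x1 ^+ 4
  = (c0 + c1 * x1 + c11 * x1 ^+ 2 + c4 * x1 ^+ 4) + c22 * v + c4 * (K * v ^+ 2) by ring.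
apply: (gm _ _ (c2 + c12 * x1)) => //.
  by apply: measurableT_comp => //; exact: measurable_pair1.
move=> x2; apply: le_trans (fle x1 x2) _; rewrite lee_fin le_eqVlt; apply/orP; left.
by apply/eqP; ring.
Qed.
End planar_moments.

(** * A superharmonic barrier outside the quadrant *)

Section polar_expansion.
Context {R : realType}.
Variables (p q : R).
Hypothesis p01 : 0 < p < 1.
Hypothesis q01 : 0 < q < 1.

Lemma approx_mul (x x0 e1 y y0 e2 : R) :
  `|x - x0| <= e1 -> `|y - y0| <= e2 -> `|y| <= 1 ->
  `|x * y - x0 * y0| <= e1 + `|x0| * e2.
Proof.
move=> xe ye y1.
have -> : x * y - x0 * y0 = (x - x0) * y + x0 * (y - y0) by ring.
apply: le_trans (ler_normD _ _) _; rewrite !normrM lerD//.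
- by rewrite -[leRHS]mulr1 ler_pM.
- by rewrite ler_wpM2l.
Qed.

Lemma radius_approx (a b : R) : `|a| + `|b| <= 1 / 8 ->
  `|((1 + a) ^+ 2 + b ^+ 2) `^ (p / 2) -
    (1 + p * a + p * (p - 1) / 2 * a ^+ 2 + p / 2 * b ^+ 2)|
   <= 500 * (`|a| + `|b|) ^+ 3.
Proof.
move=> nle; set n := `|a| + `|b| in nle *.
have n0 : 0 <= n by rewrite addr_ge0.
have an : `|a| <= n by rewrite lerDl.
have bn : `|b| <= n by rewrite lerDr.
have ab2 : a ^+ 2 + b ^+ 2 <= n ^+ 2.
  rewrite -(real_normK (num_real a)) -(real_normK (num_real b)) /n sqrrD.
  by rewrite lerD2r lerDl mulrn_wge0// mulr_ge0.
have ab20 : 0 <= a ^+ 2 + b ^+ 2 by rewrite addr_ge0 ?sqr_ge0.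
set w := a ^+ 2 + b ^+ 2 in ab2 ab20.
pose u := 2 * a + w.
have -> : (1 + a) ^+ 2 + b ^+ 2 = 1 + u by rewrite /u /w; ring.
have un : `|u| <= 3 * n.
  have : `|u| <= 2 * `|a| + w.
    by apply: le_trans (ler_normD _ _) _; rewrite normrM (ger0_norm ab20) (ger0_norm (ler0n _ _)).
  by have : n ^+ 2 <= n; [rewrite expr2 ler_piMl//; lra|lra].
have uh : `|u| <= 1 / 2 by lra.
have k01 : 0 < p / 2 < 1 by case/andP: p01 => ? ?; apply/andP; split; lra.
have := powR_approx k01 uh.
set X := powR _ _ => Xle.
have u3 : `|u| ^+ 3 <= 27 * n ^+ 3.
  have -> : 27 * n ^+ 3 = (3 * n) ^+ 3 by ring.
  by rewrite lerXn2r ?nnegrE// mulr_ge0.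
have u2 : `|u ^+ 2 - 4 * a ^+ 2| <= 5 * n ^+ 3.
  have -> : u ^+ 2 - 4 * a ^+ 2 = w * (4 * a + w) by rewrite /u; ring.
  rewrite normrM (ger0_norm ab20).
  have : `|4 * a + w| <= 5 * n.
    have : `|4 * a + w| <= 4 * `|a| + w.
      by apply: le_trans (ler_normD _ _) _; rewrite normrM (ger0_norm ab20) (ger0_norm (ler0n _ _)).
    by have : n ^+ 2 <= n; [rewrite expr2 ler_piMl//; lra|lra].
  move=> h; have -> : 5 * n ^+ 3 = n ^+ 2 * (5 * n) by ring.
  by apply: ler_pM.
have -> : X - (1 + p * a + p * (p - 1) / 2 * a ^+ 2 + p / 2 * b ^+ 2) =
  (X - (1 + p / 2 * u + p / 2 * (p / 2 - 1) / 2 * u ^+ 2)) +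
  p / 2 * (p / 2 - 1) / 2 * (u ^+ 2 - 4 * a ^+ 2).
  by rewrite /u /w; field.
apply: le_trans (ler_normD _ _) _.
have kk : `|p / 2 * (p / 2 - 1) / 2| <= 1.
  by case/andP: p01 => ? ?; rewrite ler_norml; apply/andP; split; nra.
have : `|p / 2 * (p / 2 - 1) / 2 * (u ^+ 2 - 4 * a ^+ 2)| <= 1 * (5 * n ^+ 3).
  by rewrite normrM; apply: ler_pM.
have : 0 <= n ^+ 3 by rewrite exprn_ge0.
lra.
Qed.

Lemma angle_approx (a b : R) : `|a| + `|b| <= 1 / 8 ->
  `|atan (b / (1 + a)) - (b - a * b)| <= 10 * (`|a| + `|b|) ^+ 3 /\
  `|atan (b / (1 + a))| <= 2 * (`|a| + `|b|).
Proof.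
move=> nle; set n := `|a| + `|b| in nle *.
have n0 : 0 <= n by rewrite addr_ge0.
have an : `|a| <= n by rewrite lerDl.
have bn : `|b| <= n by rewrite lerDr.
have a1 : 1 / 2 <= 1 + a by move: an; rewrite ler_norml => /andP[]; lra.
have a10 : 0 < 1 + a by lra.
have i2 : (1 + a)^-1 <= 2 by rewrite invf_ple ?posrE//; lra.
have i0 : 0 <= (1 + a)^-1 by rewrite invr_ge0 ltW.
have tn : `|b / (1 + a)| <= 2 * n.
  by rewrite normrM (ger0_norm i0) mulrC; apply: ler_pM.
split; last by apply: le_trans (norm_atan_le _) tn.
have -> : atan (b / (1 + a)) - (b - a * b) =
    (atan (b / (1 + a)) - b / (1 + a)) + a ^+ 2 * b * (1 + a)^-1.
  by field; rewrite gt_eqF.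
apply: le_trans (ler_normD _ _) _.
have h1 : `|atan (b / (1 + a)) - b / (1 + a)| <= 8 * n ^+ 3.
  apply: le_trans (atan_approx _) _.
  have -> : 8 * n ^+ 3 = (2 * n) ^+ 3 by ring.
  by rewrite lerXn2r ?nnegrE// mulr_ge0.
have h2 : `|a ^+ 2 * b * (1 + a)^-1| <= n ^+ 3 * 2.
  rewrite normrM (ger0_norm i0); apply: ler_pM => //.
  have -> : n ^+ 3 = n ^+ 2 * n by ring.
  rewrite normrM normrX; apply: ler_pM => //.
  by rewrite lerXn2r ?nnegrE.
lra.
Qed.

(** Second order expansion at 1 of the real and imaginary parts of the
    generalised power [z |-> |z| ^ p * exp (i * q * arg z)], with
    [z = 1 + a + i b]. For [p = q] this is the holomorphic function [z ^ p], and
    the coefficients of [a ^ 2] and [b ^ 2] in the real part are opposite. *)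
Lemma polar_approx (a b : R) : `|a| + `|b| <= 1 / 8 ->
  let rad := ((1 + a) ^+ 2 + b ^+ 2) `^ (p / 2) in
  let th := atan (b / (1 + a)) in
  `|rad * cos (q * th) -
      (1 + p * a + p * (p - 1) / 2 * a ^+ 2 + (p - q ^+ 2) / 2 * b ^+ 2)|
    <= 600 * (`|a| + `|b|) ^+ 3 /\
  `|rad * sin (q * th) - (q * b + (p - 1) * q * (a * b))|
    <= 600 * (`|a| + `|b|) ^+ 3.
Proof.
move=> nle rad th.
have radle := radius_approx nle.
have [thle thn] := angle_approx nle.
rewrite -/rad -/th in radle thle thn.
set n := `|a| + `|b| in nle radle thle thn *.
have n0 : 0 <= n by rewrite addr_ge0.
have an : `|a| <= n by rewrite lerDl.
have bn : `|b| <= n by rewrite lerDr.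
have [p0 p1] := andP p01; have [q0 q1] := andP q01.
have n3 : 0 <= n ^+ 3 by rewrite exprn_ge0.
have qthn : `|q * th| <= 2 * n.
  rewrite normrM (gtr0_norm q0); apply: le_trans thn.
  by rewrite ler_piMl// ltW.
have qth3 : `|q * th| ^+ 3 <= 8 * n ^+ 3.
  have -> : 8 * n ^+ 3 = (2 * n) ^+ 3 by ring.
  by rewrite lerXn2r ?nnegrE// mulr_ge0.
have abn : `|a * b| <= n ^+ 2 by rewrite normrM expr2; apply: ler_pM.
have a2n : `|a ^+ 2| <= n ^+ 2 by rewrite normrX lerXn2r ?nnegrE.
have b2n : `|b ^+ 2| <= n ^+ 2 by rewrite normrX lerXn2r ?nnegrE.
have n2n : n ^+ 2 <= 1 / 8 * n by rewrite expr2 ler_wpM2r.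
have n32 : n ^+ 3 <= 1 / 8 * n ^+ 2 by rewrite exprS ler_wpM2r// sqr_ge0.
have sinle : `|sin (q * th) - (q * b - q * (a * b))| <= 18 * n ^+ 3.
  have -> : sin (q * th) - (q * b - q * (a * b)) =
    (sin (q * th) - q * th) + q * (th - (b - a * b)) by ring.
  apply: le_trans (ler_normD _ _) _.
  have h1 := le_trans (sin_approx (q * th)) qth3.
  have h2 : `|q * (th - (b - a * b))| <= 1 * (10 * n ^+ 3).
    by rewrite normrM (gtr0_norm q0); apply: ler_pM => //; exact: ltW.
  lra.
have th2 : `|th ^+ 2 - b ^+ 2| <= 9 * n ^+ 3.
  have -> : th ^+ 2 - b ^+ 2 = (th - b) * (th + b) by ring.
  have h1 : `|th - b| <= 3 * n ^+ 2.
    have -> : th - b = (th - (b - a * b)) - a * b by ring.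
    by apply: le_trans (ler_normB _ _) _; lra.
  have h2 : `|th + b| <= 3 * n by apply: le_trans (ler_normD _ _) _; lra.
  rewrite normrM; have -> : 9 * n ^+ 3 = (3 * n ^+ 2) * (3 * n) by ring.
  exact: ler_pM.
have cosle : `|cos (q * th) - (1 - q ^+ 2 / 2 * b ^+ 2)| <= 13 * n ^+ 3.
  have -> : cos (q * th) - (1 - q ^+ 2 / 2 * b ^+ 2) =
    (cos (q * th) - (1 - (q * th) ^+ 2 / 2)) - q ^+ 2 / 2 * (th ^+ 2 - b ^+ 2).
    by field.
  apply: le_trans (ler_normB _ _) _.
  have h1 := le_trans (cos_approx (q * th)) qth3.
  have q2 : `|q ^+ 2 / 2| <= 1 / 2.
    have : q ^+ 2 <= 1 by rewrite expr_le1// ltW.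
    by move=> h; rewrite ger0_norm ?divr_ge0 ?sqr_ge0//; lra.
  have h2 : `|q ^+ 2 / 2 * (th ^+ 2 - b ^+ 2)| <= 1 / 2 * (9 * n ^+ 3).
    by rewrite normrM; apply: ler_pM.
  lra.
have cf1 : `|p * (p - 1) / 2| <= 1 / 2.
  by rewrite ler_norml; apply/andP; split; nra.
set rad0 := 1 + p * a + p * (p - 1) / 2 * a ^+ 2 + p / 2 * b ^+ 2 in radle.
have rad1 : `|rad0 - 1| <= 2 * n.
  have -> : rad0 - 1 = p * a + (p * (p - 1) / 2 * a ^+ 2 + p / 2 * b ^+ 2).
    by rewrite /rad0; ring.
  apply: le_trans (ler_normD _ _) _.
  have h1 : `|p * a| <= 1 * n.
    by rewrite normrM (gtr0_norm p0); apply: ler_pM => //; exact: ltW.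
  have h2 : `|p * (p - 1) / 2 * a ^+ 2 + p / 2 * b ^+ 2| <= 1 / 2 * n ^+ 2 + 1 / 2 * n ^+ 2.
    apply: le_trans (ler_normD _ _) _; rewrite !normrM; apply: lerD.
      by rewrite -!normrM; rewrite normrM; apply: ler_pM.
    rewrite -!normrM normrM; apply: ler_pM => //.
    by rewrite ger0_norm; lra.
  lra.
have rad2 : `|rad0| <= 2.
  have -> : rad0 = (rad0 - 1) + 1 by ring.
  by apply: le_trans (ler_normD _ _) _; rewrite normr1; lra.
split.
- have cos1 : `|cos (q * th)| <= 1 by rewrite ler_norml cos_geN1 cos_le1.
  have h := approx_mul radle cosle cos1.
  have -> : rad * cos (q * th) - (1 + p * a + p * (p - 1) / 2 * a ^+ 2 + (p - q ^+ 2) / 2 * b ^+ 2)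
    = (rad * cos (q * th) - rad0 * (1 - q ^+ 2 / 2 * b ^+ 2))
      - q ^+ 2 / 2 * (b ^+ 2 * (rad0 - 1)).
    by rewrite /rad0; field.
  apply: le_trans (ler_normB _ _) _.
  have h1 : `|rad0| * (13 * n ^+ 3) <= 2 * (13 * n ^+ 3).
    by apply: ler_wpM2r => //; lra.
  have q2 : `|q ^+ 2 / 2| <= 1.
    have : q ^+ 2 <= 1 by rewrite expr_le1// ltW.
    by move=> h'; rewrite ger0_norm ?divr_ge0 ?sqr_ge0//; lra.
  have h2 : `|q ^+ 2 / 2 * (b ^+ 2 * (rad0 - 1))| <= 1 * (n ^+ 2 * (2 * n)).
    rewrite normrM; apply: ler_pM => //; rewrite normrM; exact: ler_pM.
  have e : n ^+ 2 * (2 * n) = 2 * n ^+ 3 by ring.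
  by rewrite e mul1r in h2; lra.
- have sin1 : `|sin (q * th)| <= 1 by rewrite ler_norml sin_geN1 sin_le1.
  have h := approx_mul radle sinle sin1.
  have -> : rad * sin (q * th) - (q * b + (p - 1) * q * (a * b)) =
    (rad * sin (q * th) - rad0 * (q * b - q * (a * b))) +
    (q * b * (rad0 - 1 - p * a) - q * (a * b) * (rad0 - 1)) by ring.
  apply: le_trans (ler_normD _ _) _.
  have h1 : `|rad0| * (18 * n ^+ 3) <= 2 * (18 * n ^+ 3).
    by apply: ler_wpM2r => //; lra.
  have r2 : `|rad0 - 1 - p * a| <= n ^+ 2.
    have -> : rad0 - 1 - p * a = p * (p - 1) / 2 * a ^+ 2 + p / 2 * b ^+ 2.
      by rewrite /rad0; ring.
    apply: le_trans (ler_normD _ _) _.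
    have e1 : `|p * (p - 1) / 2 * a ^+ 2| <= 1 / 2 * n ^+ 2.
      by rewrite normrM; apply: ler_pM.
    have e2 : `|p / 2 * b ^+ 2| <= 1 / 2 * n ^+ 2.
      by rewrite normrM; apply: ler_pM => //; rewrite ger0_norm; lra.
    lra.
  have qb : `|q * b| <= 1 * n.
    by rewrite normrM (gtr0_norm q0); apply: ler_pM => //; exact: ltW.
  have qab : `|q * (a * b)| <= 1 * n ^+ 2.
    by rewrite normrM (gtr0_norm q0); apply: ler_pM => //; exact: ltW.
  have h2 : `|q * b * (rad0 - 1 - p * a)| <= 1 * n * n ^+ 2.
    by rewrite normrM; apply: ler_pM.
  have h3 : `|q * (a * b) * (rad0 - 1)| <= 1 * n ^+ 2 * (2 * n).
    by rewrite normrM; apply: ler_pM.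
  have e1 : 1 * n * n ^+ 2 = n ^+ 3 by ring.
  have e2 : 1 * n ^+ 2 * (2 * n) = 2 * n ^+ 3 by ring.
  rewrite e1 in h2; rewrite e2 in h3.
  have := ler_normB (q * b * (rad0 - 1 - p * a)) (q * (a * b) * (rad0 - 1)).
  lra.
Qed.
End polar_expansion.

Section barrier.
Context {R : realType}.
Implicit Types (p q : R) (y x : R * R).

(** By concavity the power lies below its tangent at [w]; for [w = 1] this is
    Young's inequality. *)
Lemma powR_tangent (k w z : R) : 0 < k < 1 -> 0 < w -> 0 <= z ->
  z `^ k <= w `^ k + k * w `^ (k - 1) * (z - w).
Proof.
move=> /andP[k0 k1] w0 z0.
have base t : 0 <= t -> t `^ k <= 1 + k * (t - 1).
  move=> t0; have := @conjugate_powR R (t `^ k) 1 k^-1 (1 - k)^-1.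
  rewrite !invrK powR_ge0 ler01 !invr_gt0 k0 subr_gt0 k1 => h.
  have e : k + (1 - k) = 1 by ring.
  have := h isT isT isT isT e.
  rewrite mulr1 -powRrM mulfV ?gt_eqF// powRr1// powR1; lra.
have -> : z = w * (z / w) by field; rewrite gt_eqF.
have zw : 0 <= z / w by rewrite divr_ge0// ltW.
have w0' := ltW w0.
rewrite powRM//.
have -> : w `^ k + k * w `^ (k - 1) * (w * (z / w) - w) =
    w `^ k + k * (w * w `^ (k - 1)) * (z / w - 1) by ring.
rewrite mulr_powRB1//.
have -> : w `^ k + k * w `^ k * (z / w - 1) = w `^ k * (1 + k * (z / w - 1)) by ring.
by rewrite ler_wpM2l ?powR_ge0// base.
Qed.

Definition sqn y := y.1 ^+ 2 + y.2 ^+ 2.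

(** Cosine of the angle between [y] and [(-1, -1)], the axis of the complement of
    the first quadrant. *)
Definition dir y := - (y.1 + y.2) / Num.sqrt (2 * sqn y).

(** Halfway between [3 * pi / 4], the half-aperture of the complement of the
    quadrant, and [pi / (2 * q)], where [cos (q * _)] vanishes. *)
Definition cone_angle q := (pi * (3 / 4) + pi / (2 * q)) / 2.

(** [r ^ p * cos (q * theta)] in polar coordinates around the axis [(-1, -1)].
    Freezing the angle beyond [cone_angle] keeps the function positive on the
    whole plane, where the walk may land. *)
Definition barrier p q y :=
  sqn y `^ (p / 2) * cos (q * Num.min (acos (dir y)) (cone_angle q)).

Lemma sqn_ge0 y : 0 <= sqn y.
Proof. by rewrite addr_ge0 ?sqr_ge0. Qed.

Lemma dir_itv y : -1 <= dir y <= 1.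
Proof.
rewrite -ler_norml /dir normrM normrN normfV.
rewrite (ger0_norm (sqrtr_ge0 _)).
have [s0|s0] := eqVneq (Num.sqrt (2 * sqn y)) 0; first by rewrite s0 invr0 mulr0.
have sp : 0 < Num.sqrt (2 * sqn y) by rewrite lt0r s0 sqrtr_ge0.
rewrite ler_pdivrMr// mul1r -sqrtr_sqr ler_wsqrtr// /sqn.
by have := sqr_ge0 (y.1 - y.2); rewrite sqrrB sqrrD; lra.
Qed.

(** A signed angle, to which the addition formulas apply. *)
Lemma polarP y : 0 < sqn y -> exists2 phi : R, `|phi| = acos (dir y) &
  cos phi = dir y /\ sin phi * Num.sqrt (2 * sqn y) = y.1 - y.2.
Proof.
move=> y0; have d := dir_itv y.
have sp : 0 < Num.sqrt (2 * sqn y) by rewrite sqrtr_gt0 mulr_gt0.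
have cosE : cos (acos (dir y)) = dir y by rewrite acosK// in_itv.
have sinE : sin (acos (dir y)) * Num.sqrt (2 * sqn y) = `|y.1 - y.2|.
  rewrite sin_acos// -sqrtrM; last first.
    by rewrite subr_ge0 -(real_normK (num_real _)) expr_le1// ler_norml.
  rewrite -sqrtr_sqr; congr Num.sqrt; rewrite /dir expr_div_n sqr_sqrtr; last first.
    by rewrite mulr_ge0 ?sqn_ge0.
  by rewrite mulrBl mul1r divfK ?gt_eqF ?mulr_gt0// /sqn; ring.
have [yle|yge] := leP 0 (y.1 - y.2).
  exists (acos (dir y)); first by rewrite ger0_norm ?acos_ge0.
  by rewrite cosE sinE ger0_norm.
exists (- acos (dir y)); first by rewrite normrN ger0_norm ?acos_ge0.
by rewrite cosN cosE sinN mulNr sinE ltr0_norm// opprK.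
Qed.

Section fixed_exponents.
Variables p q : R.
Hypothesis pqP : [/\ 0 < p, p < q, 1 / 2 <= q & q < 2 / 3].
Local Notation Phi := (cone_angle q).
Local Notation c0 := (cos (q * Phi)).

Let q_gt0 : 0 < q. Proof. by have [p0 pq _ _] := pqP; lra. Qed.

Lemma cone_angleP : [/\ pi * (3 / 4) < Phi, 0 <= q * Phi, q * Phi < pi / 2 & Phi < pi].
Proof.
have [p0 pq q12 q23] := pqP; have q0 := q_gt0.
have P0 := @pi_gt0 R; rewrite /cone_angle; move: (pi : R) P0 => P P0.
have q20 : 0 < 2 * q by lra.
have e : 3 / 4 < (2 * q)^-1.
  have -> : 3 / 4 = (4 / 3)^-1 :> R by field.
  by rewrite ltf_pV2 ?posrE//; lra.
have e2 : (2 * q)^-1 <= 1 by rewrite invf_le1//; lra.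
have qe : q * (2 * q)^-1 = 1 / 2 by field; rewrite gt_eqF.
have h1 : P * (3 / 4) < P / (2 * q) by rewrite ltr_pM2l.
have h2 : P / (2 * q) <= P by rewrite ler_piMr// ltW.
have h3 : q * (P / (2 * q)) = P / 2 by rewrite mulrCA qe; field.
have h4 : q * (P * (3 / 4)) < q * (P / (2 * q)) by rewrite ltr_pM2l.
have h5 : 0 < q * (P * (3 / 4)) by rewrite !mulr_gt0//; lra.
split; lra.
Qed.

Lemma barrier_const_gt0 : 0 < c0.
Proof.
have [_ h1 h2 _] := cone_angleP; apply: cos_gt0_pihalf; apply/andP; split => //.
by apply: lt_le_trans h1; rewrite oppr_lt0 divr_gt0 ?pi_gt0.
Qed.

Lemma cos_ge_const (t : R) : 0 <= t <= Phi -> c0 <= cos (q * t).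
Proof.
move=> /andP[t0 tP]; have [_ h1 h2 _] := cone_angleP.
have P0 := @pi_gt0 R; have q0 := ltW q_gt0.
have qt0 : 0 <= q * t by rewrite mulr_ge0.
have qtP : q * t <= q * Phi by rewrite ler_wpM2l.
have itv z : 0 <= z -> z <= q * Phi -> z \in `[0, pi].
  by move=> z0 zP; rewrite in_itv/= z0/=; move: h2 P0; move: (pi : R) => P; lra.
by rewrite leNgt ltr_cos ?itv// -leNgt.
Qed.

Lemma barrier_ge y : c0 * sqn y `^ (p / 2) <= barrier p q y.
Proof.
rewrite mulrC /barrier ler_wpM2l ?powR_ge0// cos_ge_const//.
have [h _ _ _] := cone_angleP; have P0 := @pi_gt0 R.
rewrite le_min ge_min lexx orbT andbT acos_ge0 ?dir_itv//=.
by apply/ltW/(le_lt_trans _ h); rewrite mulr_ge0 ?pi_ge0.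
Qed.

Lemma barrier_le y : barrier p q y <= sqn y `^ (p / 2).
Proof. by rewrite /barrier ler_piMr ?powR_ge0// cos_le1. Qed.

Lemma barrier_ge0 y : 0 <= barrier p q y.
Proof.
apply: le_trans (barrier_ge y).
by rewrite mulr_ge0 ?powR_ge0// ltW// barrier_const_gt0.
Qed.

(** Components of [x] along and across [y], in units of [|y|]. *)
Definition along y x := (x.1 * y.1 + x.2 * y.2) / sqn y.
Definition across y x := (x.2 * y.1 - x.1 * y.2) / sqn y.

Lemma sqn_add y x : 0 < sqn y ->
  sqn (y.1 + x.1, y.2 + x.2) =
  sqn y * ((1 + along y x) ^+ 2 + across y x ^+ 2).
Proof.
move=> y0; rewrite /along /across; move: (y0); rewrite /sqn /= => y0'.
by field; rewrite gt_eqF.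
Qed.

Lemma sqr_along_across y x : 0 < sqn y ->
  along y x ^+ 2 + across y x ^+ 2 = sqn x / sqn y.
Proof.
move=> y0; rewrite /along /across; move: (y0); rewrite /sqn /= => y0'.
by field; rewrite gt_eqF.
Qed.

(** In the frame of [y], adding [x] is multiplication by the complex number
    [1 + along y x + i * across y x], so the angles add up. *)
Lemma dir_add y x phi : 0 < sqn y -> cos phi = dir y ->
  sin phi * Num.sqrt (2 * sqn y) = y.1 - y.2 -> 0 < 1 + along y x ->
  dir (y.1 + x.1, y.2 + x.2) =
  cos (phi + atan (across y x / (1 + along y x))).
Proof.
move=> y0 cphi sphi a1.
set a := along y x in a1 *; set b := across y x; set t := b / (1 + a).
have sp : 0 < Num.sqrt (2 * sqn y) by rewrite sqrtr_gt0 mulr_gt0.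
have t1 : 0 < 1 + t ^+ 2 by rewrite ltr_pwDl// sqr_ge0.
have st : 0 < Num.sqrt (1 + t ^+ 2) by rewrite sqrtr_gt0.
have ct : cos (atan t) = (Num.sqrt (1 + t ^+ 2))^-1 by rewrite cos_atan.
have ct0 : cos (atan t) != 0 by rewrite ct invr_eq0 gt_eqF.
have sint : sin (atan t) = t / Num.sqrt (1 + t ^+ 2).
  by rewrite -ct -{2}(atanK t) /tan divfK.
rewrite cosD cphi ct sint.
rewrite /dir sqn_add// -/a -/b.
have -> : Num.sqrt (2 * (sqn y * ((1 + a) ^+ 2 + b ^+ 2))) =
    Num.sqrt (2 * sqn y) * (1 + a) * Num.sqrt (1 + t ^+ 2) :> R.
  have -> : 2 * (sqn y * ((1 + a) ^+ 2 + b ^+ 2)) =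
    (2 * sqn y) * ((1 + a) ^+ 2 * (1 + t ^+ 2)).
    by rewrite /t; field; rewrite gt_eqF.
  rewrite sqrtrM ?mulr_ge0 ?sqn_ge0// [X in _ * X]sqrtrM ?sqr_ge0//.
  by rewrite sqrtr_sqr gtr0_norm// mulrA.
have sE : sin phi = (y.1 - y.2) / Num.sqrt (2 * sqn y).
  by rewrite -sphi mulfK// gt_eqF.
have num : - (y.1 + x.1 + (y.2 + x.2)) =
    - (y.1 + y.2) * (1 + a) - (y.1 - y.2) * b.
  rewrite /a /b /along /across; move: (y0); rewrite /sqn => y0'.
  by field; rewrite gt_eqF.
rewrite /= num sE; move: sp st.
move: (Num.sqrt (2 * sqn y)) (Num.sqrt (1 + t ^+ 2)) => S T S0 T0.
by rewrite /t; field; rewrite !gt_eqF.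
Qed.

(** The second hypothesis on [n] keeps [y + x] inside the cone where the barrier
    is the real part of a generalised power. *)
Lemma barrier_add y x phi : 0 < sqn y -> `|phi| = acos (dir y) -> cos phi = dir y ->
  sin phi * Num.sqrt (2 * sqn y) = y.1 - y.2 -> `|phi| <= pi * (3 / 4) ->
  let n := `|along y x| + `|across y x| in
  let rad := ((1 + along y x) ^+ 2 + across y x ^+ 2) `^ (p / 2) in
  let th := atan (across y x / (1 + along y x)) in
  n <= 1 / 8 -> 2 * n <= Phi - pi * (3 / 4) ->
  barrier p q (y.1 + x.1, y.2 + x.2) = sqn y `^ (p / 2) *
    (cos (q * phi) * (rad * cos (q * th)) - sin (q * phi) * (rad * sin (q * th))).
Proof.
move=> y0 phiE cphi sphi phile n rad th n8 nPhi.
have [_ thn] := angle_approx n8.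
have a1 : 0 < 1 + along y x.
  have : `|along y x| <= n by rewrite lerDl.
  by rewrite ler_norml => /andP[]; lra.
rewrite /barrier (dir_add y0 cphi sphi a1) sqn_add// powRM ?sqn_ge0//; last first.
  by rewrite addr_ge0 ?sqr_ge0.
rewrite -/rad -/th; rewrite -/th -/n in thn.
have [_ _ _ Phipi] := cone_angleP.
have phth : `|phi + th| <= Phi by apply: le_trans (ler_normD _ _) _; lra.
have acosE : acos (cos (phi + th)) = `|phi + th|.
  have [s0|s0] := leP 0 (phi + th).
    rewrite ger0_norm// cosK// in_itv/= s0/=.
    by move: phth; rewrite ger0_norm// => /le_trans -> //; exact: ltW.
  rewrite ltr0_norm// -cosN cosK// in_itv/= oppr_ge0 (ltW s0)/=.
  by move: phth; rewrite ltr0_norm// => /le_trans -> //; exact: ltW.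
rewrite acosE min_l// -mulrA; congr (_ * _).
have -> : cos (q * `|phi + th|) = cos (q * phi + q * th).
  rewrite -mulrDr; have [s0|s0] := leP 0 (phi + th); first by rewrite ger0_norm.
  by rewrite ltr0_norm// mulrN cosN.
by rewrite cosD; ring.
Qed.
End fixed_exponents.
End barrier.

Section superharmonic.
Context {R : realType}.
Implicit Types (p q : R) (y x : R * R).
Variables p q : R.
Hypothesis pqP : [/\ 0 < p, p < q, 1 / 2 <= q & q < 2 / 3].
Local Notation Phi := (cone_angle q).
Local Notation c0 := (cos (q * Phi)).

(** Small increments fall under [barrier_add] and [polar_approx]; for the others
    the fourth order term absorbs the crude bound [barrier_le]. So one quartic
    polynomial dominates everywhere, and the moments of the increment suffice. *)
Lemma barrier_add_le (lam : R) : 0 < lam -> exists2 K, 0 <= K &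
  forall y, 0 < sqn y -> acos (dir y) <= pi * (3 / 4) ->
  exists C D, [/\ c0 <= C <= 1, `|D| <= 1, barrier p q y = sqn y `^ (p / 2) * C &
  forall x, barrier p q (y.1 + x.1, y.2 + x.2) <= sqn y `^ (p / 2) *
   (C * (1 + p * along y x + p * (p - 1) / 2 * along y x ^+ 2
          + (p - q ^+ 2) / 2 * across y x ^+ 2)
    - D * (q * across y x + (p - 1) * q * (along y x * across y x))
    + lam * (sqn x / sqn y)
    + K * (sqn x / sqn y) ^+ 2)].
Proof.
move=> lam0.
have [p0 pq q12 q23] := pqP.
have [Phi1 _ _ Phi2] := cone_angleP pqP.
have p01 : 0 < p < 1 by apply/andP; split; lra.
have q01 : 0 < q < 1 by apply/andP; split; lra.
have p1 : p <= 1 by lra.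
have q1 : q <= 1 by lra.
have pq1 : `|(p - 1) * q| <= 1.
  by move: p0 p1 q1 pq; clear; rewrite ler_norml => *; apply/andP; split; nra.
have p12 : p / 2 <= 1 / 2 by lra.
have k01 : 0 < p / 2 < 1 by apply/andP; split; lra.
pose A := p * (p - 1) / 2; pose B := (p - q ^+ 2) / 2.
have A1 : `|A| <= 1 by case/andP: p01 => *; rewrite /A ler_norml; apply/andP; split; nra.
have q2 : 0 <= q ^+ 2 <= 1 by rewrite sqr_ge0 expr_le1//; lra.
have B1 : `|B| <= 1.
  by case/andP: q2 => *; rewrite /B ler_norml; apply/andP; split; lra.
have [M M0 approx] : exists2 M : R, 0 <= M & forall a b : R, `|a| + `|b| <= 1 / 8 ->
    let rad := ((1 + a) ^+ 2 + b ^+ 2) `^ (p / 2) in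
    let th := atan (b / (1 + a)) in
    `|rad * cos (q * th) -
      (1 + p * a + p * (p - 1) / 2 * a ^+ 2 + (p - q ^+ 2) / 2 * b ^+ 2)|
    <= M * (`|a| + `|b|) ^+ 3 /\
    `|rad * sin (q * th) - (q * b + (p - 1) * q * (a * b))|
    <= M * (`|a| + `|b|) ^+ 3.
  exists 600; [exact: ler0n|exact: polar_approx].
(* up to relative size eta the expansion holds and the angle stays in the cone *)
pose eta : R := Num.min (1 / 8) ((Phi - pi * (3 / 4)) / 2).
have eta0 : 0 < eta by rewrite lt_min divr_gt0//= divr_gt0// subr_gt0.
pose K := 8 * M ^+ 2 / lam + 36 / eta ^+ 4.
exists K; first by rewrite addr_ge0// divr_ge0 ?mulr_ge0 ?sqr_ge0 ?exprn_ge0// ltW.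
move=> y y0 yle.
have [phi phiE [cphi sphi]] := polarP y0.
set C := cos (q * phi); set D := sin (q * phi).
have q0 : 0 < q by lra.
exists C, D; split.
- rewrite cos_le1 andbT /C.
  have -> : cos (q * phi) = cos (q * `|phi|).
    have [s0|s0] := leP 0 phi; first by rewrite ger0_norm.
    by rewrite ltr0_norm// mulrN cosN.
  apply: (cos_ge_const pqP); rewrite normr_ge0/= phiE.
  by apply/ltW/(le_lt_trans yle).
- by rewrite ler_norml sin_geN1 sin_le1.
- rewrite /barrier min_l; last by apply/ltW/(le_lt_trans yle).
  rewrite -phiE; congr (_ * _); rewrite /C.
  have [s0|s0] := leP 0 phi; first by rewrite ger0_norm.
  by rewrite ltr0_norm// mulrN cosN.
move=> x; rewrite -sqr_along_across//.
set a := along y x; set b := across y x.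
pose n : R := `|a| + `|b|; pose w : R := a ^+ 2 + b ^+ 2.
rewrite -/w.
have w0 : 0 <= w by rewrite addr_ge0 ?sqr_ge0.
have n0 : 0 <= n by rewrite addr_ge0.
have nw : n ^+ 2 <= 2 * w.
  rewrite /w -(real_normK (num_real a)) -(real_normK (num_real b)) /n.
  by have := sqr_ge0 (`|a| - `|b|); rewrite sqrrB sqrrD; lra.
have C1 : `|C| <= 1 by rewrite ler_norml cos_geN1 cos_le1.
have D1 : `|D| <= 1 by rewrite ler_norml sin_geN1 sin_le1.
rewrite -/A -/B.
set U := 1 + p * a + A * a ^+ 2 + B * b ^+ 2.
set V := q * b + (p - 1) * q * (a * b).
have [nle|nge] := leP n eta.
  have n8 : n <= 1 / 8 by apply: (le_trans nle); rewrite ge_min lexx.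
  have n2 : 2 * n <= Phi - pi * (3 / 4).
    rewrite mulrC -ler_pdivlMr//; apply: (le_trans nle).
    by rewrite ge_min lexx orbT.
  have phile : `|phi| <= pi * (3 / 4) by rewrite phiE.
  rewrite (barrier_add pqP y0 phiE cphi sphi phile n8 n2).
  rewrite -/a -/b ler_wpM2l ?powR_ge0// -/C -/D.
  have [] := approx _ _ n8.
  rewrite -/a -/b -/n -/A -/B -/U -/V.
  set X := _ * cos _; set Y := _ * sin _ => XU YV.
  have h1 : `|C * (X - U)| <= 1 * (M * n ^+ 3) by rewrite normrM; apply: ler_pM.
  have h2 : `|D * (Y - V)| <= 1 * (M * n ^+ 3) by rewrite normrM; apply: ler_pM.
  have h3 : C * X - D * Y <= C * U - D * V + 2 * M * n ^+ 3.
    have -> : C * X - D * Y = C * U - D * V + (C * (X - U) - D * (Y - V)) by ring.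
    rewrite lerD2l; move: (le_trans (ler_norm _) h1) h2; clear.
    by rewrite ler_norml => ? /andP[? ?]; lra.
  apply: (le_trans h3); rewrite -!addrA !lerD2l.
  (* the cubic error is split between a small quadratic and a quartic term *)
  have h4 : 2 * M * n ^+ 3 <= lam / 2 * n ^+ 2 + 4 * M ^+ 2 / (2 * lam) * n ^+ 4.
    rewrite -subr_ge0.
    have -> : lam / 2 * n ^+ 2 + 4 * M ^+ 2 / (2 * lam) * n ^+ 4 - 2 * M * n ^+ 3 =
      n ^+ 2 * (lam - 2 * M * n) ^+ 2 / (2 * lam) by field; rewrite gt_eqF.
    by apply: divr_ge0; [rewrite mulr_ge0 ?sqr_ge0|rewrite mulr_ge0// ltW].
  apply: (le_trans h4); apply: lerD.
    have -> : lam * w = lam / 2 * (2 * w) by field.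
    by rewrite ler_wpM2l// divr_ge0// ltW.
  apply: (@le_trans _ _ (8 * M ^+ 2 / lam * w ^+ 2)).
    have -> : 8 * M ^+ 2 / lam * w ^+ 2 = 4 * M ^+ 2 / (2 * lam) * (2 * w) ^+ 2.
      by field; rewrite gt_eqF.
    have -> : n ^+ 4 = (n ^+ 2) ^+ 2 by ring.
    rewrite ler_wpM2l ?divr_ge0 ?sqr_ge0 ?mulr_ge0//; first exact: ltW.
    by rewrite lerXn2r ?nnegrE ?sqr_ge0 ?mulr_ge0.
  rewrite ler_wpM2r ?sqr_ge0// lerDl divr_ge0// exprn_ge0// ltW//.
apply: (le_trans (barrier_le _ _ _)).
rewrite sqn_add// powRM ?sqn_ge0//; last by rewrite addr_ge0 ?sqr_ge0.
rewrite ler_wpM2l ?powR_ge0// -/a -/b.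
have s0 : 0 <= (1 + a) ^+ 2 + b ^+ 2 by rewrite addr_ge0 ?sqr_ge0.
apply: (le_trans (powR_tangent k01 ltr01 s0)).
rewrite !powR1 mulr1.
have an : `|a| <= n by rewrite lerDl.
have bn : `|b| <= n by rewrite lerDr.
have lhs : 1 + p / 2 * ((1 + a) ^+ 2 + b ^+ 2 - 1) <= 1 + n + w.
  have -> : (1 + a) ^+ 2 + b ^+ 2 - 1 = 2 * a + w by rewrite /w; ring.
  have h : 2 * a + w <= 2 * n + w.
    by rewrite lerD2r ler_pM2l//; apply: le_trans an; exact: ler_norm.
  have hp : p / 2 * (2 * a + w) <= p / 2 * (2 * n + w).
    by rewrite ler_wpM2l//; case/andP: k01 => /ltW.
  have : p / 2 * (2 * n + w) <= 1 / 2 * (2 * n + w).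
    by apply: ler_wpM2r => //; rewrite addr_ge0 ?mulr_ge0.
  by move: h hp w0; clear; lra.
have Uge : `|U| <= 1 + n + w.
  rewrite /U; apply: (le_trans (ler_normD _ _)).
  have e1 : `|B * b ^+ 2| <= 1 * b ^+ 2.
    by rewrite normrM (ger0_norm (sqr_ge0 b)) ler_wpM2r ?sqr_ge0.
  have e2 : `|A * a ^+ 2| <= 1 * a ^+ 2.
    by rewrite normrM (ger0_norm (sqr_ge0 a)) ler_wpM2r ?sqr_ge0.
  have e3 : `|p * a| <= 1 * n.
    by rewrite normrM (gtr0_norm p0); apply: ler_pM => //; exact: ltW.
  have e4 := ler_normD (1 + p * a) (A * a ^+ 2).
  have e5 := ler_normD 1 (p * a).
  rewrite normr1 in e5; move: e1 e2 e3 e4 e5; rewrite /w; clear; lra.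
have Vge : `|V| <= n + 2 * w.
  apply: (le_trans (ler_normD _ _)).
  have e1 : `|q * b| <= 1 * n.
    by rewrite normrM (gtr0_norm q0); apply: ler_pM => //; exact: ltW.
  have e2 : `|(p - 1) * q * (a * b)| <= 1 * (n * n).
    by rewrite normrM; apply: ler_pM => //; rewrite normrM; apply: ler_pM.
  by move: e1 e2 nw; rewrite expr2; clear; lra.
have CU : `|C * U| <= 1 * (1 + n + w) by rewrite normrM; apply: ler_pM.
have DV : `|D * V| <= 1 * (n + 2 * w) by rewrite normrM; apply: ler_pM.
have key : 2 + 3 * n + 4 * w <= 36 / eta ^+ 4 * w ^+ 2.
  have ew : eta ^+ 2 <= 2 * w.
    by apply: le_trans nw; rewrite lerXn2r ?nnegrE//; exact: ltW.
  have e1 : eta ^+ 2 <= 1 / 64.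
    have -> : 1 / 64 = (1 / 8) ^+ 2 :> R by field.
    by rewrite lerXn2r ?nnegrE ?(ltW eta0)// ge_min lexx.
  have e2 : 0 < eta ^+ 2 by rewrite exprn_gt0.
  have -> : 36 / eta ^+ 4 * w ^+ 2 = 9 * (2 * w / eta ^+ 2) ^+ 2.
    by field; rewrite gt_eqF.
  set r := 2 * w / eta ^+ 2.
  have r1 : 1 <= r by rewrite ler_pdivlMr// mul1r.
  have wr : 2 * w <= r / 64.
    have -> : 2 * w = r * eta ^+ 2 by rewrite /r divfK// gt_eqF.
    by rewrite ler_wpM2l//; lra.
  have nr : n <= r.
    have : n ^+ 2 <= r ^+ 2.
      by apply: le_trans nw _; rewrite expr2; move: wr r1; clear; nra.
    by rewrite ler_pXn2r ?nnegrE// (le_trans ler01 r1).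
  by move: wr nr r1; clear; nra.
have K0 : 0 <= 8 * M ^+ 2 / lam * w ^+ 2.
  by rewrite mulr_ge0 ?sqr_ge0// divr_ge0 ?mulr_ge0 ?sqr_ge0// ltW.
have lw : 0 <= lam * w by rewrite mulr_ge0// ltW.
rewrite /K mulrDl.
move: lhs CU DV key K0 lw; clear; rewrite !ler_norml => h1 /andP[h2 _] /andP[_ h3] h4 h5 h6.
lra.
Qed.
End superharmonic.

Section barrier_drift.
Context {R : realType}.
Variables p q : R.
Hypothesis pqP : [/\ 0 < p, p < q, 1 / 2 <= q & q < 2 / 3].
Local Notation bR := (measurableTypeR R).

Lemma measurable_sqn : measurable_fun setT (sqn : bR * bR -> bR).
Proof.
by apply: measurable_funD; apply: measurable_funX;
  [exact: measurable_fst|exact: measurable_snd].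
Qed.

(* acos is monotone on [-1, 1] only *)
Let clamp (x : R) := Num.max (-1) (Num.min 1 x).

Let clamp_itv x : -1 <= clamp x <= 1.
Proof. by rewrite /clamp le_max lexx/= ge_max ge_min lexx/= andbT; lra. Qed.

Let clampK x : -1 <= x <= 1 -> clamp x = x.
Proof. by move=> /andP[x1 x2]; rewrite /clamp min_r// max_r. Qed.

Let measurable_acos_clamp : measurable_fun setT (fun x : bR => acos (clamp x) : bR).
Proof.
apply: nonincreasing_measurable => // x y xy; rewrite leNgt; apply/negP => lt.
have [cx cy] := (clamp_itv x, clamp_itv y).
have px : acos (clamp x) \in `[0, pi] by rewrite in_itv/= acos_ge0// acos_lepi.
have py : acos (clamp y) \in `[0, pi] by rewrite in_itv/= acos_ge0// acos_lepi.
move: lt; rewrite -(ltr_cos px py) !acosK ?in_itv// ltNge => /negP; apply.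
by rewrite /clamp ge_max !le_max lexx/= le_min !ge_min xy lexx !orbT.
Qed.

Lemma measurable_barrier : measurable_fun setT (barrier p q : bR * bR -> bR).
Proof.
have ms := measurable_sqn.
have md : measurable_fun setT (dir : bR * bR -> bR).
  have -> : (dir : bR * bR -> bR) = (fun y : bR * bR =>
      - (y.1 + y.2) * (2 * sqn y) `^ (- 2^-1)).
    by apply/funext => y; rewrite /dir powRN powR12_sqrt// mulr_ge0 ?sqn_ge0.
  apply: measurable_funM.
    apply: measurable_funN; apply: measurable_funD;
      [exact: measurable_fst|exact: measurable_snd].
  apply: (measurableT_comp (@measurable_powR R _)).
  exact: measurable_funM.
have ma : measurable_fun setT (fun y : bR * bR => acos (dir y) : bR).
  rewrite (_ : (fun y => _) = fun y : bR * bR => acos (clamp (dir y))).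
    exact: (measurableT_comp measurable_acos_clamp).
  by apply/funext => y; rewrite clampK// dir_itv.
apply: measurable_funM; first exact: (measurableT_comp (@measurable_powR R _)).
apply: (measurableT_comp (f := (@cos R : bR -> bR))).
  by apply: continuous_measurable_fun => x; exact: continuous_cos.
apply: measurable_funM => //.
exact: measurable_minr.
Qed.

(** The drift [(p ^ 2 - q ^ 2) / 2] per unit of squared displacement is
    negative because the radial exponent [p] is smaller than the angular one
    [q]; far from the apex it outweighs the error terms. *)
Lemma barrier_superharmonic (K4 : R) : 0 <= K4 -> exists2 rho, 0 < rho &
  forall (g : probability bR R) v, quartic_moments g v K4 -> 0 < v ->
  forall y : R * R, rho * v <= sqn y -> acos (dir y) <= pi * (3 / 4) ->
  (\int[g]_x1 \int[g]_x2 (barrier p q (y.1 + x1, y.2 + x2))%:E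
     <= (barrier p q y)%:E)%E.
Proof.
move=> K40; have [p0 pq q12 q23] := pqP.
have c00 := barrier_const_gt0 pqP.
set c0 := cos _ in c00.
have dr0 : 0 < q ^+ 2 - p ^+ 2.
  by rewrite subr_sqr mulr_gt0//; [rewrite subr_gt0|lra].
pose lam := c0 * (q ^+ 2 - p ^+ 2) / 8.
have lam0 : 0 < lam by rewrite /lam !mulr_gt0.
have [K K0 HK] := barrier_add_le pqP lam0.
(* from this distance on, the quartic error is at most lam *)
pose rho := 4 * K * K4 / lam + 1.
have rho0 : 0 < rho.
  by rewrite /rho ltr_wpDl// divr_ge0 ?mulr_ge0// ltW.
exists rho => // g v gm v0 y yrho yangle.
have y0 : 0 < sqn y by apply: lt_le_trans yrho; rewrite mulr_gt0.
have [C [D [/andP[C0 C1] D1 -> Hx]]] := HK y y0 yangle.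
set s := sqn y in y0 yrho Hx *.
set P := s `^ (p / 2) in Hx *.
have P0 : 0 <= P by exact: powR_ge0.
pose A := p * (p - 1) / 2; pose B := (p - q ^+ 2) / 2.
have mb : measurable_fun setT
    (fun x : bR * bR => (barrier p q (y.1 + x.1, y.2 + x.2))%:E).
  apply/measurable_EFinP; apply: (measurableT_comp measurable_barrier).
  apply/measurable_fun_pairP; split => /=.
    by apply: measurable_funD => //; exact: measurable_fst.
  by apply: measurable_funD => //; exact: measurable_snd.
have := @planar_quartic_bound R g v K4
  (fun x : bR * bR => (barrier p q (y.1 + x.1, y.2 + x.2))%:E)
  (P * C)
  (P * (C * p * y.1 + D * q * y.2) / s)
  (P * (C * p * y.2 - D * q * y.1) / s)
  (P * (C * (A * y.1 ^+ 2 + B * y.2 ^+ 2) + D * (p - 1) * q * (y.1 * y.2)) / s ^+ 2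
     + P * lam / s)
  (P * (2 * C * (A - B) * (y.1 * y.2) - D * (p - 1) * q * (y.1 ^+ 2 - y.2 ^+ 2)) / s ^+ 2)
  (P * (C * (A * y.2 ^+ 2 + B * y.1 ^+ 2) - D * (p - 1) * q * (y.1 * y.2)) / s ^+ 2
     + P * lam / s)
  (P * (2 * K) / s ^+ 2) gm mb.
move=> H; apply: le_trans (H _ _ _) _ => {H}.
- by move=> z; rewrite lee_fin barrier_ge0.
- by rewrite divr_ge0 ?sqr_ge0// mulr_ge0// mulr_ge0.
- move=> x1 x2; rewrite lee_fin /=; apply: (le_trans (Hx (x1, x2))).
  rewrite -/A -/B /along /across -/s /= /sqn /=.
  rewrite -subr_ge0; have sn0 : s != 0 by rewrite gt_eqF.
  set L := (X in 0 <= X).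
  have -> : L = P * K / s ^+ 2 * (x1 ^+ 2 - x2 ^+ 2) ^+ 2.
    by rewrite /L; field.
  by rewrite mulr_ge0 ?sqr_ge0// divr_ge0 ?sqr_ge0// mulr_ge0.
rewrite lee_fin.
have sE : y.1 ^+ 2 + y.2 ^+ 2 = s by [].
set L := (X in X <= _).
have -> : L = P * C - P * v / s *
   (C * (q ^+ 2 - p ^+ 2) / 2 - 2 * lam - 4 * K * K4 * v / s).
  rewrite /L; have -> : y.2 ^+ 2 = s - y.1 ^+ 2 by rewrite -sE addrAC subrr add0r.
  by rewrite /A /B; field; rewrite gt_eqF.
rewrite gerBl; apply: mulr_ge0.
  by rewrite divr_ge0 ?mulr_ge0 ?(ltW v0) ?(ltW y0).
have e1 : 4 * K * K4 * v / s <= lam.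
  rewrite ler_pdivrMr//.
  have : 4 * K * K4 <= lam * rho.
    rewrite /rho mulrDr mulr1 mulrCA mulfV ?gt_eqF// mulr1.
    by rewrite lerDl ltW.
  move=> h; apply: (@le_trans _ _ (lam * (rho * v))).
    by rewrite mulrA ler_wpM2r// ltW.
  by rewrite ler_wpM2l// ltW.
have e2 : 8 * lam <= C * (q ^+ 2 - p ^+ 2).
  have -> : 8 * lam = c0 * (q ^+ 2 - p ^+ 2) by rewrite /lam; field.
  by rewrite ler_wpM2r// ltW.
by move: e1 e2 lam0; clear; lra.
Qed.
End barrier_drift.

(** * Waiting for the quadrant *)

Section quadrant_geometry.
Context {R : realType}.
Local Notation bR := (measurableTypeR R).

Lemma powR_subadd (k s t : R) : 0 < k <= 1 -> 0 <= s -> 0 <= t ->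
  (s + t) `^ k <= s `^ k + t `^ k.
Proof.
move=> /andP[k0 k1] s0 t0.
have [st0|st0] := eqVneq (s + t) 0.
  by rewrite st0 powR0 ?gt_eqF// addr_ge0 ?powR_ge0.
have st : 0 < s + t by rewrite lt0r st0 addr_ge0.
have part r : 0 <= r -> r <= s + t -> r / (s + t) * (s + t) `^ k <= r `^ k.
  move=> r0 rst; rewrite le_eqVlt in r0; case/orP: r0 => [/eqP <-|r0].
    by rewrite !mul0r powR_ge0.
  have rs0 : 0 < r / (s + t) by rewrite divr_gt0.
  have {2}-> : r = r / (s + t) * (s + t) by rewrite divfK// gt_eqF.
  rewrite [leRHS]powRM ?(ltW st) ?(ltW rs0)// ler_wpM2r ?powR_ge0//.
  by apply: ger1_powR => //; rewrite rs0 ler_pdivrMr// mul1r.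
have -> : (s + t) `^ k = s / (s + t) * (s + t) `^ k + t / (s + t) * (s + t) `^ k.
  by rewrite -mulrDl -mulrDl divff ?mul1r// gt_eqF.
by apply: lerD; apply: part => //; [rewrite lerDl|rewrite lerDr].
Qed.

Definition in_quadrant (x : R * R) := (0 <= x.1) && (0 <= x.2).

(** The barrier is superharmonic away from its apex only. Moving the apex into the
    quadrant, to [(a, a)], keeps all points outside the quadrant in the cone and
    at distance at least [a] from the apex. *)
Lemma acos_outside_quadrant (a : R) (x : R * R) : 0 <= a -> ~~ in_quadrant x ->
  acos (dir (x.1 - a, x.2 - a)) <= pi * (3 / 4) /\
  a ^+ 2 <= sqn (x.1 - a, x.2 - a).
Proof.
move=> a0 xQ; set y := (_, _).
have P0 := @pi_gt0 R.
have cos34 : cos (pi * (3 / 4)) < 0 :> R.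
  have -> : pi * (3 / 4) = pi / 4 + pi / 2 :> R by field.
  rewrite cosD cos_pihalf sin_pihalf mulr0 mulr1 sub0r oppr_lt0.
  by apply: sin_gt0_pi; rewrite divr_gt0//= ltr_pdivrMr// ltr_pMr//; lra.
have sq34 : cos (pi * (3 / 4)) ^+ 2 = 1 / 2 :> R.
  have : cos (pi * (3 / 4) + pi * (3 / 4)) = 0 :> R.
    have -> : pi * (3 / 4) + pi * (3 / 4) = pi / 2 + pi :> R by field.
    by rewrite cosDpi cos_pihalf oppr0.
  rewrite cosD -!expr2; have := cos2Dsin2 (pi * (3 / 4) : R).
  by move: (cos _ ^+ 2) (sin _ ^+ 2) => u v; lra.
have neg : (y.1 <= - a) || (y.2 <= - a).
  rewrite /y /=; move: xQ; rewrite /in_quadrant negb_and -!ltNge.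
  by case/orP => h; apply/orP; [left|right]; lra.
split; last first.
  rewrite /sqn; case/orP: neg => h.
    have : a ^+ 2 <= y.1 ^+ 2 by rewrite -[y.1 ^+ 2]sqrrN lerXn2r ?nnegrE; lra.
    by have := sqr_ge0 y.2; lra.
  have : a ^+ 2 <= y.2 ^+ 2 by rewrite -[y.2 ^+ 2]sqrrN lerXn2r ?nnegrE; lra.
  by have := sqr_ge0 y.1; lra.
have dy := dir_itv y.
rewrite leNgt; apply/negP => lt.
have px : acos (dir y) \in `[0, pi] by rewrite in_itv/= acos_ge0// acos_lepi.
have p34 : pi * (3 / 4) \in `[0, pi :> R].
  by rewrite in_itv/= mulr_ge0 ?pi_ge0//= ler_piMr ?pi_ge0//; lra.
move: lt; rewrite -(ltr_cos p34 px) acosK ?in_itv// => lt.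
have dsq : 1 / 2 < dir y ^+ 2.
  by rewrite -sq34 -[ltRHS]sqrrN -[ltLHS]sqrrN ltrXn2r// ?nnegrE; lra.
have dneg : dir y < 0 by lra.
have [s0|s0] := eqVneq (sqn y) 0.
  by move: dneg; rewrite /dir s0 mulr0 sqrtr0 invr0 mulr0 ltxx.
have sp : 0 < sqn y by rewrite lt0r s0 sqn_ge0.
have S0 : 0 < Num.sqrt (2 * sqn y) by rewrite sqrtr_gt0 mulr_gt0.
have spos : 0 < y.1 + y.2.
  by move: dneg; rewrite /dir pmulr_llt0 ?invr_gt0// oppr_lt0.
move: dsq; rewrite /dir expr_div_n sqrrN sqr_sqrtr ?mulr_ge0 ?sqn_ge0//.
rewrite ltr_pdivlMr ?mulr_gt0// mulrA divfK// mul1r /sqn ltNge => /negP; apply.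
case/orP: neg => h.
  have : (y.1 + y.2) ^+ 2 <= y.2 ^+ 2 by rewrite lerXn2r ?nnegrE; lra.
  by have := sqr_ge0 y.1; lra.
have : (y.1 + y.2) ^+ 2 <= y.1 ^+ 2 by rewrite lerXn2r ?nnegrE; lra.
by have := sqr_ge0 y.2; lra.
Qed.

(** Jensen's inequality, by integrating the tangent at the mean. *)
Lemma sqn_powR_concave (g : probability bR R) (v K4 k c : R) (x : R * R) :
  quartic_moments g v K4 -> 0 < v -> 0 < k < 1 -> 0 <= c ->
  (\int[g]_x1 \int[g]_x2 ((sqn (x.1 + x1, x.2 + x2) + c) `^ k)%:E <=
    ((sqn x + 2 * v + c) `^ k)%:E)%E.
Proof.
move=> gm v0 k01 c0; set w := sqn x + 2 * v + c.
have w0 : 0 < w by rewrite /w ltr_pwDl// ltr_wpDl ?sqn_ge0// mulr_gt0.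
have [k0 k1] := andP k01.
set P := k * w `^ (k - 1).
have mf : measurable_fun setT
   (fun z : bR * bR => ((sqn (x.1 + z.1, x.2 + z.2) + c) `^ k)%:E).
  apply/measurable_EFinP; apply: (measurableT_comp (@measurable_powR R _)).
  apply: measurable_funD => //; apply: (measurableT_comp measurable_sqn).
  apply/measurable_fun_pairP; split => /=.
    by apply: measurable_funD => //; exact: measurable_fst.
  by apply: measurable_funD => //; exact: measurable_snd.
have := @planar_quartic_bound R g v K4
   (fun z : bR * bR => ((sqn (x.1 + z.1, x.2 + z.2) + c) `^ k)%:E)
   (w `^ k + P * (sqn x + c - w)) (P * (2 * x.1)) (P * (2 * x.2)) P 0 P 0 gm mf.
move=> H; apply: le_trans (H _ _ _) _ => {H} //.
- by move=> z; rewrite lee_fin powR_ge0.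
- move=> x1 x2; rewrite lee_fin /=.
  have s0 : 0 <= sqn (x.1 + x1, x.2 + x2) + c by rewrite addr_ge0 ?sqn_ge0.
  apply: (le_trans (powR_tangent k01 w0 s0)); rewrite -/P.
  rewrite le_eqVlt; apply/orP; left; apply/eqP.
  by rewrite /w /sqn /=; ring.
- rewrite lee_fin le_eqVlt; apply/orP; left; apply/eqP.
  by rewrite /w; ring.
Qed.
End quadrant_geometry.

Section waiting.
Context {R : realType}.
Local Notation bR := (measurableTypeR R).

Lemma planar_integral_le (g : probability bR R) (f1 f2 : bR * bR -> bR) :
  measurable_fun setT f1 -> measurable_fun setT f2 ->
  (forall z, 0 <= f1 z) -> (forall z, f1 z <= f2 z) ->
  (\int[g]_x1 \int[g]_x2 (f1 (x1, x2))%:E <= \int[g]_x1 \int[g]_x2 (f2 (x1, x2))%:E)%E.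
Proof.
move=> mf1 mf2 f10 f12.
have f20 z : 0 <= f2 z by apply: le_trans (f12 z).
have me1 : measurable_fun setT (EFin \o f1) by exact/measurable_EFinP.
have me2 : measurable_fun setT (EFin \o f2) by exact/measurable_EFinP.
rewrite -(fubini_tonelli1 (m1 := g) (m2 := g) (EFin \o f1))//.
rewrite -(fubini_tonelli1 (m1 := g) (m2 := g) (EFin \o f2))//.
by apply: ge0_le_integral => // z _; rewrite lee_fin.
Qed.

Lemma planar_integral_affine (g : probability bR R) (f : bR * bR -> bR) (c e : R) :
  measurable_fun setT f -> (forall z, 0 <= f z) -> 0 <= c -> 0 <= e ->
  (\int[g]_x1 \int[g]_x2 (c * f (x1, x2) + e)%:E =
     c%:E * \int[g]_x1 \int[g]_x2 (f (x1, x2))%:E + e%:E)%E.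
Proof.
move=> mf f0 c0 e0.
have me : measurable_fun setT (EFin \o f) by exact/measurable_EFinP.
have mh : measurable_fun setT (fun z => (c * f z + e)%:E).
  by apply/measurable_EFinP; apply: measurable_funD => //; exact: measurable_funM.
rewrite -(fubini_tonelli1 (m1 := g) (m2 := g) (EFin \o f))//.
rewrite -(fubini_tonelli1 (m1 := g) (m2 := g) (fun z => (c * f z + e)%:E))//; last first.
  by move=> z; rewrite lee_fin addr_ge0 ?mulr_ge0.
under eq_integral do rewrite EFinD EFinM.
rewrite ge0_integralD//.
- rewrite ge0_integralZl//; last by move=> z _; rewrite lee_fin.
  congr (_ + _)%E; rewrite integral_cst//= [X in (_ * X)%E](_ : _ = 1%E) ?mule1//.
  rewrite -setXTT [LHS](product_measure1E g g)//.
  by rewrite -[RHS]mule1; congr (_ * _)%E; exact: probability_setT.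
- by move=> z _; rewrite -EFinM lee_fin mulr_ge0.
- by apply/measurable_EFinP; exact: measurable_funM.
Qed.

(** [G l x] bounds the expected cost [|x'.1| `^ p] of the walk at the end of its
    current stage when it is [x] away from the starting point of the stage and
    [l] steps of the compulsory delay remain; the stage ends when the walk is
    in the quadrant after the delay. After the delay [G] is a barrier whose apex
    is shifted by [a] into the quadrant, where [a] is of the order of one
    increment. During the delay it is a multiple of a power of the mean squared
    distance at the end of the delay, plus a multiple of [v]. By scaling a delay of [m] steps then costs a multiple of
    [(m * v) `^ (p / 2)]; the exponent [2 / 3] is critical because the complement
    of the quadrant has aperture [3 * pi / 2] and [(3 * pi / 2) * (2 / 3) = pi]. *)
Lemma waiting_potential (p K4 : R) : 0 < p < 2 / 3 -> 0 <= K4 ->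
  exists2 M, 0 < M &
  forall (g : probability bR R) v, quartic_moments g v K4 -> 0 < v ->
  exists G : nat -> bR * bR -> bR,
  [/\ forall l, measurable_fun setT (G l),
      forall l x, `|x.1| `^ p <= G l x,
      forall l x, (\int[g]_x1 \int[g]_x2 (G l (x.1 + x1, x.2 + x2))%:E
                     <= (G l.+1 x)%:E)%E,
      forall x, ~~ in_quadrant x ->
        (\int[g]_x1 \int[g]_x2 (G 0%N (x.1 + x1, x.2 + x2))%:E <= (G 0%N x)%:E)%E &
      forall m, (0 < m)%N -> G m (0, 0) <= M * (m%:R * v) `^ (p / 2)].
Proof.
move=> /andP[p0 p23] K40.
pose q : R := (Num.max p (1 / 2) + 2 / 3) / 2.
have qm : Num.max p (1 / 2) < q.
  by rewrite /q ltr_pdivlMr// mulr_natr mulr2n ltrD2l gt_max p23/=; lra.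
have pqP : [/\ 0 < p, p < q, 1 / 2 <= q & q < 2 / 3].
  split => //; first by apply: le_lt_trans qm; rewrite le_max lexx.
    by apply/ltW/(le_lt_trans _ qm); rewrite le_max lexx orbT.
  have : Num.max p (1 / 2) < 2 / 3 by rewrite gt_max p23/=; lra.
  by rewrite /q; lra.
have k01 : 0 < p / 2 < 1 by apply/andP; split; lra.
have k01' : 0 < p / 2 <= 1 by apply/andP; split; lra.
have [k0 k1] := andP k01.
have k0' := ltW k0.
have c00 := barrier_const_gt0 pqP.
set c0 : R := cos _ in c00.
have [rho rho0 Hrho] := barrier_superharmonic pqP K40.
pose A := 4 * rho + 1; have A0 : 0 < A by rewrite /A; lra.
have ic0 : 0 < c0^-1 by rewrite invr_gt0.
pose D := (2 * c0^-1 + 1) * 2 `^ (p / 2).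
have D1 : 1 <= D.
  have h2 : 1 <= 2 `^ (p / 2) :> R.
    by rewrite -[leLHS](powRr0 2); apply: ler_powR => //; lra.
  by rewrite /D -[leLHS]mulr1; apply: ler_pM => //; lra.
have D0 : 0 < D by apply: lt_le_trans D1.
exists (D * (2 + A) `^ (p / 2)).
  by rewrite mulr_gt0// powR_gt0// addr_gt0.
move=> g v gm v0.
pose a := Num.sqrt (rho * v).
have rv0 : 0 <= rho * v by rewrite mulr_ge0// ltW.
have a2 : a ^+ 2 = rho * v by rewrite sqr_sqrtr.
have a0 : 0 <= a by exact: sqrtr_ge0.
pose e := (2 * (rho * v)) `^ (p / 2).
have e0 : 0 <= e by exact: powR_ge0.
pose b (x : bR * bR) : bR := barrier p q (x.1 - a, x.2 - a).
have b0 x : 0 <= b x by exact: barrier_ge0.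
have mb : measurable_fun setT b.
  apply: (measurableT_comp (measurable_barrier p q)).
  apply/measurable_fun_pairP; split => /=.
    by apply: measurable_funB => //; exact: measurable_fst.
  by apply: measurable_funB => //; exact: measurable_snd.
(* the constant e makes up for the shift of the apex in the lower bound Wx *)
pose W (x : bR * bR) : bR := 2 * c0^-1 * b x + e.
pose Dl (l : nat) (x : bR * bR) : bR :=
  (sqn x + (2 * (l%:R * v) + A * v)) `^ (p / 2).
have mDl l : measurable_fun setT (Dl l).
  apply: (measurableT_comp (@measurable_powR R _)).
  by apply: measurable_funD => //; exact: measurable_sqn.
have cl0 l : 0 <= 2 * (l%:R * v) + A * v.
  by rewrite addr_ge0 ?mulr_ge0 ?ler0n ?(ltW v0) ?(ltW A0).
have mW : measurable_fun setT W.
  by apply: measurable_funD => //; exact: measurable_funM.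
have W0 x : 0 <= W x by rewrite addr_ge0// mulr_ge0// mulr_ge0// ltW.
have Wx x : `|x.1| `^ p <= W x.
  have -> : `|x.1| `^ p = (x.1 ^+ 2) `^ (p / 2).
    rewrite -(real_normK (num_real x.1)) -powR_mulrn// -powRrM.
    by congr (_ `^ _); field.
  apply: (@le_trans _ _ ((2 * sqn (x.1 - a, x.2 - a) + 2 * (rho * v)) `^ (p / 2))).
    apply: (ge0_ler_powR k0'); rewrite ?nnegrE ?sqr_ge0 ?addr_ge0 ?mulr_ge0 ?sqn_ge0 ?(ltW rho0) ?(ltW v0)//.
    rewrite -a2 /sqn /=; have := sqr_ge0 (x.1 - 2 * a); have := sqr_ge0 (x.2 - a).
    by rewrite !sqrrB; move: (x.1) (x.2) => u w; nra.
  apply: (le_trans (powR_subadd k01' _ _)); rewrite ?mulr_ge0 ?sqn_ge0 ?(ltW rho0) ?(ltW v0)//.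
  rewrite lerD2r powRM ?sqn_ge0//.
  have h2 : 2 `^ (p / 2) <= 2 :> R by apply: ler1_powR; lra.
  apply: (@le_trans _ _ (2 * sqn (x.1 - a, x.2 - a) `^ (p / 2))).
    by rewrite ler_wpM2r ?powR_ge0.
  rewrite -mulrA ler_wpM2l// ler_pdivlMl//; exact: (barrier_ge pqP).
have WD x : W x <= D * Dl 0%N x.
  have Av0 : 0 <= A * v by rewrite mulr_ge0// ltW.
  have z0 : 0 <= sqn x + A * v by rewrite addr_ge0// sqn_ge0.
  have z20 : 0 <= 2 * (sqn x + A * v) by rewrite mulr_ge0.
  have rv20 : 0 <= 2 * (rho * v) by rewrite mulr_ge0.
  rewrite /Dl mul0r mulr0 add0r /D -mulrA -powRM//.
  rewrite mulrDl mul1r; apply: lerD.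
    apply: ler_wpM2l; first by rewrite mulr_ge0// ltW.
    apply: (le_trans (barrier_le _ _ _)); apply: (ge0_ler_powR k0');
      rewrite ?nnegrE ?sqn_ge0//.
    have -> : A * v = 4 * a ^+ 2 + v by rewrite a2 /A; ring.
    rewrite /sqn /=; have := sqr_ge0 (x.1 + a); have := sqr_ge0 (x.2 + a).
    rewrite !sqrrB !sqrrD; move: v0 (sqr_ge0 a); move: (x.1) (x.2) => u w; clear; nra.
  apply: (ge0_ler_powR k0'); rewrite ?nnegrE//.
  rewrite ler_wpM2l// ler_wpDl ?sqn_ge0// ler_wpM2r ?(ltW v0)// /A.
  by move: rho0; clear; lra.
have step l x : (\int[g]_x1 \int[g]_x2 (D * Dl l (x.1 + x1, x.2 + x2) + 0)%:E
     <= (D * Dl l.+1 x)%:E)%E.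
  rewrite (@planar_integral_affine g (fun z => Dl l (x.1 + z.1, x.2 + z.2)))//.
  - rewrite adde0 [leRHS]EFinM; apply: lee_wpmul2l; first by rewrite lee_fin ltW.
    apply: le_trans (sqn_powR_concave x gm v0 k01 (cl0 l)) _.
    rewrite lee_fin /Dl le_eqVlt; apply/orP; left; apply/eqP; congr (_ `^ _).
    by rewrite -[l.+1%:R]natr1; ring.
  - apply: (measurableT_comp (mDl l)); apply/measurable_fun_pairP; split => /=.
      by apply: measurable_funD => //; exact: measurable_fst.
    by apply: measurable_funD => //; exact: measurable_snd.
  - by move=> z; exact: powR_ge0.
  - exact: ltW.
have shift (h : bR * bR -> bR) (x : bR * bR) : measurable_fun setT h ->
    measurable_fun setT (fun z : bR * bR => h (x.1 + z.1, x.2 + z.2)).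
  move=> mh; apply: (measurableT_comp mh); apply/measurable_fun_pairP; split => /=.
    by apply: measurable_funD => //; exact: measurable_fst.
  by apply: measurable_funD => //; exact: measurable_snd.
pose G (l : nat) : bR * bR -> bR := if l is l'.+1 then fun x => D * Dl l'.+1 x else W.
have mG l : measurable_fun setT (G l).
  case: l => [|l]; first exact: mW.
  by apply: measurable_funM => //; exact: mDl.
exists G; split => //.
- case=> [|l] x; first exact: Wx.
  apply: (@le_trans _ _ (Dl l.+1 x)); last by rewrite /G ler_peMl// powR_ge0.
  have -> : `|x.1| `^ p = (x.1 ^+ 2) `^ (p / 2).
    rewrite -(real_normK (num_real x.1)) -powR_mulrn// -powRrM.
    by congr (_ `^ _); field.
  have dl0 : 0 <= sqn x + (2 * (l.+1%:R * v) + A * v).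
    by apply: addr_ge0; [exact: sqn_ge0|exact: cl0].
  apply: (ge0_ler_powR k0'); rewrite ?nnegrE ?sqr_ge0//.
  have := cl0 l.+1; rewrite /sqn; have := sqr_ge0 x.2.
  by move: (2 * _ + _) => c *; lra.
- move=> l x; apply: le_trans (step l x).
  apply: (@planar_integral_le g (fun z => G l (x.1 + z.1, x.2 + z.2))
     (fun z => D * Dl l (x.1 + z.1, x.2 + z.2) + 0)).
  + exact: shift.
  + apply: measurable_funD => //; apply: measurable_funM => //; exact: shift.
  + by move=> z; case: (l) => [//|l']; rewrite /G mulr_ge0 ?powR_ge0// ltW.
  + by move=> z; rewrite addr0; case: (l) => [|//]; exact: WD.
- move=> x xQ; have [ang rad] := acos_outside_quadrant a0 xQ.
  rewrite a2 in rad; have H := Hrho g v gm v0 _ rad ang.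
  rewrite /G /W (@planar_integral_affine g (fun z => b (x.1 + z.1, x.2 + z.2)))//.
  + rewrite [leRHS]EFinD [X in (_ <= X + _)%E]EFinM leeD2r//; apply: lee_wpmul2l.
      by rewrite lee_fin mulr_ge0// ltW.
    apply: le_trans H; rewrite le_eqVlt; apply/orP; left; apply/eqP.
    apply: eq_integral => x1 _; apply: eq_integral => x2 _; rewrite /b /=.
    by congr (barrier _ _ (_, _))%:E; ring.
  + exact: shift.
  + by rewrite mulr_ge0// ltW.
- case=> [//|m] _; rewrite /G /Dl.
  have mv0 : 0 <= m.+1%:R * v by rewrite mulr_ge0// ltW.
  have A20 : 0 <= 2 + A by rewrite addr_ge0// ltW.
  rewrite -[leRHS]mulrA ler_wpM2l ?(ltW D0)// -powRM//.
  have m1 : v <= m.+1%:R * v by rewrite ler_peMl ?(ltW v0)// ler1n.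
  have dl0 : 0 <= sqn (0, 0) + (2 * (m.+1%:R * v) + A * v).
    by apply: addr_ge0; [exact: sqn_ge0|exact: cl0].
  have r0 := mulr_ge0 A20 mv0.
  apply: (ge0_ler_powR k0'); rewrite ?nnegrE//.
  have -> : sqn (0, 0) = 0 :> R by rewrite /sqn /= expr0n/= addr0.
  by rewrite add0r [leRHS]mulrDl lerD2l ler_wpM2l// ltW.
Qed.
End waiting.

(** * Laws of independent pairs *)

Section rectangles.
Context {R : realType} {d1 d2 : measure_display}.
Context {S1 : measurableType d1} {S2 : measurableType d2}.

Lemma measure_eq_rectangles (m1 m2 : {measure set (S1 * S2) -> \bar R}) :
  (m1 setT < +oo)%E ->
  (forall A B, measurable A -> measurable B -> m1 (A `*` B) = m2 (A `*` B)) ->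
  forall V, measurable V -> m1 V = m2 V.
Proof.
move=> m1T m12 V mV.
pose C : set (set (S1 * S2)) :=
  [set C | exists A, measurable A /\ exists B, measurable B /\ C = A `*` B].
apply: (measure_unique C (fun=> setT)) => //.
- rewrite measurable_prod_measurableType //; congr (<<s _ >>).
  rewrite predeqE; split => [[A mA [B mB <-]]|[A [mA [B [mB ->]]]]].
    by exists A; split => //; exists B.
  by exists A => //; exists B.
- move=> _ _ [X1 [mX1 [X2 [mX2 ->]]]] [Y1 [mY1 [Y2 [mY2 ->]]]].
  rewrite -setXI; exists (X1 `&` Y1); split; first exact: measurableI.
  by exists (X2 `&` Y2); split => //; exact: measurableI.
- by move=> _; exists setT; split => //; exists setT; rewrite setXTT.
- by rewrite bigcup_const//; exists 0%N.
- by move=> _ [A [mA [B [mB ->]]]]; exact: m12.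
Qed.
End rectangles.

Section independence.
Context {R : realType} {d : measure_display} {T : measurableType d}.
Local Notation bR := (measurableTypeR R).
Variable P : probability T R.

(** A pushforward that also accepts measures of mass below 1, such as the
    restriction of a probability to an event. *)
Definition law {d' : measure_display} {S : measurableType d'}
    (mu : {measure set T -> \bar R}) (f : T -> S) (mf : measurable_fun setT f) :
    {measure set S -> \bar R} :=
  measure_function_pushforward__canonical__measure_function_Measure mu mf.

Variable g : probability bR R.

(** Both sides are finite measures of [V] that agree on rectangles. *)
Lemma indep_extend {dS : measure_display} {S : measurableType dS}
    (X : T -> S) (Y : T -> bR) (F : set T) :
  measurable_fun setT X -> measurable_fun setT Y -> measurable F ->
  (forall U A, measurable U -> measurable A ->
    P (X @^-1` U `&` Y @^-1` A `&` F) = (P (X @^-1` U `&` Y @^-1` A) * P F)%E) ->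
  forall V : set (S * bR), measurable V ->
    P ((fun w => (X w, Y w)) @^-1` V `&` F) =
    (P ((fun w => (X w, Y w)) @^-1` V) * P F)%E.
Proof.
move=> mX mY mF h V mV.
have mXY : measurable_fun setT (fun w => (X w, Y w)) by exact: measurable_fun_pair.
have PF : P F \is a fin_num by exact: fin_num_measure.
have r0 : 0 <= fine (P F) by exact: fine_ge0.
pose m1 := law (mrestr P mF) mXY.
pose m2 : {measure set (S * bR) -> \bar R} := mscale (NngNum r0) (law P mXY).
have m2E W : m2 W = (P ((fun w => (X w, Y w)) @^-1` W) * P F)%E.
  by rewrite /m2 /= /mscale /= fineK// muleC.
rewrite -m2E; apply: (measure_eq_rectangles (m1 := m1)) => //.
- rewrite /m1 /= /pushforward /mrestr preimage_setT setTI.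
  by rewrite ltey_eq PF.
- move=> A B mA mB; rewrite m2E -h//.
Qed.

Lemma law_pair {dS : measure_display} {S : measurableType dS} (X : T -> S) (Y : T -> bR)
    (mX : measurable_fun setT X) (mY : measurable_fun setT Y)
    (f : S * bR -> \bar R) :
  (forall U A, measurable U -> measurable A ->
    P (X @^-1` U `&` Y @^-1` A) = (P (X @^-1` U) * g A)%E) ->
  measurable_fun setT f -> (forall z, 0 <= f z)%E ->
  (\int[P]_w f (X w, Y w) = \int[P]_w \int[g]_y f (X w, y))%E.
Proof.
move=> h mf f0.
have mXY : measurable_fun setT (fun w => (X w, Y w)) by exact: measurable_fun_pair.
pose X' : {mfun T >-> S} := HB.pack X (isMeasurableFun.Build _ _ _ _ _ mX).
have e1 : (\int[P]_w f (X w, Y w) = \int[law P mXY]_z f z)%E.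
  by rewrite ge0_integral_pushforward//.
rewrite e1; transitivity (\int[distribution P X' \x g]_z f z)%E.
  apply: eq_measure_integral => V mV _.
  apply: (measure_eq_rectangles (m1 := law P mXY)) => //.
    by rewrite /= /pushforward preimage_setT probability_setT ltry.
  move=> A B mA mB; rewrite [RHS](product_measure1E (distribution P X') g)//.
  exact: h.
rewrite fubini_tonelli1//.
rewrite ge0_integral_distribution//.
- exact: measurable_fun_fubini_tonelli_F.
- by move=> y; exact: integral_ge0.
Qed.
End independence.

(** * Chains driven by independent increments *)

Section driven_chain.
Context {R : realType} {d : measure_display} {T : measurableType d}.
Local Notation bR := (measurableTypeR R).
Variable P : probability T R.
Variable g : probability bR R.
Variables (N : nat) (a b : nat -> T -> bR).
Hypothesis ma : forall k, (k < N)%N -> measurable_fun setT (a k).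
Hypothesis mb : forall k, (k < N)%N -> measurable_fun setT (b k).

Definition future n (A B : nat -> set bR) : set T :=
  [set w | forall k, (n <= k < N)%N -> A k (a k w) /\ B k (b k w)].

(* the increments are peeled off one at a time, first [a n], then [b n] *)
Hypothesis indep : forall n A B, (n < N)%N ->
  (forall k, measurable (A k)) -> (forall k, measurable (B k)) ->
  P (future n A B) = (g (A n) * g (B n) * P (future n.+1 A B))%E.

Context {dS : measure_display} {S : measurableType dS}.
Variables (step : S -> bR * bR -> S) (s0 : S).
Hypothesis mstep : measurable_fun setT
  (fun z : (S * bR) * bR => step z.1.1 (z.1.2, z.2)).

Fixpoint chain n w : S :=
  if n is n'.+1 then step (chain n' w) (a n' w, b n' w) else s0.

Lemma measurable_chain n : (n <= N)%N -> measurable_fun setT (chain n).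
Proof.
elim: n => [|n IH] nN; first exact: measurable_cst.
have -> : chain n.+1 = (fun z : (S * bR) * bR => step z.1.1 (z.1.2, z.2)) \o
    (fun w => ((chain n w, a n w), b n w)) by [].
apply: (measurableT_comp mstep).
apply: measurable_fun_pair; last exact: mb.
by apply: measurable_fun_pair; [exact: IH (ltnW nN)|exact: ma].
Qed.

Lemma measurable_future n A B :
  (forall k, measurable (A k)) -> (forall k, measurable (B k)) ->
  measurable (future n A B).
Proof.
move=> mA mB.
have -> : future n A B = \bigcap_(k in [set k | (n <= k < N)%N])
    (a k @^-1` A k `&` b k @^-1` B k).
  by apply/seteqP; split => w /= h k /h.
apply: bigcap_measurableType => k /= /andP[_ kN].
apply: measurableI; rewrite -[X in measurable X]setTI.
  exact: ma.
exact: mb.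
Qed.

Lemma futureT n : future n (fun=> setT) (fun=> setT) = setT.
Proof. by apply/seteqP; split. Qed.

Let upd (A : nat -> set bR) n A' k := if k == n then A' else A k.

Let future_upd n A B A' B' : (n < N)%N ->
  future n (upd A n A') (upd B n B') =
  a n @^-1` A' `&` (b n @^-1` B' `&` future n.+1 A B).
Proof.
move=> nN; apply/seteqP; split => w /=.
  move=> h; have := h n; rewrite leqnn nN /upd eqxx => /(_ isT) [hA hB].
  split=> //; split => // k /andP[nk kN]; have := h k.
  by rewrite (ltnW nk) kN /upd gtn_eqF//; apply.
move=> [hA [hB h]] k; rewrite leq_eqVlt => /andP[/orP[/eqP <- _|nk kN]].
  by rewrite /upd eqxx.
by rewrite /upd gtn_eqF//; apply: h; rewrite nk.
Qed.

Let future_updS n A B A' B' :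
  future n.+1 (upd A n A') (upd B n B') = future n.+1 A B.
Proof.
by apply/seteqP; split => w /= h k /[dup] /andP[nk _] /h;
  rewrite /upd gtn_eqF.
Qed.

Definition decoupled n := forall U A B, measurable U ->
  (forall k, measurable (A k)) -> (forall k, measurable (B k)) ->
  P (chain n @^-1` U `&` future n A B) = (P (chain n @^-1` U) * P (future n A B))%E.

Section one_step.
Variable n : nat.
Hypothesis nN : (n < N)%N.
Hypothesis dn : decoupled n.

Let mX := measurable_chain (ltnW nN).

Let E1 U A' B' A B : measurable U -> measurable A' -> measurable B' ->
  (forall k, measurable (A k)) -> (forall k, measurable (B k)) ->
  P (chain n @^-1` U `&` a n @^-1` A' `&` (b n @^-1` B' `&` future n.+1 A B)) =
  (P (chain n @^-1` U) * (g A' * g B' * P (future n.+1 A B)))%E.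
Proof.
move=> mU mA' mB' mA mB.
have mu1 k : measurable (upd A n A' k) by rewrite /upd; case: ifP.
have mu2 k : measurable (upd B n B' k) by rewrite /upd; case: ifP.
rewrite -setIA -future_upd// dn//; congr (_ * _)%E.
by rewrite indep// future_updS /upd !eqxx.
Qed.

Let gT : g setT = 1%E. Proof. exact: probability_setT. Qed.

Let PT : P setT = 1%E. Proof. exact: probability_setT. Qed.

Let E2 U A' : measurable U -> measurable A' ->
  P (chain n @^-1` U `&` a n @^-1` A') = (P (chain n @^-1` U) * g A')%E.
Proof.
move=> mU mA'.
have := @E1 U A' setT (fun=> setT) (fun=> setT) mU mA' measurableT
  (fun=> measurableT) (fun=> measurableT).
by rewrite futureT preimage_setT !setIT gT PT !mule1.
Qed.

Let E3 B' A B : measurable B' ->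
  (forall k, measurable (A k)) -> (forall k, measurable (B k)) ->
  P (b n @^-1` B' `&` future n.+1 A B) = (g B' * P (future n.+1 A B))%E.
Proof.
move=> mB' mA mB.
have := @E1 setT setT B' A B measurableT measurableT mB' mA mB.
by rewrite !preimage_setT !setTI gT PT !mul1e.
Qed.

Let mpre (f : T -> bR) A' : measurable_fun setT f -> measurable A' ->
  measurable (f @^-1` A').
Proof. by move=> mf mA; rewrite -[X in measurable X]setTI; exact: mf. Qed.

Let E4 V B' A B : measurable V -> measurable B' ->
  (forall k, measurable (A k)) -> (forall k, measurable (B k)) ->
  P ((fun w => (chain n w, a n w)) @^-1` V `&` (b n @^-1` B' `&` future n.+1 A B)) =
  (P ((fun w => (chain n w, a n w)) @^-1` V) * (g B' * P (future n.+1 A B)))%E.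
Proof.
move=> mV mB' mA mB; rewrite -E3//; apply: indep_extend => //.
- exact: ma.
- by apply: measurableI; [exact: mpre (mb nN) _|exact: measurable_future].
- by move=> U A' mU mA'; rewrite E1// E2// E3// !muleA.
Qed.

Let E5 V B' : measurable V -> measurable B' ->
  P ((fun w => (chain n w, a n w)) @^-1` V `&` b n @^-1` B') =
  (P ((fun w => (chain n w, a n w)) @^-1` V) * g B')%E.
Proof.
move=> mV mB'.
have := @E4 V B' (fun=> setT) (fun=> setT) mV mB' (fun=> measurableT) (fun=> measurableT).
by rewrite futureT !setIT PT !mule1.
Qed.

(** The next state is a function of the present one and of two increments, which
    [indep_extend] adds one after the other. *)
Lemma decoupledS : decoupled n.+1.
Proof.
move=> U A B mU mA mB.
have e : chain n.+1 @^-1` U = (fun w => ((chain n w, a n w), b n w)) @^-1`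
    ((fun z : (S * bR) * bR => step z.1.1 (z.1.2, z.2)) @^-1` U) by [].
rewrite e; apply: indep_extend.
- by apply: measurable_fun_pair => //; exact: ma.
- exact: mb.
- exact: measurable_future.
- by move=> V B' mV mB'; rewrite -setIA E4// E5// !muleA.
- by rewrite -[X in measurable X]setTI; exact: mstep.
Qed.

Lemma expectation_step (f : S -> \bar R) :
  measurable_fun setT f -> (forall s, 0 <= f s)%E ->
  (\int[P]_w f (chain n.+1 w) =
   \int[P]_w \int[g]_x \int[g]_y f (step (chain n w) (x, y)))%E.
Proof.
move=> mf f0.
pose h (z : (S * bR) * bR) := f (step z.1.1 (z.1.2, z.2)).
have mh : measurable_fun setT h by exact: measurableT_comp.
have h0 z : (0 <= h z)%E by exact: f0.
have mXa : measurable_fun setT (fun w => (chain n w, a n w)).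
  by apply: measurable_fun_pair => //; exact: ma.
have -> : (\int[P]_w f (chain n.+1 w) = \int[P]_w h ((chain n w, a n w), b n w))%E by [].
rewrite (law_pair (g := g) mXa (mb nN) E5 mh h0).
rewrite (law_pair (g := g) mX (ma nN)
  (f := fun z : S * bR => (\int[g]_y h (z, y))%E) E2)//.
- exact: (measurable_fun_fubini_tonelli_F (m2 := g) h).
- by move=> z; exact: integral_ge0.
Qed.
End one_step.

Lemma decoupledP n : (n <= N)%N -> decoupled n.
Proof.
elim: n => [_|n IH nN]; last exact: decoupledS (IH (ltnW nN)).
move=> U A B mU mA mB.
have [s0U|s0U] := pselect (U s0).
  have -> : chain 0 @^-1` U = setT by apply/seteqP; split.
  by rewrite setTI probability_setT mul1e.
have -> : chain 0 @^-1` U = set0 by apply/seteqP; split.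
by rewrite set0I measure0 mul0e.
Qed.

(** As the stopping rules are part of [step], this takes the place of optional
    stopping. *)
Lemma supermartingale_expectation (f : S -> \bar R) :
  measurable_fun setT f -> (forall s, 0 <= f s)%E ->
  (forall s, \int[g]_x \int[g]_y f (step s (x, y)) <= f s)%E ->
  (\int[P]_w f (chain N w) <= f s0)%E.
Proof.
move=> mf f0 fle; suff h n : (n <= N)%N -> (\int[P]_w f (chain n w) <= f s0)%E.
  exact: h.
elim: n => [_|n IH nN].
  rewrite /= integral_cst//=.
  by rewrite [X in (_ * X)%E](_ : _ = 1%E) ?mule1//; exact: probability_setT.
rewrite (expectation_step nN (decoupledP (ltnW nN)) mf f0).
apply: le_trans (IH (ltnW nN)); apply: ge0_le_integral => //.
- by move=> w _; apply: integral_ge0 => x _; exact: integral_ge0.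
- pose h (z : (S * bR) * bR) := f (step z.1.1 (z.1.2, z.2)).
  have mh : measurable_fun setT h by exact: measurableT_comp.
  have h0 z : (0 <= h z)%E by exact: f0.
  pose h1 (z : S * bR) := (\int[g]_y h (z, y))%E.
  have mh1 : measurable_fun setT h1.
    exact: (measurable_fun_fubini_tonelli_F (m2 := g) h).
  have mh2 : measurable_fun setT (fun s => \int[g]_x h1 (s, x))%E.
    apply: (measurable_fun_fubini_tonelli_F (m2 := g) h1) => //.
    by move=> z; exact: integral_ge0.
  exact: (measurableT_comp mh2 (measurable_chain (ltnW nN))).
- exact: (measurableT_comp mf (measurable_chain (ltnW nN))).
Qed.
End driven_chain.

(** * The machine that runs the stages *)

Section stage_machine.
Context {R : realType}.
Local Notation bR := (measurableTypeR R).

(** Number of completed stages, remaining delay, displacement since the last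
    chain point, and total cost of the completed stages. *)
Definition state : Type := ((nat * nat) * ((bR * bR) * bR))%type.

Variables (K : nat) (m : nat -> nat) (p : nat -> R).

Definition complete_stage (s : state) : state :=
  if [&& (s.1.1 < K)%N, s.1.2 == 0%N & in_quadrant s.2.1]
  then ((s.1.1.+1, m s.1.1.+1), ((0, 0), s.2.2 + `|s.2.1.1| `^ p s.1.1)) else s.

Definition move (s : state) (z : bR * bR) : state :=
  ((s.1.1, s.1.2.-1), ((s.2.1.1 + z.1, s.2.1.2 + z.2), s.2.2)).

Definition stage_step s z := move (complete_stage s) z.

(** The first component takes countably many values. *)
Lemma measurable_sections {dE dF : measure_display} {E : measurableType dE}
    {F : measurableType dF} (f : (nat * nat) * E -> F) :
  (forall i, measurable_fun setT (fun e => f (i, e))) -> measurable_fun setT f.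
Proof.
move=> mf _ A mA; rewrite setTI.
have -> : f @^-1` A = \bigcup_k \bigcup_l
    (([set k] `*` [set l]) `*` ((fun e => f ((k, l), e)) @^-1` A)).
  apply/seteqP; split => [[[k l] e] /= fA|[[k l] e] [k' _ [l' _ /= [[-> ->]]]]//].
  by exists k => //; exists l.
apply: bigcup_measurable => k _; apply: bigcup_measurable => l _.
apply: measurableX; first exact: measurableX.
by rewrite -[X in measurable X]setTI; exact: mf.
Qed.

Lemma measurable_in_quadrant : measurable_fun setT (in_quadrant : bR * bR -> bool).
Proof.
by apply: measurable_and; apply: measurable_fun_ler.
Qed.

Lemma measurable_complete_stage : measurable_fun setT complete_stage.
Proof.
apply: measurable_sections => -[k l] /=; rewrite /complete_stage /=.
have mid : measurable_fun setT (fun e : (bR * bR) * bR => ((k, l), e) : state).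
  rewrite (_ : (fun e => _) = fun e => ((k, l), (e.1, e.2))); last first.
    by apply/funext => -[].
  by apply: measurable_fun_pair => //; exact: measurable_fun_pair.
case: (k < K)%N => //=; case: (l == 0%N) => //=.
apply: measurable_fun_ifT.
- apply: (measurableT_comp measurable_in_quadrant); exact: measurable_fst.
- apply: measurable_fun_pair => //; apply: measurable_fun_pair => //=.
  apply: measurable_funD; first exact: measurable_snd.
  apply: (measurableT_comp (@measurable_powR R _)).
  apply: measurableT_comp => //; apply: measurableT_comp; exact: measurable_fst.
- exact: mid.
Qed.

Lemma measurable_stage_step : measurable_fun setT
  (fun z : (state * bR) * bR => stage_step z.1.1 (z.1.2, z.2)).
Proof.
pose mv (z : (state * bR) * bR) : state := move z.1.1 (z.1.2, z.2).
have mmv : measurable_fun setT mv.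
  have f1 : measurable_fun setT (fun z : (state * bR) * bR => z.1.1).
    by apply: measurableT_comp; exact: measurable_fst.
  have f2 : measurable_fun setT (fun z : (state * bR) * bR => z.1.2).
    by apply: measurableT_comp; [exact: measurable_snd|exact: measurable_fst].
  apply: measurable_fun_pair.
    apply: measurable_fun_pair.
      by apply: measurableT_comp; [exact: measurable_fst|];
         apply: measurableT_comp; [exact: measurable_fst|].
    apply: (measurableT_comp (f := predn)) => //.
    by apply: measurableT_comp; [exact: measurable_snd|];
       apply: measurableT_comp; [exact: measurable_fst|].
  have f3 : measurable_fun setT (fun z : (state * bR) * bR => z.1.1.2).
    by apply: measurableT_comp; [exact: measurable_snd|].
  have f4 : measurable_fun setT (fun z : (state * bR) * bR => z.1.1.2.1).
    by apply: measurableT_comp; [exact: measurable_fst|].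
  apply: measurable_fun_pair.
    apply: measurable_fun_pair; apply: measurable_funD => //.
    - by apply: measurableT_comp; [exact: measurable_fst|].
    - by apply: measurableT_comp; [exact: measurable_snd|].
    - exact: measurable_snd.
  by apply: measurableT_comp; [exact: measurable_snd|].
have -> : (fun z : (state * bR) * bR => stage_step z.1.1 (z.1.2, z.2)) =
    mv \o (fun z => ((complete_stage z.1.1, z.1.2), z.2)) by [].
apply: (measurableT_comp mmv).
apply: measurable_fun_pair; last exact: measurable_snd.
apply: measurable_fun_pair.
  apply: (measurableT_comp measurable_complete_stage).
  by apply: measurableT_comp; exact: measurable_fst.
by apply: measurableT_comp; [exact: measurable_snd|exact: measurable_fst].
Qed.

Variable G : nat -> nat -> bR * bR -> bR.
Hypothesis mG : forall k l, (k < K)%N -> measurable_fun setT (G k l).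
Hypothesis G_ge : forall k l x, (k < K)%N -> `|x.1| `^ p k <= G k l x.

Let G_ge0 k l x : (k < K)%N -> 0 <= G k l x.
Proof. by move=> kK; apply: le_trans (G_ge l x kK); exact: powR_ge0. Qed.

Let rest k := \sum_(k <= i < K) G i (m i) (0, 0).

Let rest_ge0 k : 0 <= rest k.
Proof. by rewrite /rest big_nat; apply: sumr_ge0 => i /andP[_ iK]; exact: G_ge0. Qed.

(** Cost paid so far plus a bound on the expected cost to come. It is a
    supermartingale: completing a stage trades [G] for the actual cost. *)
Definition potential (s : state) : R := `|s.2.2| +
  (if (s.1.1 < K)%N then G s.1.1 s.1.2 s.2.1 + rest s.1.1.+1 else 0).

Lemma potential_ge0 s : 0 <= potential s.
Proof.
rewrite /potential addr_ge0//; case: ifP => // sK.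
by rewrite addr_ge0 ?G_ge0.
Qed.

Lemma measurable_potential : measurable_fun setT potential.
Proof.
apply: measurable_sections => -[k l]; rewrite /potential /=.
apply: measurable_funD; first by apply: measurableT_comp => //; exact: measurable_snd.
have [kK|Kk] := ltnP k K; last exact: measurable_cst.
apply: measurable_funD => //.
by apply: (measurableT_comp (mG l kK)); exact: measurable_fst.
Qed.

Lemma potential_complete_stage s : potential (complete_stage s) <= potential s.
Proof.
rewrite /complete_stage; case: ifPn => [/and3P[sK _ _]|_]; last exact: lexx.
case: s sK => -[k l] [x acc] /= sK; rewrite /potential /= sK.
apply: (@le_trans _ _ (`|acc| + G k l x + rest k.+1)); last by rewrite addrA.
apply: lerD.
  apply: (le_trans (ler_normD _ _)); rewrite lerD2l ger0_norm ?powR_ge0//.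
  exact: G_ge.
case: ifP => k1K; last exact: rest_ge0.
by rewrite [leRHS]/rest big_ltn.
Qed.

Variable g : probability bR R.
Hypothesis G_delay : forall k l x, (k < K)%N ->
  (\int[g]_x1 \int[g]_x2 (G k l (x.1 + x1, x.2 + x2))%:E <= (G k l.+1 x)%:E)%E.
Hypothesis G_wait : forall k x, (k < K)%N -> ~~ in_quadrant x ->
  (\int[g]_x1 \int[g]_x2 (G k 0%N (x.1 + x1, x.2 + x2))%:E <= (G k 0%N x)%:E)%E.
Hypothesis m_gt0 : forall k, (0 < m k)%N.

Lemma potential_move s : (s.1.1 < K)%N ==> (s.1.2 != 0%N) || ~~ in_quadrant s.2.1 ->
  (\int[g]_x1 \int[g]_x2 (potential (move s (x1, x2)))%:E <= (potential s)%:E)%E.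
Proof.
case: s => -[k l] [x acc] /=; rewrite /move /potential /=.
have [kK|Kk] /= := ltnP k K; last first.
  have cstE c : (\int[g]_(x in setT) c%:E = c%:E :> \bar R)%E.
    rewrite integral_cst//= [X in (_ * X)%E](_ : _ = 1%E) ?mule1//.
    exact: probability_setT.
  by move=> _; under eq_integral do rewrite cstE; rewrite cstE.
move=> lx.
have msh l' : measurable_fun setT (fun z : bR * bR => G k l' (x.1 + z.1, x.2 + z.2)).
  apply: (measurableT_comp (mG l' kK)); apply/measurable_fun_pairP; split => /=.
    by apply: measurable_funD => //; exact: measurable_fst.
  by apply: measurable_funD => //; exact: measurable_snd.
have -> : (\int[g]_x1 \int[g]_x2
    (`|acc| + (G k l.-1 (x.1 + x1, x.2 + x2) + rest k.+1))%:E =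
  \int[g]_x1 \int[g]_x2
    (1 * G k l.-1 (x.1 + x1, x.2 + x2) + (`|acc| + rest k.+1))%:E)%E.
  apply: eq_integral => x1 _; apply: eq_integral => x2 _.
  by rewrite mul1r addrCA.
rewrite (@planar_integral_affine _ g (fun z => G k l.-1 (x.1 + z.1, x.2 + z.2)))//.
- rewrite mul1e addrCA [leRHS]EFinD leeD2r//.
  move: lx; case: l => [/= xQ|l _ /=]; [exact: G_wait|exact: G_delay].
- by move=> z; exact: G_ge0.
- by rewrite addr_ge0.
Qed.

Lemma potential_step s :
  (\int[g]_x1 \int[g]_x2 (potential (stage_step s (x1, x2)))%:E <= (potential s)%:E)%E.
Proof.
apply: (@le_trans _ _ (potential (complete_stage s))%:E); last first.
  by rewrite lee_fin potential_complete_stage.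
apply: potential_move; rewrite /complete_stage.
case: ifPn => [/and3P[_ _ _]|] /=; first by rewrite -lt0n m_gt0 implybT.
by case: (s.1.1 < K)%N => //=; rewrite negb_and.
Qed.
End stage_machine.

(** * From the machine to chain points *)

Section paths.
Context {R : realType}.
Local Notation bR := (measurableTypeR R).
Variables (K : nat) (m : nat -> nat) (p : nat -> R).
Hypothesis p01 : forall k, 0 < p k <= 1.

Definition stage_times (A1 A2 : nat -> R) (k : nat) (t : nat -> nat) :=
  t 0%N = 0%N /\ forall j, (j < k)%N ->
    [/\ (t j + m j <= t j.+1)%N, A1 (t j) <= A1 (t j.+1) & A2 (t j) <= A2 (t j.+1)].

(** The state [s] is what the machine has recorded along the first [n] steps of
    the walk with coordinates [A1] and [A2], when its stages ended at times [t]. *)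
Definition tracks (A1 A2 : nat -> R) n (s : @state R) := exists t,
  [/\ stage_times A1 A2 s.1.1 t, (t s.1.1 <= n)%N,
      s.1.2 = (m s.1.1 - (n - t s.1.1))%N /\
      s.2.1 = (A1 n - A1 (t s.1.1), A2 n - A2 (t s.1.1)),
      s.2.2 = \sum_(0 <= j < s.1.1) `|A1 (t j.+1) - A1 (t j)| `^ p j &
      (s.1.1 <= K)%N].

Lemma tracks_complete A1 A2 n s : tracks A1 A2 n s ->
  tracks A1 A2 n (complete_stage K m p s).
Proof.
rewrite /complete_stage; case: ifPn => // /and3P[].
case: s => -[k l] [x acc] /= kK /eqP -> xQ [t /= [[t0 tP] tn [l0 xE] accE _]].
pose t' j := if (j <= k)%N then t j else n.
have t'k j : (j <= k)%N -> t' j = t j by rewrite /t' => ->.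
have t'k1 : t' k.+1 = n by rewrite /t' ltnn.
exists t'; split => /=.
- split; first by rewrite t'k.
  move=> j; rewrite ltnS leq_eqVlt => /orP[/eqP ->|jk]; last first.
    by rewrite !t'k ?(ltnW jk)//; exact: tP.
  rewrite t'k1 t'k//; move: xQ; rewrite xE /in_quadrant /= !subr_ge0 => /andP[? ?].
  split => //; have /eqP := esym l0; rewrite subn_eq0 => h.
  by rewrite -(subnKC tn) leq_add2l.
- by rewrite t'k1.
- by rewrite t'k1 subnn subn0 !subrr.
- rewrite big_nat_recr//= accE; congr (_ + _).
    by apply: eq_big_nat => j /andP[_ jk]; rewrite !t'k// ltnW.
  by rewrite t'k1 t'k// xE.
- exact: kK.
Qed.

Lemma tracks_move A1 A2 n s z : tracks A1 A2 n s ->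
  A1 n.+1 = A1 n + z.1 -> A2 n.+1 = A2 n + z.2 -> tracks A1 A2 n.+1 (move s z).
Proof.
case: s => -[k l] [x acc] [t /= [tP tn [lE xE] accE kK]] e1 e2.
exists t; split => //=; first exact: leqW.
split; first by rewrite lE subSn// subnS.
by rewrite xE /= e1 e2; congr (_, _); rewrite addrAC.
Qed.

Lemma tracks_chain (A1 A2 : nat -> R) (d : measure_display)
  (T : measurableType d) (a b : nat -> T -> bR) (w : T) n :
  A1 0%N = 0 -> A2 0%N = 0 ->
  (forall n, A1 n.+1 = A1 n + a n w) -> (forall n, A2 n.+1 = A2 n + b n w) ->
  tracks A1 A2 n (chain a b (stage_step K m p) ((0%N, m 0%N), ((0, 0), 0)) n w).
Proof.
move=> A10 A20 A1S A2S; elim: n => [|n IH] /=.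
  exists (fun=> 0%N); split => //=; first by rewrite !subn0 A10 A20 !subrr.
  by rewrite big_geq.
by apply: tracks_move => //; exact: tracks_complete.
Qed.

(** As long as the total cost is below 1 and the exponents are at most 1, each
    displacement is below its own cost, hence their sum is below the total. *)
Lemma stage_cost_small (A1 A2 : nat -> R) n s (rho c : R) : tracks A1 A2 n s ->
  A1 0%N = 0 -> rho <= 1 -> `|s.2.1.1| `^ p s.1.1 <= c -> `|s.2.2| + c <= rho ->
  `|A1 n| <= rho.
Proof.
case: s => -[k l] [x acc] [t /= [[t0 _] tn [_ xE] accE _]] A10 r1 xc Hc.
have c0 : 0 <= c by apply: le_trans xc; exact: powR_ge0.
have acc0 : 0 <= acc by rewrite accE sumr_ge0// => j _; exact: powR_ge0.
rewrite (ger0_norm acc0) in Hc.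
have accr : acc <= rho by apply: le_trans Hc; rewrite lerDl.
have c1 : c <= 1 by apply: le_trans r1; apply: le_trans Hc; rewrite lerDr.
have small (y : R) j : `|y| `^ p j <= 1 -> `|y| <= `|y| `^ p j.
  have /andP[pj0 pj1] := p01 j => y1.
  have [->|y0] := eqVneq y 0; first by rewrite normr0 powR_ge0.
  have yp : 0 < `|y| by rewrite normr_gt0.
  have y1' : `|y| <= 1.
    rewrite leNgt; apply/negP => lt; move: y1; rewrite leNgt => /negP; apply.
    have -> : 1 = 1 `^ p j :> R by rewrite powR1.
    by apply: gt0_ltr_powR; rewrite ?nnegrE.
  by apply: ger1_powR => //; rewrite yp y1'.
have A1E : A1 n = \sum_(0 <= j < k) (A1 (t j.+1) - A1 (t j)) + x.1.
  have := telescope_sumr (fun j => A1 (t j)) (leq0n k) => /= ->.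
  rewrite t0 A10 subr0 xE /=.
  by rewrite addrC subrK.
rewrite A1E; apply: (le_trans (ler_normD _ _)); apply: le_trans Hc; apply: lerD.
  rewrite accE; apply: (le_trans (ler_norm_sum _ _ _)).
  rewrite !big_nat; apply: ler_sum => j /andP[_ jk]; apply: small.
  apply: le_trans r1; apply: le_trans accr.
  rewrite accE (big_cat_nat (leq0n j) (ltnW jk))/= (big_ltn jk).
  rewrite addrCA lerDl addr_ge0// sumr_ge0// => *; exact: powR_ge0.
by apply: le_trans (xc); apply: small; exact: le_trans xc c1.
Qed.
End paths.

Section chain_exists.
Context {R : realType} {d : measure_display} {T : measurableType d}.
Local Notation bR := (measurableTypeR R).
Variable P : probability T R.
Variable g : probability bR R.
Variables (N : nat) (a b : nat -> T -> bR).
Hypothesis ma : forall k, (k < N)%N -> measurable_fun setT (a k).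
Hypothesis mb : forall k, (k < N)%N -> measurable_fun setT (b k).
Hypothesis indep : forall n A B, (n < N)%N ->
  (forall k, measurable (A k)) -> (forall k, measurable (B k)) ->
  P (future N a b n A B) = (g (A n) * g (B n) * P (future N a b n.+1 A B))%E.
Variables (K : nat) (m : nat -> nat) (p : nat -> R) (G : nat -> nat -> bR * bR -> bR).
Hypothesis p01 : forall k, 0 < p k <= 1.
Hypothesis m_gt0 : forall k, (0 < m k)%N.
Hypothesis mG : forall k l, (k < K)%N -> measurable_fun setT (G k l).
Hypothesis G_ge : forall k l x, (k < K)%N -> `|x.1| `^ p k <= G k l x.
Hypothesis G_delay : forall k l x, (k < K)%N ->
  (\int[g]_x1 \int[g]_x2 (G k l (x.1 + x1, x.2 + x2))%:E <= (G k l.+1 x)%:E)%E.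
Hypothesis G_wait : forall k x, (k < K)%N -> ~~ in_quadrant x ->
  (\int[g]_x1 \int[g]_x2 (G k 0%N (x.1 + x1, x.2 + x2))%:E <= (G k 0%N x)%:E)%E.

(** Markov's inequality for the potential bounds the probability that the cost
    exceeds [rho]. Otherwise either all stages are complete after [N] steps, or
    the walk ends within [rho] of its start in the first coordinate. *)
Lemma stage_times_exist (rho : R) : 0 < rho <= 1 -> exists E : set T,
  [/\ measurable E,
      (P E <= (rho^-1 * \sum_(0 <= k < K) G k (m k) (0, 0))%:E +
         P [set w | `|\sum_(0 <= k < N) a k w|%R <= rho]%R)%E &
      forall w, ~ E w -> exists t,
        stage_times m (fun n => \sum_(0 <= k < n) a k w)
          (fun n => \sum_(0 <= k < n) b k w) K t /\ (t K <= N)%N].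
Proof.
move=> /andP[r0 r1].
pose s0 : @state R := ((0%N, m 0%N), ((0, 0), 0)).
pose X n w : @state R := chain a b (stage_step K m p) s0 n w.
pose f (s : @state R) := (potential K m G s)%:E.
have mpot := measurable_potential m mG.
have mf : measurable_fun setT f by exact/measurable_EFinP.
have f0 s : (0 <= f s)%E by rewrite lee_fin; exact: potential_ge0 G_ge _.
have mstep := measurable_stage_step K m p.
have mX : measurable_fun setT (X N).
  exact: (measurable_chain ma mb s0 mstep (leqnn N)).
have Ef : (\int[P]_w f (X N w) <= f s0)%E.
  apply: (supermartingale_expectation (g := g) ma mb indep s0 mstep mf f0) => s.
  exact: (potential_step mG G_ge G_delay G_wait m_gt0).
have fs0 : (f s0 <= (\sum_(0 <= k < K) G k (m k) (0, 0))%:E)%E.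
  rewrite lee_fin /potential /= normr0 add0r; case: ifP => K0.
    by rewrite [leRHS]big_ltn.
  by rewrite big_nat sumr_ge0// => i /andP[_ iK]; apply: le_trans (G_ge _ _ iK); exact: powR_ge0.
pose E1 := [set w | (rho%:E <= f (X N w))%E].
pose E2 := [set w | `|\sum_(0 <= k < N) a k w| <= rho].
have mE1 : measurable E1.
  have -> : E1 = setT `&` [set w | (rho%:E <= (f \o X N) w)%E] by rewrite setTI.
  by apply: emeasurable_fun_c_infty => //; exact: measurableT_comp.
have mE2 : measurable E2.
  have -> : E2 = setT `&` (fun w => `|\sum_(0 <= k < N) a k w|) @^-1` `]-oo, rho]%classic.
    by rewrite setTI; apply/seteqP; split => w /=; rewrite in_itv.
  have msum n : (n <= N)%N -> measurable_fun setT (fun w => \sum_(0 <= k < n) a k w : bR).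
    elim: n => [|n IH] nN.
      rewrite (_ : (fun w => _) = cst 0)//.
      by apply/funext => w; rewrite big_geq.
    rewrite (_ : (fun w => _) = (fun w => \sum_(0 <= k < n) a k w + a n w : bR)); last first.
      by apply/funext => w; rewrite big_nat_recr.
    by apply: measurable_funD; [exact: IH (ltnW nN)|exact: ma].
  have mn : measurable_fun setT (fun w => `|\sum_(0 <= k < N) a k w| : bR).
    by apply: measurableT_comp => //; exact: msum.
  by apply: mn => //; exact: measurable_itv.
exists (E1 `|` E2); split; first exact: measurableU.
- apply: (le_trans (measureU2 _ mE1 mE2)); apply: leeD => //.
  have h : (rho%:E * P E1 <= (\sum_(0 <= k < K) G k (m k) (0, 0))%:E)%E.
    apply: le_trans (le_trans Ef fs0).
    rewrite -integral_cst//; apply: (@le_trans _ _ (\int[P]_(w in E1) f (X N w))%E).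
      apply: ge0_le_integral => //; first by move=> w _; rewrite lee_fin ltW.
      apply: measurable_funTS; exact: measurableT_comp.
    apply: ge0_subset_integral => //; exact: measurableT_comp.
  by rewrite EFinM lee_pdivlMl.
- move=> w nE.
  pose A1 n := \sum_(0 <= k < n) a k w; pose A2 n := \sum_(0 <= k < n) b k w.
  have A10 : A1 0%N = 0 by rewrite /A1 big_geq.
  have A20 : A2 0%N = 0 by rewrite /A2 big_geq.
  have A1S n : A1 n.+1 = A1 n + a n w by rewrite /A1 big_nat_recr.
  have A2S n : A2 n.+1 = A2 n + b n w by rewrite /A2 big_nat_recr.
  have tr := tracks_chain K m p N A10 A20 A1S A2S.
  rewrite -/(X N w) in tr.
  have [kK|Kk] := ltnP (X N w).1.1 K; last first.
    case: tr => t [tP tn _ _ kK]; have e : (X N w).1.1 = K by apply/eqP; rewrite eqn_leq kK.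
    by rewrite e in tP tn; exists t.
  exfalso; apply: nE; have [h|h] := leP rho (potential K m G (X N w)).
    by left; rewrite /E1 /= /f lee_fin.
  right; apply: (stage_cost_small p01 tr A10 r1 (c := G (X N w).1.1 (X N w).1.2 (X N w).2.1)).
    exact: G_ge.
  apply/ltW/(le_lt_trans _ h); rewrite /potential kK addrA lerDl.
  rewrite big_nat sumr_ge0// => i /andP[_ iK].
  by apply: le_trans (G_ge _ _ iK); exact: powR_ge0.
Qed.
End chain_exists.

(** * Delays that the cost can afford *)

Section delay_scales.
Context {R : realType}.

Lemma sum_odd_even (f : nat -> R) n : (0 < n)%N ->
  \sum_(1 <= k < n.*2) f k =
  \sum_(0 <= k < n) f k.*2.+1 + \sum_(1 <= k < n) f k.*2.
Proof.
case: n => // n _; elim: n => [|n IH].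
  by rewrite big_nat1 (big_geq (leqnn 1)) addr0 big_nat1.
rewrite doubleS big_nat_recr//= big_nat_recr//= IH.
rewrite [in RHS](big_nat_recr n.+1)//= [in RHS](big_nat_recr n.+1 1)//=.
by rewrite addrACA -!addrA; congr (_ + (_ + _)); exact: addrC.
Qed.

(** Among the [2 ^ J - 1] interior dyadic points of order [J], exactly
    [2 ^ (i - 1)] appear first at level [i]. *)
Lemma dyadic_level_sum (F : nat -> R) J :
  \sum_(1 <= k < 2 ^ J) F (J - logn 2 k)%N =
  \sum_(0 <= i < J) 2 ^+ i * F i.+1.
Proof.
elim: J => [|J IH]; first by rewrite expn0 !big_geq.
rewrite expnS mul2n sum_odd_even ?expn_gt0//.
rewrite [RHS]big_nat_recr//= -IH [RHS]addrC; congr (_ + _); last first.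
  apply: eq_big_nat => k /andP[k0 _].
  by rewrite -mul2n lognM// lognE/= subSS.
rewrite (eq_big_nat _ _ (F2 := fun=> F J.+1)) => [|k _].
  by rewrite big_const_nat iter_addr addr0 subn0 -[LHS]mulr_natl natrX.
by rewrite lognE/= dvdn2 /= odd_double/= subn0.
Qed.

Lemma quadratic_le_exp (C delta : R) : 0 < C -> 0 < delta ->
  exists i0, forall i, (i0 <= i)%N ->
    i.+1%:R * i.+2%:R <= C * 2 `^ (delta * i%:R).
Proof.
move=> C0 d0; pose c := delta * ln 2 / 3.
have ln20 : 0 < ln 2 :> R by rewrite ln_gt0// ltr1n.
have c0 : 0 < c by rewrite /c divr_gt0// mulr_gt0.
have Cc : 0 < C * c ^+ 3 by rewrite mulr_gt0// exprn_gt0.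
have [n Hn] : exists n : nat, 6 / (C * c ^+ 3) <= n%:R.
  have h0 : 0 <= 6 / (C * c ^+ 3) by rewrite divr_ge0// ltW.
  have /andP[_ h1] := Num.Theory.truncn_itv h0.
  by exists (Num.truncn (6 / (C * c ^+ 3))).+1; exact: ltW.
exists n.+1 => -[//|i]; rewrite ltnS => ni; set x : R := i.+1%:R.
have x1 : 1 <= x by rewrite ler1n.
have nx : n%:R <= x by rewrite ler_nat ltnW.
have e : 2 `^ (delta * x) = expR (c * x) ^+ 3.
  rewrite /powR pnatr_eq0/= -expRM_natl; congr expR; rewrite /c.
  by field.
have h : (c * x) ^+ 3 <= expR (c * x) ^+ 3.
  have cx : 0 <= c * x by rewrite mulr_ge0 ?(ltW c0)// (le_trans ler01).
  rewrite lerXn2r ?nnegrE ?expR_ge0//.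
  by apply: le_trans (expR_ge1Dx _); rewrite lerDr.
rewrite e; apply: (@le_trans _ _ (C * (c * x) ^+ 3)); last by rewrite ler_wpM2l// ltW.
have -> : i.+2%:R = x + 1 :> R by rewrite /x natr1.
have -> : i.+3%:R = x + 2 :> R by rewrite /x -natrD addn2.
have -> : C * (c * x) ^+ 3 = (C * c ^+ 3) * x * x ^+ 2 by ring.
apply: (@le_trans _ _ (6 * x ^+ 2)).
  by rewrite expr2; move: x1; clear; nra.
rewrite ler_wpM2r ?sqr_ge0//; move: (le_trans Hn nx).
by rewrite ler_pdivrMr// mulrC.
Qed.

Variables (kappa M : nat -> R) (eta : R).
Hypothesis kappa_gt0 : forall m, 0 < kappa m.
Hypothesis M_gt0 : forall m, 0 < M m.
Hypothesis eta_gt0 : 0 < eta.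

Let budget i : R := eta / (2 ^+ i * (i.+1%:R * i.+2%:R)).

Let budget_gt0 i : 0 < budget i.
Proof. by rewrite divr_gt0// mulr_gt0 ?exprn_gt0// mulr_gt0. Qed.

(* the largest delay that the cost exponent of index [m] can afford *)
Let affordable i m : R := Num.min (2 ^- i) ((budget i / M m) `^ (kappa m)^-1).

Let affordable_gt0 i m : 0 < affordable i m.
Proof.
by rewrite lt_min invr_gt0 exprn_gt0//= powR_gt0// divr_gt0.
Qed.

Let affordable_cost i m x : 0 <= x <= affordable i m ->
  M m * x `^ kappa m <= budget i.
Proof.
move=> /andP[x0]; rewrite le_min => /andP[_ xle].
rewrite mulrC -ler_pdivlMr//; apply: (@le_trans _ _ (((budget i / M m) `^ (kappa m)^-1) `^ kappa m)).
  by apply: ge0_ler_powR; rewrite ?nnegrE ?powR_ge0// ltW.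
by rewrite -powRrM mulVf ?gt_eqF// powRr1// ltW// divr_gt0.
Qed.

Let affordable_dec i m : affordable i.+1 m <= affordable i m.
Proof.
rewrite /affordable; apply: le_min2.
  rewrite lef_pV2 ?posrE ?exprn_gt0// exprS ler_peMl ?exprn_ge0// ler1n//.
apply: ge0_ler_powR; rewrite ?nnegrE ?invr_ge0 ?(ltW (kappa_gt0 _))//.
- by rewrite ltW// divr_gt0.
- by rewrite ltW// divr_gt0.
rewrite ler_pM2r ?invr_gt0// /budget ler_pM2l// lef_pV2 ?posrE.
- apply: ler_pM => //; rewrite ?mulr_ge0 ?exprn_ge0//.
    by rewrite exprS ler_peMl ?exprn_ge0// ler1n.
  by apply: ler_pM; rewrite ?ler_nat.
- by rewrite mulr_gt0 ?exprn_gt0// mulr_gt0.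
- by rewrite mulr_gt0 ?exprn_gt0// mulr_gt0.
Qed.

Let best i : 'I_i.+1 := [arg max_(j > ord0) affordable i (val j)]%O.

Let best_ge i m : (m <= i)%N -> affordable i m <= affordable i (best i).
Proof.
move=> mi; rewrite /best; case: arg_maxP => // j _ jmax.
by have := jmax (Ordinal (mi : (m < i.+1)%N)) isT.
Qed.

Let Fixpoint delay i : R :=
  if i is i'.+1 then Num.min (delay i') (affordable i (best i)) else
  affordable 0 (best 0).

(** The exponents [kappa m] may tend to a critical one while the constants [M m]
    grow without control. So level [i] uses the exponent among the first
    [i + 1] that affords the longest delay. For each [m] the delay is then
    eventually at least the one that the exponent [m] affords, which up to a
    polynomial factor is the smaller of [2 ^- i] and [2 `^ (- i / kappa m)]. *)
Lemma exists_delay_scales : exists (r : nat -> R) (mu : nat -> nat),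
  [/\ forall i, 0 < r i, forall i, r i.+1 <= r i, forall i, r i <= 2 ^- i,
      forall i, M (mu i) * r i `^ kappa (mu i) <= budget i &
      forall m s, 0 <= s < kappa m -> s <= 1 ->
        exists i0, forall i, (i0 <= i)%N -> 2 ^- i <= r i `^ s].
Proof.
have dbest i : delay i <= affordable i (best i).
  by case: i => [|i]; [exact: lexx|rewrite /= ge_min lexx orbT].
have d0 i : 0 < delay i.
  by elim: i => [|i IH]; [exact: affordable_gt0|rewrite /= lt_min IH affordable_gt0].
exists delay, best; split => //.
- by move=> i; rewrite /= ge_min lexx.
- by move=> i; apply: (le_trans (dbest i)); rewrite ge_min lexx.
- by move=> i; apply: affordable_cost; rewrite ltW//=.
move=> m s /andP[s0 sm] s1.
have dge i : (m <= i)%N -> Num.min (delay m) (affordable i m) <= delay i.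
  move=> /subnK <-; elim: (i - m)%N => [|k IH]; first by rewrite add0n ge_min lexx.
  rewrite addSn /= le_min; apply/andP; split.
    by apply: le_trans IH; rewrite le_min2 ?affordable_dec.
  by rewrite ge_min best_ge ?orbT// -addSn leq_addl.
have [i1 Hi1] : exists i : nat, 2 ^- i <= delay m.
  exists (Num.truncn (delay m)^-1).
  rewrite -[leRHS]invrK lef_pV2 ?posrE ?exprn_gt0 ?invr_gt0//.
  have h0 : 0 <= (delay m)^-1 by rewrite invr_ge0 ltW.
  have /andP[_ h1] := Num.Theory.truncn_itv h0.
  by apply: le_trans (ltW h1) _; rewrite -natrX ler_nat ltn_expl.
have {dge}dge i : (maxn m i1 <= i)%N -> affordable i m <= delay i.
  rewrite geq_max => /andP[mi ii]; apply: le_trans (dge i mi).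
  rewrite le_min lexx andbT; apply: (le_trans _ Hi1).
  rewrite /affordable ge_min lef_pV2 ?posrE ?exprn_gt0//.
  by rewrite ler_weXn2l// ler1n.
pose q := s / kappa m.
have q0 : 0 <= q by rewrite divr_ge0// ltW.
have q1 : q < 1 by rewrite ltr_pdivrMr// mul1r.
have dq : 0 < 1 - q by rewrite subr_gt0.
have [i2 Hi2] := quadratic_le_exp (divr_gt0 eta_gt0 (M_gt0 m)) dq.
exists (maxn (maxn m i1) i2) => i; rewrite geq_max => /andP[ii i2i].
apply: (@le_trans _ _ (affordable i m `^ s)); last first.
  by apply: ge0_ler_powR; rewrite ?nnegrE ?dge// ltW.
have two i' : 2 ^- i' = 2 `^ (- i'%:R) :> R by rewrite powRN powR_mulrn.
have pos : 0 < 2 ^- i :> R by rewrite invr_gt0 exprn_gt0.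
have le1 : 2 ^- i <= 1 :> R by rewrite invf_le1 ?exprn_gt0// exprn_ege1// ler1n.
rewrite /affordable; case: (leP (2 ^- i) ((budget i / M m) `^ _)) => _.
  by apply: ger1_powR; rewrite ?pos.
rewrite -powRrM [_^-1 * s]mulrC -/q.
pose y := eta / M m / (i.+1%:R * i.+2%:R).
have y0 : 0 < y by rewrite !divr_gt0// mulr_gt0.
have -> : budget i / M m = 2 ^- i * y.
  rewrite /budget /y; set c := _ * i.+2%:R; field.
  by rewrite !gt_eqF//= ?exprn_gt0// /c mulr_gt0.
rewrite powRM ?(ltW pos) ?(ltW y0)//.
rewrite [leLHS](_ : _ = (2 ^- i) `^ q * (2 ^- i) `^ (1 - q)); last first.
  rewrite -powRD; last by rewrite (gt_eqF pos) implybT.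
  by rewrite subrKC powRr1 ?(ltW pos).
rewrite ler_wpM2l ?powR_ge0//.
have pw1 (z : R) : 1 `^ z = 1 :> R by rewrite powR1.
have [y1|y1] := leP 1 y.
  apply: (@le_trans _ _ 1).
    by rewrite -[leRHS](pw1 (1 - q)); apply: ge0_ler_powR; rewrite ?nnegrE// ltW.
  by rewrite -[leLHS](pw1 q); apply: ge0_ler_powR; rewrite ?nnegrE// ltW.
apply: (@le_trans _ _ y); last by apply: ger1_powR; rewrite ?y0 ?ltW.
rewrite two -powRrM mulNr powRN mulrC -div1r ler_pdivrMr ?powR_gt0// mulrAC.
rewrite ler_pdivlMr; last by rewrite mulr_gt0.
by rewrite mul1r; exact: Hi2.
Qed.

Lemma budget_sum J : \sum_(0 <= i < J) 2 ^+ i * budget i.+1 <= eta.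
Proof.
apply: (@le_trans _ _ (eta - eta / J.+1%:R)); last by rewrite gerBl divr_ge0// ltW.
elim: J => [|J IH]; first by rewrite big_geq// divr1 subrr.
rewrite big_nat_recr//=; apply: (le_trans (lerD IH (lexx _))).
rewrite /budget exprS.
have x0 : 0 < J.+1%:R :> R by [].
have e2 : J.+2%:R = J.+1%:R + 1 :> R by rewrite natr1.
have e3 : J.+3%:R = J.+1%:R + 2 :> R by rewrite -natrD addn2.
rewrite e2 e3; move: x0; set x : R := J.+1%:R => x0.
have p0 : 0 < 2 ^+ J :> R by rewrite exprn_gt0.
set p : R := 2 ^+ J in p0 *.
have -> : p * (eta / (2 * p * ((x + 1) * (x + 2)))) = eta * (2 * ((x + 1) * (x + 2)))^-1.
  by field; rewrite !gt_eqF// addr_gt0.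
have -> : eta - eta / x = eta * (1 - x^-1) by rewrite mulrBr mulr1.
have -> : eta - eta / (x + 1) = eta * (1 - (x + 1)^-1) by rewrite mulrBr mulr1.
rewrite -mulrDr ler_pM2l//.
rewrite -subr_ge0.
have -> : 1 - (x + 1)^-1 - (1 - x^-1 + (2 * ((x + 1) * (x + 2)))^-1) =
   (x + 4) / (2 * x * (x + 1) * (x + 2)).
  by field; rewrite !gt_eqF// addr_gt0.
by rewrite divr_ge0 ?addr_ge0 ?mulr_ge0 ?addr_ge0// ltW.
Qed.
End delay_scales.

(** * Brownian motion on a grid *)

Section brownian_grid.
Context {R : realType} {d : measure_display} {T : measurableType d}.
Local Notation bR := (measurableTypeR R).
Variable P : probability T R.

Definition grid_increment (X : R -> T -> R) (N k : nat) : T -> bR :=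
  fun w => X (k.+1%:R / N%:R) w - X (k%:R / N%:R) w.

Lemma grid_in_unit (N k : nat) : (0 < N)%N -> (k <= N)%N ->
  `[0, 1]%classic (k%:R / N%:R : R).
Proof.
move=> N0 kN /=; have N0' : 0 < N%:R :> R by rewrite ltr0n.
by rewrite in_itv/= divr_ge0//= ler_pdivrMr// mul1r ler_nat.
Qed.

Lemma sum_grid_increment X N n w :
  \sum_(0 <= k < n) grid_increment X N k w = X (n%:R / N%:R) w - X 0 w.
Proof.
by rewrite (telescope_sumr (fun k => X (k%:R / N%:R) w))// mul0r.
Qed.

Section one_coordinate.
Variable X : R -> T -> R.
Hypothesis HX : standard_linear_BM P X.
Variable N : nat.
Hypothesis N0 : (0 < N)%N.

Lemma measurable_grid_increment k : (k < N)%N ->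
  measurable_fun setT (grid_increment X N k).
Proof.
move=> kN; apply: measurable_funB; apply: (BM_measurable HX); apply: grid_in_unit => //.
exact: ltnW.
Qed.

Let g := normal_prob (0 : R) (Num.sqrt N%:R^-1).

Lemma grid_increment_law k A : (k < N)%N -> measurable A ->
  P (grid_increment X N k @^-1` A) = g A.
Proof.
move=> kN mA; have N0' : 0 < N%:R :> R by rewrite ltr0n.
have s0 : 0 <= k%:R / N%:R :> R by rewrite divr_ge0.
have st : k%:R / N%:R < k.+1%:R / N%:R :> R by rewrite ltr_pM2r ?invr_gt0// ltr_nat.
have t1 : k.+1%:R / N%:R <= 1 :> R by rewrite ler_pdivrMr// mul1r ler_nat.
have := BM_gaussian_increments HX s0 st t1 mA.
rewrite /grid_increment => ->; rewrite /g.
by have -> : k.+1%:R / N%:R - k%:R / N%:R = N%:R^-1 :> R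
  by rewrite -mulrBl -natrB// subSnn mul1r.
Qed.

Lemma grid_increments_prod (A : nat -> set bR) n : (forall k, measurable (A k)) ->
  P [set w | forall k, (n <= k < N)%N -> A k (grid_increment X N k w)] =
  (\prod_(i < N) (if (n <= i)%N then g (A i) else 1))%E.
Proof.
move=> mA; pose A' k := if (n <= k)%N then A k else setT.
have mA' k : measurable (A' k) by rewrite /A'; case: ifP.
pose E (i : 'I_N) := setT `&` grid_increment X N i @^-1` A' i.
have -> : [set w | forall k, (n <= k < N)%N -> A k (grid_increment X N k w)] =
    \bigcap_i E i.
  apply/seteqP; split => w /=.
    move=> h i _; split => //=; rewrite /A'; case: ifP => // ni.
    by apply: h; rewrite ni ltn_ord.
  move=> h k /andP[nk kN]; have [_] := h (Ordinal kN) I.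
  by rewrite /= /A' nk.
have := @BM_independent_increments _ _ _ _ _ HX N (fun k => k%:R / N%:R).
rewrite /independent_RVs /independent_sigma_algebras => ->.
- apply: eq_bigr => i _; rewrite /E setTI grid_increment_law// /A'.
  by case: ifP => // _; exact: probability_setT.
- by move=> k kN; exact: grid_in_unit.
- by move=> k kN; rewrite ler_pM2r ?invr_gt0 ?ltr0n// ler_nat.
- by move=> i; exists (A' i); first exact: mA'.
Qed.

(** With this, independence of the coordinate processes applies to events of the
    increments. *)
Lemma grid_event_process_sigma (A : nat -> set bR) n : (forall k, measurable (A k)) ->
  process_sigma_algebra `[0, 1] X
    [set w | forall k, (n <= k < N)%N -> A k (grid_increment X N k w)].
Proof.
move=> mA; pose C := \bigcup_(t in `[0%R, 1%R]%classic)
  preimage_set_system setT (X t) measurable.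
have mX t : `[0, 1]%classic t ->
    measurable_fun setT (X t : g_sigma_algebraType C -> bR).
  move=> t01 _ B mB; apply: sub_sigma_algebra; exists t => //.
  by exists B.
suff : measurable ([set w | forall k, (n <= k < N)%N -> A k (grid_increment X N k w)]
   : set (g_sigma_algebraType C)) by [].
have -> : [set w | forall k, (n <= k < N)%N -> A k (grid_increment X N k w)] =
    \bigcap_(k in [set k | (n <= k < N)%N]) (grid_increment X N k @^-1` A k).
  by apply/seteqP; split => w /= h k /h.
apply: bigcap_measurableType => k /= /andP[_ kN].
have mi : measurable_fun setT (grid_increment X N k : g_sigma_algebraType C -> bR).
  by apply: measurable_funB; apply: mX; apply: grid_in_unit => //; exact: ltnW.
by rewrite -[X in measurable X]setTI; exact: mi.
Qed.
End one_coordinate.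

Lemma grid_increments_independent (B : R -> T -> 'rV[R]_2) (N : nat) :
  standard_BM P B -> (0 < N)%N ->
  let g := normal_prob (0 : R) (Num.sqrt N%:R^-1) in
  let a := grid_increment (fun t w => B t w ord0 ord0) N in
  let b := grid_increment (fun t w => B t w ord0 ord_max) N in
  forall n A A', (n < N)%N ->
  (forall k, measurable (A k)) -> (forall k, measurable (A' k)) ->
  P (future N a b n A A') = (g (A n) * g (A' n) * P (future N a b n.+1 A A'))%E.
Proof.
move=> HB N0 g a b n A A' nN mA mA'.
have split k : P (future N a b k A A') =
    ((\prod_(i < N) (if (k <= i)%N then g (A i) else 1)) *
     (\prod_(i < N) (if (k <= i)%N then g (A' i) else 1)))%E.
  pose E (i : 'I_2) := [set w | forall l, (k <= l < N)%N ->
     (if i == ord0 then A else A') l (grid_increment (fun t w => B t w ord0 i) N l w)].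
  have -> : future N a b k A A' = \bigcap_i E i.
    apply/seteqP; split => w /=.
      move=> h i _ l /h [hA hA']; case: ifPn => [/eqP -> //|].
      by move=> i0; have -> : i = ord_max by apply/val_inj; move: i0; case: i => -[|[|]].
    move=> h l kl; split; first exact: (h ord0 I l kl).
    exact: (h ord_max I l kl).
  rewrite (BM_independent_coordinates HB); last first.
    move=> i; apply: grid_event_process_sigma => // l.
    by case: (i == ord0).
  rewrite 2!big_ord_recl big_ord0 mule1.
  have -> : lift ord0 ord0 = ord_max :> 'I_2 by exact/val_inj.
  by rewrite /E /= !(grid_increments_prod (BM_coordinates HB _) N0).
have one (C : nat -> set bR) : (\prod_(i < N) (if (n <= i)%N then g (C i) else 1) =
    g (C n) * \prod_(i < N) (if (n.+1 <= i)%N then g (C i) else 1))%E.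
  rewrite (bigD1 (Ordinal nN))//= leqnn; congr (_ * _)%E.
  rewrite [in RHS](bigD1 (Ordinal nN))//= ltnn mul1e.
  apply: eq_bigr => i /eqP ni; rewrite ltn_neqAle.
  suff -> : n != i by [].
  by apply/eqP => e; apply: ni; exact: val_inj.
rewrite !split !one muleACA//.
Qed.
End brownian_grid.

(** * Skeletons and their probability *)

(** A discrete version of the map [h] in [hausdorff_dim_ge]: [tau k] is the image of
    the dyadic point [k / 2 ^ J], whose exact level is [J - logn 2 k]. *)
Definition monotone_skeleton {R : realType} (f : R -> 'rV[R]_2) (r : nat -> R) (J : nat)
    (tau : nat -> R) :=
  [/\ 0 <= tau 0%N, tau (2 ^ J).-1 <= 1 &
    forall k, (k.+1 < 2 ^ J)%N ->
      [/\ tau k + r (J - logn 2 k.+1)%N <= tau k.+1 &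
        forall i, f (tau k) ord0 i <= f (tau k.+1) ord0 i]].

Local Notation bR R := (measurableTypeR R).

(** The delays [r] do not depend on the order [J]: the total expected cost of all stages
    is at most [rho ^ 2] for every [J], so that Markov's inequality loses [rho], and
    Brownian motion at time 1 is within [rho] of its start with probability at
    most [rho]. *)
Lemma skeleton_probability {R : realType} {d : measure_display}
    {T : measurableType d} (P : probability T R) (B : R -> T -> 'rV[R]_2) (rho : R) :
  standard_BM P B -> 0 < rho <= 1 -> exists r : nat -> R,
  [/\ forall i, 0 < r i, forall i, r i.+1 <= r i, forall i, r i <= 2 ^- i,
      forall s, 0 <= s < 1 / 3 ->
        exists i0, forall i, (i0 <= i)%N -> 2 ^- i <= r i `^ s &
      forall J, exists E : set T,
        [/\ measurable E, (P E <= (2 * rho)%:E)%E &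
          forall w, ~ E w -> exists tau, monotone_skeleton (B^~ w) r J tau]].
Proof.
move=> HB rho01; have /andP[rho0 rho1] := rho01.
pose kappa (m : nat) : R := 1 / 3 - (3 * m.+2%:R)^-1.
have kappa_itv m : 0 < kappa m < 1 / 3.
  have h : 0 < (3 * m.+2%:R)^-1 :> R by rewrite invr_gt0 mulr_gt0.
  have h2 : (3 * m.+2%:R)^-1 < 3^-1 :> R.
    by rewrite ltf_pV2 ?posrE ?mulr_gt0// ltr_pMr// ltr1n.
  by move: h h2; rewrite /kappa; set z := (3 * _)^-1 => h h2; lra.
have kappa0 m : 0 < kappa m by case/andP: (kappa_itv m).
pose K4 : R := 64 * 32 ^+ 2.
have K40 : 0 <= K4 by rewrite mulr_ge0// exprn_ge0.
have pm m : 0 < 2 * kappa m < 2 / 3 by have := kappa_itv m; lra.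
have /choice[M HM] : forall m, exists M, 0 < M /\
    forall (g : probability (bR R) R) v, quartic_moments g v K4 -> 0 < v ->
    exists G : nat -> (bR R) * (bR R) -> (bR R),
    [/\ forall l, measurable_fun setT (G l),
      forall l x, `|x.1| `^ (2 * kappa m) <= G l x,
      forall l x, (\int[g]_x1 \int[g]_x2 (G l (x.1 + x1, x.2 + x2))%:E
                     <= (G l.+1 x)%:E)%E,
      forall x, ~~ in_quadrant x ->
        (\int[g]_x1 \int[g]_x2 (G 0%N (x.1 + x1, x.2 + x2))%:E <= (G 0%N x)%:E)%E &
      forall n, (0 < n)%N -> G n (0, 0) <= M * (n%:R * v) `^ kappa m].
  move=> m; have [M M0 HM] := waiting_potential (pm m) K40.
  exists M; split => // g v qm v0; have [G [G1 G2 G3 G4 G5]] := HM g v qm v0.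
  exists G; split => // n n0; have := G5 n n0.
  by rewrite [2 * _]mulrC mulfK.
pose M' m := M m * 66 `^ kappa m.
have M'0 m : 0 < M' m by rewrite mulr_gt0 ?powR_gt0//; have [] := HM m.
have eta0 : 0 < rho ^+ 2 by rewrite exprn_gt0.
have [r [mu [r0 rdec rle rbudget rs]]] := exists_delay_scales kappa0 M'0 eta0.
exists r; split => //.
  move=> s /andP[s0 s3].
  have [m sm] : exists m, s < kappa m.
    have [e e0 eE] : exists2 e, 0 < e & e = 1 / 3 - s.
      by exists (1 / 3 - s); rewrite ?subr_gt0.
    have h0 : 0 <= e^-1 by rewrite invr_ge0 ltW.
    have /andP[_ h1] := Num.Theory.truncn_itv h0.
    exists (Num.truncn e^-1); rewrite /kappa.
    suff : (3 * (Num.truncn e^-1).+2%:R)^-1 < e.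
      by rewrite ltrBrDr -ltrBrDl -eE.
    rewrite invf_plt ?posrE// ?mulr_gt0//; apply: (lt_trans h1).
    rewrite -natr1; have : 0 < (Num.truncn e^-1).+1%:R :> R by [].
    lra.
  by apply: (rs m s); rewrite ?s0//; move: s3; clear; lra.
move=> J.
have rJ i : (i <= J)%N -> r J <= r i.
  move=> /subnK <-; elim: (J - i)%N => [//|k IH]; rewrite addSn.
  exact: le_trans (rdec _) IH.
(* the grid resolves the smallest delay, so rounding up at most doubles delays *)
pose N := (Num.truncn (r J)^-1).+1.
have N0 : (0 < N)%N by [].
have NR : 0 < N%:R :> R by rewrite ltr0n.
have rN : 1 <= r J * N%:R.
  have h0 : 0 <= (r J)^-1 by rewrite invr_ge0 ltW.
  have /andP[_ h1] := Num.Theory.truncn_itv h0.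
  by rewrite -ler_pdivrMl// mulr1 ltW.
pose lev k := (J - logn 2 k.+1)%N.
have rlev k : 1 <= r (lev k) * N%:R.
  by apply: (le_trans rN); rewrite ler_pM2r// rJ// leq_subr.
pose m k := (Num.truncn (r (lev k) * N%:R)).+1.
have mle k : r (lev k) * N%:R <= (m k)%:R.
  have h0 : 0 <= r (lev k) * N%:R by rewrite (le_trans ler01).
  by have /andP[_ h1] := Num.Theory.truncn_itv h0; exact: ltW.
have mge k : (m k)%:R <= 2 * r (lev k) * N%:R.
  have h0 : 0 <= r (lev k) * N%:R by rewrite (le_trans ler01).
  have /andP[h1 _] := Num.Theory.truncn_itv h0.
  by rewrite /m -natr1; move: h1 (rlev k); clear; lra.
pose sigma : R := Num.sqrt N%:R^-1.
have sigma0 : 0 < sigma by rewrite sqrtr_gt0 invr_gt0.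
have sigma2 : sigma ^+ 2 = N%:R^-1 by rewrite sqr_sqrtr// invr_ge0 ltW.
have [v [v1 v2 qm]] := normal_quartic_moments sigma0.
have v0 : 0 < v by apply: lt_le_trans v1; rewrite divr_gt0// exprn_gt0.
have /choice[G HG] := fun m => proj2 (HM m) _ v qm v0.
pose a := grid_increment (fun t w => B t w ord0 ord0) N.
pose b := grid_increment (fun t w => B t w ord0 ord_max) N.
have ma k : (k < N)%N -> measurable_fun setT (a k).
  by move=> kN; exact: (measurable_grid_increment (BM_coordinates HB ord0)).
have mb k : (k < N)%N -> measurable_fun setT (b k).
  by move=> kN; exact: (measurable_grid_increment (BM_coordinates HB ord_max)).
pose K := (2 ^ J).-1.
pose idx k := mu (lev k).
have p01 k : 0 < 2 * kappa (idx k) <= 1.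
  by have /andP[h1 h2] := kappa_itv (idx k); move: h1 h2; clear; lra.
have [E [mE PE HE]] := stage_times_exist ma mb
  (grid_increments_independent HB N0) (K := K) (m := m)
  (p := fun k => 2 * kappa (idx k)) (G := fun k => G (idx k)) p01
  (fun k => ltn0Sn _)
  (fun k l _ => let: And5 h _ _ _ _ := HG (idx k) in h l)
  (fun k l x _ => let: And5 _ h _ _ _ := HG (idx k) in h l x)
  (fun k l x _ => let: And5 _ _ h _ _ := HG (idx k) in h l x)
  (fun k x _ => let: And5 _ _ _ h _ := HG (idx k) in h x) rho01.
exists E; split => //.
- apply: (le_trans PE); rewrite mulr_natl mulr2n EFinD; apply: leeD.
    rewrite lee_fin ler_pdivrMl// -expr2.
    apply: le_trans (budget_sum eta0 J).
    rewrite -(dyadic_level_sum (fun i => rho ^+ 2 / (2 ^+ i * (i.+1%:R * i.+2%:R)))).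
    have -> : (2 ^ J = K.+1)%N by rewrite /K prednK// expn_gt0.
    rewrite big_add1/=; apply: ler_sum => k _.
    have [_ _ _ _ /(_ (m k) (ltn0Sn _)) hG] := HG (idx k).
    apply: (le_trans hG); apply: le_trans (rbudget (lev k)).
    have [M0 _] := HM (idx k).
    rewrite /M' -mulrA ler_pM2l// -powRM ?(ltW (r0 _))//.
    apply: ge0_ler_powR; rewrite ?nnegrE ?(ltW (kappa0 _))//.
    + by rewrite mulr_ge0// ltW.
    + by rewrite mulr_ge0// ltW.
    apply: (@le_trans _ _ ((2 * r (lev k) * N%:R) * (33 * sigma ^+ 2))).
      by apply: ler_pM => //; rewrite ltW.
    rewrite sigma2 mulrACA mulfV ?gt_eqF// mulr1.
    by rewrite mulrAC; move: (r0 (lev k)); clear; lra.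
  have lt01 : (0 : R) < 1 by exact: ltr01.
  pose A := [set x : (bR R) | `|x| <= rho].
  have mA : measurable A.
    have -> : A = `[- rho, rho]%classic.
      by apply/seteqP; split => x; rewrite /A /= in_itv/= ler_norml.
    exact: measurable_itv.
  have := BM_gaussian_increments (BM_coordinates HB ord0) (lexx 0) lt01 (lexx 1) mA.
  rewrite subr0 sqrtr1 => PA.
  have -> : [set w | `|\sum_(0 <= k < N) a k w| <= rho] =
      (fun w => B 1 w ord0 ord0 - B 0 w ord0 ord0) @^-1` A.
    apply/seteqP; split => w /=; rewrite sum_grid_increment divff ?gt_eqF//.
  rewrite PA; apply: le_trans (normal_prob_itv_le lt01 (ltW rho0)) _.
  by rewrite divr1.
- move=> w /HE[t [[t0 tP] tK]].
  exists (fun k => (t k)%:R / N%:R); split.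
  + by rewrite t0 mul0r.
  + by rewrite ler_pdivrMr// mul1r ler_nat.
  move=> k kJ; have kK : (k < K)%N by rewrite -ltnS prednK ?expn_gt0.
  have [h1 h2 h3] := tP k kK; rewrite !sum_grid_increment in h2 h3.
  rewrite -/(lev k); split.
    rewrite ler_pdivlMr// mulrDl; apply: (@le_trans _ _ ((t k)%:R + (m k)%:R)).
      by rewrite divfK ?gt_eqF// lerD2l.
    by rewrite -natrD ler_nat.
  move=> i; have [->|i0] := eqVneq i ord0; first by move: h2; rewrite lerD2r.
  have -> : i = ord_max by apply/val_inj; move: i0; case: i => -[|[|]].
  by move: h3; rewrite lerD2r.
Qed.

(** * Lower bound for the Hausdorff dimension *)

Section mass_distribution.
Context {R : realType}.

Lemma dyadic_floor (x : R) (i : nat) : 0 <= x -> exists j : nat,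
  j%:R / 2 ^+ i <= x /\ x < j.+1%:R / 2 ^+ i.
Proof.
move=> x0; have p2 : 0 < 2 ^+ i :> R by rewrite exprn_gt0.
have h0 : 0 <= x * 2 ^+ i by rewrite mulr_ge0// ltW.
have /andP[h1 h2] := Num.Theory.truncn_itv h0.
exists (Num.truncn (x * 2 ^+ i)).
by rewrite ler_pdivrMr// ltr_pdivlMr.
Qed.

(** Pulling a cover of [D] back along [h] turns a set of diameter below [r i] into
    a subset of a dyadic interval of length [2 ^- i]. As these subsets cover the
    unit interval, their lengths add up to at least 1. *)
Lemma hausdorff_dim_ge (h : R -> R) (D : set R) (r : nat -> R) (t : R) :
  (forall i, 0 < r i) -> (forall i, r i.+1 <= r i) ->
  (forall e, 0 < e -> exists i, r i <= e) ->
  (forall s, 0 <= s < t -> exists i0, forall i, (i0 <= i)%N -> 2 ^- i <= r i `^ s) ->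
  (forall x y i (a : nat), 0 <= x -> y < 1 -> x < a%:R / 2 ^+ i <= y ->
     r i <= h y - h x) ->
  (forall x, 0 <= x < 1 -> D (h x)) ->
  (t%:E <= hausdorff_dim D)%E.
Proof.
move=> r0 rdec rlim rs gap hD; rewrite /hausdorff_dim.
apply: le_ereal_inf_tmp => _ [s [s0 Hs] <-]; rewrite lee_fin leNgt; apply/negP => st.
have [i0 Hi0] := rs s (introT andP (conj s0 st)).
have rmono i j : (i <= j)%N -> r j <= r i.
  move=> /subnK <-; elim: (j - i)%N => [//|k IH]; rewrite addSn.
  exact: le_trans IH.
have hmono x y : 0 <= x -> y < 1 -> x < y -> h x < h y.
  move=> x0 y1 xy.
  have [i Hi] : exists i : nat, 2 ^- i < y - x.
    have xy0 : 0 < y - x by rewrite subr_gt0.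
    exists (Num.truncn (y - x)^-1).
    rewrite -invf_plt ?posrE ?exprn_gt0//.
    have i0' : 0 <= (y - x)^-1 by rewrite invr_ge0 ltW.
    have /andP[_ h1] := Num.Theory.truncn_itv i0'.
    apply: lt_le_trans h1 _.
    by rewrite -natrX ler_nat ltn_expl.
  have y0 : 0 <= y by apply: le_trans (ltW xy).
  have [j [j1 j2]] := dyadic_floor i y0.
  rewrite -subr_gt0; apply: lt_le_trans (r0 i) _; apply: (gap x y i j) => //.
  rewrite j1 andbT.
  by move: j2 Hi; rewrite -natr1 mulrDl div1r; lra.
(* points with images closer than r i share a closed dyadic interval of level i *)
have loc i d x y : d < r i -> 0 <= x < 1 -> 0 <= y < 1 -> `|h x - h y| <= d ->
    forall j : nat, j%:R / 2 ^+ i <= x -> x < j.+1%:R / 2 ^+ i ->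
    y \in `[j%:R / 2 ^+ i, j.+1%:R / 2 ^+ i].
  move=> di /andP[x0 x1] /andP[y0 y1] hxy j jx xj.
  rewrite in_itv/=; apply/andP; split; rewrite leNgt; apply/negP => lt.
    have := gap y x i j y0 x1; rewrite lt jx => /(_ isT).
    have := le_trans (ler_norm _) hxy; lra.
  have := gap x y i j.+1 x0 y1; rewrite xj (ltW lt) => /(_ isT).
  by move: hxy; rewrite distrC => /(le_trans (ler_norm _)); lra.
suff : ((1 / 2)%:E <= hausdorff_measure s D)%E by rewrite Hs lee_fin; lra.
rewrite /hausdorff_measure; apply: ereal_sup_ge.
exists (hausdorff_premeasure s (r i0 / 2) D).
  by exists (r i0 / 2) => //=; rewrite divr_gt0.
rewrite /hausdorff_premeasure; apply: le_ereal_inf_tmp => _ [U [DU dU] <-].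
have piece n : exists I : set (measurableTypeR R), [/\ measurable I,
    (forall x, 0 <= x < 1 -> U n (h x) -> I x) &
    (lebesgue_measure I <= 2%:E * diam_pow s (U n))%E].
  have dp0 : (0 <= diam_pow s (U n))%E.
    by rewrite /diam_pow; case: ifP => // _; exact: poweR_ge0.
  have [[x0 [x01 Ux0]]|none] := pselect (exists x, 0 <= x < 1 /\ U n (h x)); last first.
    exists set0; split => //; last by rewrite measure0 mule_ge0.
    by move=> x x01 Ux; exfalso; apply: none; exists x.
  have diam0 : (0 <= diam (U n))%E by apply: ereal_sup_ubound; left.
  have diamle : (diam (U n) <= (r i0 / 2)%:E)%E by exact: dU.
  have dfin : diam (U n) \is a fin_num.
    by rewrite ge0_fin_numE// (le_lt_trans diamle) ?ltry.
  pose dd := fine (diam (U n)).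
  have ddE : diam (U n) = dd%:E by rewrite /dd fineK.
  have dd0 : 0 <= dd by rewrite -lee_fin -ddE.
  have ddle : dd <= r i0 / 2 by rewrite -lee_fin -ddE.
  have dist y : U n (h y) -> `|h x0 - h y| <= dd.
    move=> Uy; rewrite -lee_fin -ddE; apply: ereal_sup_ubound; right.
    by exists (h x0) => //; exists (h y).
  have [dd00|ddN0] := eqVneq dd 0.
    exists [set x0]; split => //.
      move=> x x1 /dist; rewrite dd00 normr_le0 subr_eq0 => /eqP hx.
      have [/andP[x0a x0b] /andP[xa xb]] := (x01, x1).
      have [lt|lt|//] := ltgtP x x0.
        by have := hmono x x0 xa x0b lt; rewrite hx ltxx.
      by have := hmono x0 x x0a xb lt; rewrite hx ltxx.
    by rewrite lebesgue_measure_set1 mule_ge0.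
  have ddp : 0 < dd by rewrite lt0r ddN0.
  have ex : exists i, r i <= dd by exact: rlim.
  (* r i.+1 <= diam (U n) < r i *)
  case: (ex_minnP ex) => -[|i] ri imin.
    by have := rmono 0%N i0 (leq0n _); have := r0 i0; lra.
  have di : dd < r i.
    by rewrite ltNge; apply/negP => /imin; rewrite ltnn.
  have i0i : (i0 <= i)%N.
    rewrite leqNgt; apply/negP => lt; have := rmono _ _ lt.
    by have := r0 i0; lra.
  have [j [jx xj]] := dyadic_floor i (proj1 (andP x01)).
  exists `[j%:R / 2 ^+ i, j.+1%:R / 2 ^+ i]%classic; split => //.
    by move=> x x1 Ux; exact: (loc i dd x0 x di x01 x1 (dist _ Ux) j jx xj).
  rewrite lebesgue_measure_itv/= lte_fin (le_lt_trans jx xj) -EFinD.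
  have -> : diam_pow s (U n) = (dd `^ s)%:E.
    rewrite /diam_pow ifF; last by apply/negbTE/set0P; exists (h x0).
    by rewrite ddE poweR_EFin.
  rewrite -EFinM lee_fin -mulrBl -natrB// subSnn mul1r.
  have e2 : 2 ^- i.+1 <= r i.+1 `^ s by apply: Hi0; exact: leqW.
  have e3 : r i.+1 `^ s <= dd `^ s.
    by apply: ge0_ler_powR; rewrite ?nnegrE// ltW.
  have e4 : 2 ^- i = 2 * 2 ^- i.+1 :> R by rewrite exprS invfM mulrA mulfV ?mul1r.
  by rewrite e4; move: e2 e3; lra.
have /choice[I HI] := piece.
have mI n : measurable (I n) by have [] := HI n.
have cov : `[0%R, 1%R[%classic `<=` \bigcup_n I n.
  move=> x /=; rewrite in_itv/= => x01; have [n _ Un] := DU _ (hD x x01).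
  by exists n => //; have [_ + _] := HI n; apply.
have h1 : (1%:E <= \sum_(0 <= n <oo) lebesgue_measure (I n))%E.
  apply: (@le_trans _ _ (lebesgue_measure (\bigcup_n I n))).
    have <- : lebesgue_measure (`[0%R, 1%R[%classic : set (measurableTypeR R)) = 1%:E.
      by rewrite lebesgue_measure_itv/= lte_fin ltr01 oppr0 adde0.
    by apply: le_measure => //; rewrite inE//; exact: bigcup_measurable.
  apply: measure_sigma_subadditive => //; exact: bigcup_measurable.
have h2 : (\sum_(0 <= n <oo) lebesgue_measure (I n) <=
    \sum_(0 <= n <oo) 2%:E * diam_pow s (U n))%E.
  by apply: lee_nneseries => // n _; have [] := HI n.
have h3 := le_trans h1 h2.
have dp0 n : (0 <= diam_pow s (U n))%E.
  by rewrite /diam_pow; case: ifP => // _; exact: poweR_ge0.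
rewrite nneseriesZl// in h3.
have -> : (1 / 2)%:E = ((1 / 2)%:E * 1%:E)%E :> \bar R by rewrite mule1.
apply: (@le_trans _ _ ((1 / 2)%:E * (2%:E * \sum_(0 <= n <oo) diam_pow s (U n))))%E.
  exact: lee_wpmul2l.
by rewrite muleA -EFinM divfK// mul1e.
Qed.
End mass_distribution.

(** * Limits of skeletons *)

Section skeleton_limit.
Context {R : realType}.

Lemma ultra_cvg_segment (U : set_system nat) (u : nat -> R) (a b : R) :
  UltraFilter U -> (forall n, a <= u n <= b) ->
  exists2 p, a <= p <= b & u @ U --> p.
Proof.
move=> UU uab.
have Uab : U (u @^-1` `[a, b]%classic).
  by apply: filterE => n; rewrite /= in_itv/= uab.
have [p [pab clp]] := @segment_compact R a b (u @ U) _ Uab.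
exists p; first by move: pab; rewrite /= in_itv.
move=> V Vp; have [//|nV] := in_ultra_setVsetC (u @^-1` V) UU.
by have [x []] := clp (~` V) V nV Vp.
Qed.

Lemma le_truncn_dyadic (x y : R) J : x <= y ->
  (Num.truncn (x * 2 ^+ J) <= Num.truncn (y * 2 ^+ J))%N.
Proof. by move=> xy; apply: le_truncn; rewrite ler_pM2r ?exprn_gt0. Qed.

Lemma truncn_dyadic_le (x : R) J : x < 1 ->
  (Num.truncn (x * 2 ^+ J) <= (2 ^ J).-1)%N.
Proof.
move=> x1; rewrite truncn_le_nat prednK ?expn_gt0// natrX.
by rewrite gtr_pMl// exprn_gt0.
Qed.

Lemma skeleton_mono (f : R -> 'rV[R]_2) r J tau : (forall i, 0 < r i) ->
  monotone_skeleton f r J tau -> forall k l, (k <= l <= (2 ^ J).-1)%N ->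
  tau k <= tau l /\ forall i, f (tau k) ord0 i <= f (tau l) ord0 i.
Proof.
move=> r0 [_ _ tauP] k l /andP[kl].
rewrite -(subnKC kl); elim: (l - k)%N => [|n IH] h; first by rewrite addn0.
rewrite addnS in h *; have [h1 h2] := IH (ltnW h).
have [|h3 h4] := tauP (k + n)%N; first by rewrite -ltnS prednK ?expn_gt0// in h.
split; last by move=> i; exact: le_trans (h2 i) (h4 i).
by apply: (le_trans h1); apply: le_trans h3; rewrite lerDl ltW.
Qed.

(** Across a dyadic point of level [i] a skeleton of order [J >= i] steps onto
    that very point, which is of exact level at most [i]. *)
Lemma skeleton_gap (f : R -> 'rV[R]_2) r J tau : (forall i, 0 < r i) ->
  (forall i, r i.+1 <= r i) -> monotone_skeleton f r J tau ->
  forall (x y : R) i (a : nat), (i <= J)%N -> 0 <= x -> y < 1 -> x < a%:R / 2 ^+ i <= y ->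
  r i <= tau (Num.truncn (y * 2 ^+ J)) - tau (Num.truncn (x * 2 ^+ J)).
Proof.
move=> r0 rdec sk x y i a iJ x0 y1 /andP[xa ay].
have rmono j k : (j <= k)%N -> r k <= r j.
  move=> /subnK <-; elim: (k - j)%N => [//|n IH]; rewrite addSn.
  exact: le_trans IH.
have [_ _ tauP] := sk.
have p2 n : 0 < 2 ^+ n :> R by rewrite exprn_gt0.
have a0 : (0 < a)%N.
  rewrite lt0n; apply/eqP => a0; move: xa; rewrite a0 mul0r.
  by rewrite ltNge x0.
pose c := (a * 2 ^ (J - i))%N.
have c0 : (0 < c)%N by rewrite muln_gt0 a0 expn_gt0.
have cE : a%:R / 2 ^+ i * 2 ^+ J = c%:R :> R.
  rewrite /c natrM natrX -{1}(subnK iJ) exprD [_ ^+ _ * 2 ^+ i]mulrC mulrA.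
  by rewrite divfK// gt_eqF.
have cy : (c <= Num.truncn (y * 2 ^+ J))%N.
  rewrite truncn_ge_nat -?cE ?ler_pM2r//.
  by apply: (@le_trans _ _ c%:R); rewrite // -cE ler_pM2r.
have xc : (Num.truncn (x * 2 ^+ J) <= c.-1)%N.
  by rewrite truncn_le_nat prednK// -cE ltr_pM2r.
have yJ := truncn_dyadic_le J y1.
have cJ : (c <= (2 ^ J).-1)%N by exact: leq_trans yJ.
have [|t1 _] := tauP c.-1; first by rewrite prednK// -[(2 ^ J)%N]prednK ?expn_gt0.
rewrite prednK// in t1.
have [t2 _] := skeleton_mono r0 sk (introT andP (conj xc (leq_trans (leq_pred _) cJ))).
have [t3 _] := skeleton_mono r0 sk (introT andP (conj cy yJ)).
have t4 : r i <= r (J - logn 2 c)%N.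
  apply: rmono; rewrite leq_subLR /c lognM ?expn_gt0// pfactorK//.
  by rewrite -addnA subnK// leq_addl.
by move: t1 t2 t3 t4; clear; lra.
Qed.

Lemma skeleton_itv (f : R -> 'rV[R]_2) r J tau : (forall i, 0 < r i) ->
  monotone_skeleton f r J tau ->
  forall k, (k <= (2 ^ J).-1)%N -> 0 <= tau k <= 1.
Proof.
move=> r0 sk k kJ; have [t0 t1 _] := sk; apply/andP; split.
  by apply: (le_trans t0); have [] := skeleton_mono r0 sk (introT andP (conj (leq0n k) kJ)).
by apply: le_trans t1; have [] := skeleton_mono r0 sk (introT andP (conj kJ (leqnn _))).
Qed.

(** The limit of the skeletons along an ultrafilter keeps all gaps and, by
    continuity, the monotonicity of [f]. *)
Lemma monotone_set_of_skeletons (f : R -> 'rV[R]_2) r :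
  (forall i, {within `[0, 1], continuous (fun t => f t ord0 i)}) ->
  (forall i, 0 < r i) -> (forall i, r i.+1 <= r i) -> (forall i, r i <= 2 ^- i) ->
  (forall s, 0 <= s < 1 / 3 ->
     exists i0, forall i, (i0 <= i)%N -> 2 ^- i <= r i `^ s) ->
  (forall n, exists2 J, (n <= J)%N & exists tau, monotone_skeleton f r J tau) ->
  exists D : set R, [/\ compact D, D `<=` `[0, 1], nondecreasing_on D f &
    ((1 / 3)%:E <= hausdorff_dim D)%E].
Proof.
move=> fc r0 rdec rle rs skel.
have /choice[Jt HJt] : forall n, exists q : nat * (nat -> R),
    (n <= q.1)%N /\ monotone_skeleton f r q.1 q.2.
  by move=> n; have [J nJ [tau sk]] := skel n; exists (J, tau).
(* one ultrafilter provides limits at all points simultaneously *)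
have [U [UU NU]] := @ultraFilterLemma nat \oo _.
pose hn (x : R) n := (Jt n).2 (Num.truncn (x * 2 ^+ (Jt n).1)).
have hn01 (x : R) n : x < 1 -> 0 <= hn x n <= 1.
  move=> x1; have [_ sk] := HJt n.
  exact: (skeleton_itv r0 sk (truncn_dyadic_le _ x1)).
have /choice[h Hh] : forall x : R, exists p : R, x < 1 -> (0 <= p <= 1) /\ hn x @ U --> p.
  move=> x; have [x1|] := boolP (x < 1); last by exists 0.
  have [p p01 cp] := ultra_cvg_segment UU (fun n => hn01 x n x1).
  by exists p.
have hmono (x y : R) : x <= y -> y < 1 -> h x <= h y.
  move=> xy y1; have [_ cx] := Hh x (le_lt_trans xy y1); have [_ cy] := Hh y y1.
  apply: ler_cvg_to cx cy _; apply: filterE => n.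
  have [_ sk] := HJt n.
  by have [] := skeleton_mono r0 sk (introT andP (conj (le_truncn_dyadic _ xy) (truncn_dyadic_le _ y1))).
have fcw i (z : R) (V : set R) : `[0, 1]%classic z -> nbhs (f z ord0 i) V ->
    nbhs z [set u | `[0, 1]%classic u -> V (f u ord0 i)].
  by move=> z01 Vz; have /subspace_continuousP/(_ z z01 V Vz) := fc i.
have fcvg i (x : R) : x < 1 -> (fun n => f (hn x n) ord0 i) @ U --> f (h x) ord0 i.
  move=> x1; have [h01 cx] := Hh x x1.
  move=> V HV.
  have hx01 : `[0, 1]%classic (h x) by rewrite /= in_itv.
  have HW : nbhs (h x) [set z | `[0, 1]%classic z -> V (f z ord0 i)] := fcw i (h x) V hx01 HV.
  have HU : U (hn x @^-1` [set z | `[0, 1]%classic z -> V (f z ord0 i)]) := cx _ HW.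
  suff : U [set n | V (f (hn x n) ord0 i)] by [].
  by apply: filterS HU => n; apply; have := hn01 x n x1; rewrite /= in_itv.
have fmono i (x y : R) : x <= y -> y < 1 -> f (h x) ord0 i <= f (h y) ord0 i.
  move=> xy y1; apply: ler_cvg_to (fcvg i x (le_lt_trans xy y1)) (fcvg i y y1) _.
  apply: filterE => n; have [_ sk] := HJt n.
  have [_] := skeleton_mono r0 sk (introT andP (conj (le_truncn_dyadic _ xy) (truncn_dyadic_le _ y1))).
  exact.
have gap (x y : R) i (a : nat) : 0 <= x -> y < 1 -> x < a%:R / 2 ^+ i <= y ->
    r i <= h y - h x.
  move=> x0 y1 xay; have x1 : x < 1.
    by case/andP: xay => xa ay; apply: lt_trans y1; exact: lt_le_trans ay.
  have [_ cx] := Hh x x1; have [_ cy] := Hh y y1.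
  apply: ler_cvg_to (cvg_cst (r i)) (cvgB cy cx) _.
  apply: NU; exists i => // n /= ni; have [nJ sk] := HJt n.
  exact: (skeleton_gap r0 rdec sk (leq_trans ni nJ) x0 y1 xay).
pose D0 := h @` [set x : R | 0 <= x < 1].
have D01 : D0 `<=` `[0, 1]%classic.
  by move=> _ [x /= /andP[_ x1] <-]; rewrite in_itv/=; have [] := Hh x x1.
have cl01 : closed `[(0 : R), 1]%classic by exact: interval_closed.
have D1 : closure D0 `<=` `[0, 1]%classic.
  by move=> z /(closure_subset D01); rewrite -(closure_id _).1.
exists (closure D0); split => //.
- by apply: subclosed_compact D1; [exact: closed_closure|exact: segment_compact].
- move=> i s t; rewrite !inE => Ds Dt st.
  move: st; rewrite le_eqVlt => /orP[/eqP -> //|st].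
  rewrite leNgt; apply/negP => fts.
  (* near s and t there are points of the image with the same order of values *)
  pose c := (f s ord0 i + f t ord0 i) / 2.
  pose e := (s + t) / 2.
  have cont z (V : set R) : closure D0 z -> nbhs (f z ord0 i) V ->
      forall W : set R, nbhs z W -> exists x, [/\ 0 <= x < 1, W (h x) & V (f (h x) ord0 i)].
    move=> Dz Vz W Wz; have HV := fcw i z V (D1 z Dz) Vz.
    have [_ [[x x01 <-] [Vx Wx]]] := Dz _ (filterI HV Wz).
    by exists x; split => //; apply: Vx; apply: D01; exists x.
  have [x [x01 Wx Vx]] : exists x, [/\ 0 <= x < 1, h x < e & c < f (h x) ord0 i].
    apply: (cont s [set v | c < v] Ds _ [set u | u < e]).
      by apply: lt_nbhsr; rewrite /c; lra.
    by apply: lt_nbhsl; rewrite /e; lra.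
  have [y [y01 Wy Vy]] : exists x, [/\ 0 <= x < 1, e < h x & f (h x) ord0 i < c].
    apply: (cont t [set v | v < c] Dt _ [set u | e < u]).
      by apply: lt_nbhsl; rewrite /c; lra.
    by apply: lt_nbhsr; rewrite /e; lra.
  have [/andP[_ x1] /andP[_ y1]] := (x01, y01).
  have [xy|yx] := leP x y.
    by have := fmono i x y xy y1; rewrite leNgt (lt_trans Vy Vx).
  by have := hmono y x (ltW yx) x1; rewrite leNgt (lt_trans Wx Wy).
- apply: (hausdorff_dim_ge (h := h) r0 rdec _ rs gap).
    move=> e e0; exists (Num.truncn e^-1); apply: (le_trans (rle _)).
    rewrite -[leRHS]invrK lef_pV2 ?posrE ?exprn_gt0 ?invr_gt0//.
    apply: (le_trans (ltW (truncnS_gt _))).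
    by rewrite -natrX ler_nat ltn_expl.
  by move=> x x01; apply: subset_closure; exists x.
Qed.
End skeleton_limit.

(** * Almost sure existence *)

(** The intersections from [n] on increase with [n], and each of them lies in one of
    the events. *)
Lemma measure_eventually_le {R : realType} {d : measure_display}
    {T : measurableType d} (P : probability T R) (E : nat -> set T) (c : \bar R) :
  (forall n, measurable (E n)) -> (forall n, (P (E n) <= c)%E) ->
  (P (\bigcup_n \bigcap_(k in [set k | (n <= k)%N]) E k) <= c)%E.
Proof.
move=> mE PE; pose F n := \bigcap_(k in [set k | (n <= k)%N]) E k.
have mF n : measurable (F n) by exact: bigcap_measurableType.
have F_nd : nondecreasing_seq F.
  by move=> n m nm; apply/subsetPset => w Fw k /= mk; apply: Fw; exact: leq_trans mk.
have cvP := @nondecreasing_cvg_mu _ _ _ P _ mF (bigcup_measurable (fun n _ => mF n)) F_nd.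
have cvQ : (fun n => P (F n)) @ \oo --> P (\bigcup_n F n) := cvP.
rewrite -/(F) -(cvg_lim _ cvQ)//; apply: lime_le.
  by apply/cvg_ex; exists (P (\bigcup_n F n)).
apply: nearW => n; apply: le_trans (PE n); apply: le_measure; rewrite ?inE//.
by move=> w; apply => /=.
Qed.

Theorem theorem1p7 (R : realType) (d : measure_display) (T : measurableType d)
    (P : probability T R) (B : R -> T -> 'rV[R]_2) (HB : standard_BM P B) :
  {ae P, forall w : T, exists D : set R,
    [/\ compact D, D `<=` `[0, 1],
        nondecreasing_on D (fun t => B t w) &
        ((1 / 3)%:E <= hausdorff_dim D)%E]}.
Proof.
pose rho m : R := m.+1%:R^-1.
have rho01 m : 0 < rho m <= 1.
  by rewrite /rho invr_gt0 ltr0n/= invf_le1// ler1n.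
have /choice[r Hr] := fun m => skeleton_probability HB (rho01 m).
have /choice[E HE] : forall m, exists E : nat -> set T, forall J,
    [/\ measurable (E J), (P (E J) <= (2 * rho m)%:E)%E &
      forall w, ~ E J w -> exists tau, monotone_skeleton (B^~ w) (r m) J tau].
  by move=> m; have [_ _ _ _ /choice[E HE]] := Hr m; exists E.
pose F m := \bigcup_n \bigcap_(k in [set k | (n <= k)%N]) E m k.
have mF m : measurable (F m).
  by apply: bigcup_measurable => n _; apply: bigcap_measurableType => k _; have [] := HE m k.
have PF m : (P (F m) <= (2 * rho m)%:E)%E.
  by apply: measure_eventually_le => n; have [] := HE m n.
have good : {ae P, forall w, exists m, ~ F m w}.
  exists (\bigcap_m F m); split.
  - by apply: bigcap_measurableType => m _; exact: mF.
  - apply/eqP; rewrite eq_le measure_ge0 andbT.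
    apply/lee_addgt0Pr => e e0; rewrite add0e.
    pose m := Num.truncn (2 / e).
    have h : 2 * rho m <= e.
      by rewrite /rho ler_pdivrMr// mulrC -ler_pdivrMr// ltW// truncnS_gt.
    apply: (le_trans _ (le_trans (PF m) _)); last by rewrite lee_fin.
    apply: le_measure; rewrite ?inE//; first by apply: bigcap_measurableType => i _; exact: mF.
    by move=> w; apply.
  - move=> w /= nw m _; apply: contrapT => nF; apply: nw; by exists m.
have cont0 := BM_continuous (BM_coordinates HB ord0).
have cont1 := BM_continuous (BM_coordinates HB ord_max).
move: good cont0 cont1; apply: filterS3 => w [m Fmw] c0 c1.
have [r0 rdec rle rs _] := Hr m.
apply: (monotone_set_of_skeletons _ r0 rdec rle rs).
  move=> i; have [->//|i0] := eqVneq i ord0.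
  by have -> : i = ord_max by apply/val_inj; move: i0; case: i => -[|[|]].
move=> n; apply: contrapT => nJ; apply: Fmw; exists n => // k /= nk.
apply: contrapT => nE; apply: nJ; exists k => //.
by have [_ _] := HE m k; apply.
Qed.
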